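(* Let $Z$ and $\Upsilon$ be a holomorphic vector field and holomorphic volume form, respectively, on a complex $n$-manifold $M$, and let $p\in M$ be a singular point of $Z$. If there exists a gradient Kähler Ricci soliton $g$ with Ricci potential $f$ on a neighborhood of $p$ whose associated holomorphic vector field and volume form are $Z$ and $\Upsilon$, respectively, then there exist $\mathsf h=(h_1,\ldots,h_n)\in\mathbb R^n$ and a $p$-centered holomorphic chart $z=(z^i):U\to\mathbb C^n$ such that, on $U$, $$Z=\sum_{i=1}^n h_i\,z^i\,\frac{\partial}{\partial z^i}\qquad\text{and}\qquad \Upsilon=dz^1\wedge\cdots\wedge dz^n .$$
   Context: A gradient Kähler Ricci soliton is a Kähler metric $g$ for which there exists a real-valued function $f$ (a Ricci potential) with $\mathrm{Ric}(g)=\nabla^2 f$. In local holomorphic coordinates $g=g_{i\bar j}\,dz^i\circ d\bar z^j$ (with $a\circ b=\frac12(a\otimes b+b\otimes a)$) and the Kähler form is $\Omega=\frac i2 g_{i\bar j}\,dz^i\wedge d\bar z^j$. The associated holomorphic vector field of $(g,f)$ is $Z=\frac12(\nabla f-iJ(\nabla f))$. A holomorphic volume form (nowhere-vanishing holomorphic $n$-form) $\Upsilon$ is associated to $(g,f)$ if $\frac1{n!}\Omega^n=\left(\frac{i^n}{2}\right)^n e^{-f}\,\Upsilon\wedge\overline\Upsilon$. A singular point of $Z$ is a zero of $Z$. *)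

(* Defs.v *)
From HB Require Import structures.
From mathcomp Require Import all_boot all_order all_algebra perm.
From mathcomp Require Import complex.
From mathcomp Require Import all_classical all_reals all_analysis.
Set Implicit Arguments.
Unset Strict Implicit.
Unset Printing Implicit Defensive.
Import Order.TTheory GRing.Theory Num.Theory.
Import numFieldNormedType.Exports.

Local Open Scope classical_set_scope.
Local Open Scope complex_scope.
Local Open Scope ring_scope.

(* [R[i]] packaged as a field: [R[i]] itself is not recognized as a normed
   module over itself, whereas any [numClosedFieldType] is. *)
Definition Cx (R : realType) : numClosedFieldType := R[i].

Section RealGeometry.
Context {R : realType} {m : nat}.
Implicit Types (u f : 'rV[R]_m -> R) (G : 'rV[R]_m -> 'M[R]_m) (y : 'rV[R]_m).

Definition frame (a : 'I_m) : 'rV[R]_m := delta_mx 0 a.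

Definition pderiv (a : 'I_m) u : 'rV[R]_m -> R := fun y => 'D_(frame a) u y.

(* C^infinity on an open set: all iterated partial derivatives exist and are
   continuous. *)
Definition smooth_on (D : set 'rV[R]_m) u : Prop :=
  forall (s : seq 'I_m) y, D y ->
    {for y, continuous (foldr pderiv u s)} /\
    forall a, derivable (foldr pderiv u s) y (frame a).

(* Gamma^k_{ij} *)
Definition christoffel G (k i j : 'I_m) y : R :=
  2^-1 * \sum_l invmx (G y) k l *
    (pderiv i (fun w => G w j l) y + pderiv j (fun w => G w i l) y
     - pderiv l (fun w => G w i j) y).

(* The l-th component of R(d_i, d_j) d_k, for
   R(X, Y) = [nabla_X, nabla_Y] - nabla_[X, Y]. *)
Definition riemann G (l k i j : 'I_m) y : R :=
  pderiv i (christoffel G l j k) y - pderiv j (christoffel G l i k) y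
  + \sum_p (christoffel G l i p y * christoffel G p j k y
            - christoffel G l j p y * christoffel G p i k y).

(* Ric(d_j, d_k) = tr (X |-> R(X, d_j) d_k) *)
Definition ricci G y : 'M[R]_m :=
  \matrix_(j, k) \sum_i riemann G i k i j y.

Definition hessian G f y : 'M[R]_m :=
  \matrix_(i, j) (pderiv i (pderiv j f) y
                  - \sum_k christoffel G k i j y * pderiv k f y).

Definition gradient G f y : 'rV[R]_m :=
  \row_k \sum_l invmx (G y) k l * pderiv l f y.

End RealGeometry.

Section Forms.
Context {R : realType} {m : nat}.

(* Values on k tangent vectors; multilinearity and antisymmetry hold for the
   forms built below and are not part of the type. *)
Definition form (k : nat) := ('I_k -> 'rV[R]_m) -> Cx R.

Definition wedge (k l : nat) (a : form k) (b : form l) : form (k + l) :=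
  fun v => (k`!%:R * l`!%:R)^-1 *
    \sum_(s : 'S_(k + l)) (-1) ^+ s * (a (fun i => v (s (lshift l i)))
                                       * b (fun j => v (s (rshift k j)))).

Fixpoint wedge_pow (a : form 2) (k : nat) : form (k * 2) :=
  match k with
  | 0 => fun=> 1
  | k'.+1 => wedge a (@wedge_pow a k')
  end.

Definition dirder (v : 'rV[R]_m) (u : 'rV[R]_m -> Cx R) (y : 'rV[R]_m) : Cx R :=
  'D_v (fun w => complex.Re (u w)) y +i* 'D_v (fun w => complex.Im (u w)) y.

(* Exterior derivative, evaluated on constant vector fields, whose brackets
   vanish. *)
Definition ext_deriv (k : nat) (w : 'rV[R]_m -> form k) :
    'rV[R]_m -> form k.+1 :=
  fun y v => \sum_(i < k.+1)
    (-1) ^+ i * dirder (v i) (fun x => w x (fun j => v (lift i j))) y.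

End Forms.
Arguments form : clear implicits.
Arguments wedge_pow {R m} a k : rename.

(** Linear algebra on C^n = R^(n + n).

   A real tangent vector has components in the frame
   d/dx^1, ..., d/dx^n, d/dy^1, ..., d/dy^n, where z^j = x^j + i y^j. *)

Section ComplexCoordinates.
Context {R : realType} {n : nat}.
Implicit Type H : 'M[Cx R]_n.

Definition to_complex (v : 'rV[R]_(n + n)) : 'rV[Cx R]_n :=
  \row_j (v 0 (lshift n j) +i* v 0 (rshift n j)).

Definition dz (j : 'I_n) (v : 'rV[R]_(n + n)) : Cx R := to_complex v 0 j.
Definition dzbar (j : 'I_n) (v : 'rV[R]_(n + n)) : Cx R := Num.conj (dz j v).

Definition form1 (l : 'rV[R]_(n + n) -> Cx R) : form R (n + n) 1 :=
  fun v => l (v ord0).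

Definition Jrot (v : 'rV[R]_(n + n)) : 'rV[R]_(n + n) :=
  row_mx (- rsubmx v) (lsubmx v).

(* g_{i jbar} dz^i o dzbar^j with a o b = (a (x) b + b (x) a) / 2 *)
Definition metric_form H (u v : 'rV[R]_(n + n)) : Cx R :=
  \sum_i \sum_j H i j *
    (2^-1 * (dz i u * dzbar j v + dzbar j u * dz i v)).

(* Real Gram matrix; [metric_form H] is real-valued when H is Hermitian. *)
Definition real_metric H : 'M[R]_(n + n) :=
  \matrix_(a, b) complex.Re (metric_form H (frame a) (frame b)).

Definition kahler_form H : form R (n + n) 2 :=
  fun v => ('i / 2) *
    \sum_i \sum_j H i j * wedge (form1 (dz i)) (form1 (dzbar j)) v.

(* c dz^1 /\ ... /\ dz^n and its conjugate *)
Definition hol_top_form (c : Cx R) : form R (n + n) n :=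
  fun v => c * \det (\matrix_(i, j) dz j (v i)).
Definition conj_form k (a : form R (n + n) k) : form R (n + n) k :=
  fun v => Num.conj (a v).

(* sum_j w_j d/dz^j as a complexified tangent vector, with
   d/dz^j = (d/dx^j - i d/dy^j) / 2 *)
Definition hol_vector (w : 'rV[Cx R]_n) : 'rV[Cx R]_(n + n) :=
  row_mx (2^-1 *: w) (- ('i / 2) *: w).

Definition complexify (v : 'rV[R]_(n + n)) : 'rV[Cx R]_(n + n) :=
  map_mx (real_complex R) v.

End ComplexCoordinates.

Record chart (R : realType) (n : nat) (T : topologicalType) := Chart {
  cdom : set T;
  cmap : T -> 'rV[Cx R]_n;
  cinv : 'rV[Cx R]_n -> T;
  cdom_open : open cdom;
  cimage_open : open (cmap @` cdom);
  cmapK : forall x, cdom x -> cinv (cmap x) = x;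
  cmap_continuous : {within cdom, continuous cmap};
  cinv_continuous : {within cmap @` cdom, continuous cinv} }.

Definition transition R n T (c d : chart R n T) : 'rV[Cx R]_n -> 'rV[Cx R]_n :=
  cmap d \o cinv c.

(* Holomorphic means complex (Frechet) differentiable at every point. *)
Definition compatible R n T (c d : chart R n T) : Prop :=
  forall x, cdom c x -> cdom d x ->
    differentiable (transition c d) (cmap c x) /\
    differentiable (transition d c) (cmap d x).

Record complex_manifold (R : realType) (n : nat) := ComplexManifold {
  space :> topologicalType;
  atlas : set (chart R n space);
  space_hausdorff : hausdorff_space space;
  space_second_countable : @second_countable space;
  atlas_cover : forall x, exists2 c, atlas c & cdom c x;
  atlas_compatible : forall c d, atlas c -> atlas d -> compatible c d }.

Definition hol_chart R n (M : complex_manifold R n) (c : chart R n M) : Prop :=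
  forall d, atlas d -> compatible c d.

Definition transition_jacobian R n T (c d : chart R n T) (x : T) :
    'M[Cx R]_n :=
  jacobian (transition c d) (cmap c x).

(** Tensor fields on M are given by their components in every holomorphic chart,
   subject to the transformation law; the values at points outside the domain
   of the chart, or at charts that are not holomorphic, are irrelevant.  The
   entry (i, j) of [transition_jacobian c d x] is d z_d^j / d z_c^i. *)

Record hol_vector_field R n (M : complex_manifold R n) := HolVectorField {
  vcomp : chart R n M -> M -> 'rV[Cx R]_n;
  vcomp_change : forall c d x, hol_chart c -> hol_chart d ->
    cdom c x -> cdom d x ->
    vcomp d x = vcomp c x *m transition_jacobian c d x;
  vcomp_hol : forall c x, hol_chart c -> cdom c x ->
    differentiable (vcomp c \o cinv c) (cmap c x) }.

Definition singular_point R n (M : complex_manifold R n)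
    (Z : hol_vector_field M) (p : M) : Prop :=
  forall c, hol_chart c -> cdom c p -> vcomp Z c p = 0.

(* In the chart c the form is [ucomp c] dz^1 /\ ... /\ dz^n. *)
Record hol_volume_form R n (M : complex_manifold R n) := HolVolumeForm {
  ucomp : chart R n M -> M -> Cx R;
  ucomp_change : forall c d x, hol_chart c -> hol_chart d ->
    cdom c x -> cdom d x ->
    ucomp c x = \det (transition_jacobian c d x) * ucomp d x;
  ucomp_hol : forall c x, hol_chart c -> cdom c x ->
    differentiable (ucomp c \o cinv c) (cmap c x);
  ucomp_neq0 : forall c x, hol_chart c -> cdom c x -> ucomp c x != 0 }.

Section Expression.
Context {R : realType} {n : nat} {M : complex_manifold R n}.
Implicit Types (W : set M) (c : chart R n M).

Definition local_dom W c : set 'rV[R]_(n + n) :=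
  [set y | exists2 x, cdom c x /\ W x & cmap c x = to_complex y].

Definition local_expr {A : Type} c (s : M -> A) : 'rV[R]_(n + n) -> A :=
  fun y => s (cinv c (to_complex y)).

End Expression.

(* [gcomp c] is the matrix (g_{i jbar}) in the chart c. *)
Record kahler_metric R n (M : complex_manifold R n) (W : set M) :=
  KahlerMetric {
  gcomp : chart R n M -> M -> 'M[Cx R]_n;
  gcomp_change : forall c d x, hol_chart c -> hol_chart d ->
    W x -> cdom c x -> cdom d x ->
    gcomp c x = transition_jacobian c d x *m gcomp d x
                *m (map_mx Num.conj (transition_jacobian c d x))^T;
  gcomp_hermitian : forall c x, hol_chart c -> W x -> cdom c x ->
    (map_mx Num.conj (gcomp c x))^T = gcomp c x;
  gcomp_pos : forall c x (v : 'rV[R]_(n + n)),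
    hol_chart c -> W x -> cdom c x ->
    v != 0 -> 0 < metric_form (gcomp c x) v v;
  gcomp_smooth : forall c i j, hol_chart c ->
    smooth_on (local_dom W c)
      (local_expr c (fun x => complex.Re (gcomp c x i j))) /\
    smooth_on (local_dom W c)
      (local_expr c (fun x => complex.Im (gcomp c x i j)));
  gcomp_closed : forall c y v, hol_chart c -> local_dom W c y ->
    ext_deriv (local_expr c (fun x => kahler_form (gcomp c x))) y v = 0 }.

Section Soliton.
Context {R : realType} {n : nat} {M : complex_manifold R n} {W : set M}.
Implicit Types (g : kahler_metric W) (f : M -> R) (c : chart R n M).

Definition local_metric g c : 'rV[R]_(n + n) -> 'M[R]_(n + n) :=
  local_expr c (fun x => real_metric (gcomp g c x)).

Definition gradient_soliton g f : Prop :=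
  forall c, hol_chart c ->
    smooth_on (local_dom W c) (local_expr c f) /\
    forall y, local_dom W c y ->
      ricci (local_metric g c) y =
      hessian (local_metric g c) (local_expr c f) y.

(* Z = (grad f - i J (grad f)) / 2 on W *)
Definition associated_vector_field g f (Z : hol_vector_field M) : Prop :=
  forall c y, hol_chart c -> local_dom W c y ->
    let X := gradient (local_metric g c) (local_expr c f) y in
    hol_vector (local_expr c (vcomp Z c) y) =
    2^-1 *: (complexify X - 'i *: complexify (Jrot X)).

(* Omega^n / n! = (i^n / 2)^n e^(-f) Upsilon /\ conj Upsilon on W.  The two
   sides have degrees n * 2 and n + n, which are equal but not convertible,
   so both are evaluated on the initial terms of a sequence of vectors. *)
Definition associated_volume_form g f (Ups : hol_volume_form M) : Prop :=
  forall c x (v : nat -> 'rV[R]_(n + n)), hol_chart c -> W x -> cdom c x ->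
    let Omega := kahler_form (gcomp g c x) in
    let U := hol_top_form (ucomp Ups c x) in
    (n`!%:R)^-1 * wedge_pow Omega n (fun i => v i) =
    ('i ^+ n / 2) ^+ n * (expR (- f x))%:C
      * wedge U (conj_form U) (fun i => v i).

End Soliton.

(* Main.v *)
Require Import Defs.
From HB Require Import structures.
From mathcomp Require Import all_boot all_order all_algebra fingroup perm.
From mathcomp Require Import sesquilinear spectral complex ring lra.
From mathcomp Require Import all_classical all_reals all_analysis.
Set Implicit Arguments.
Unset Strict Implicit.
Unset Printing Implicit Defensive.
Import Order.TTheory GRing.Theory Num.Theory.
Import numFieldNormedType.Exports.
Local Open Scope classical_set_scope.
Local Open Scope complex_scope.
Local Open Scope ring_scope.

(** Let [H] be the Hermitian matrix of [g] in a chart. The field [Z] is the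
   gradient of [f], the second differential of [f] is symmetric and the Kaehler
   form is closed; together this says that [i Z] is a Killing field
   ([killing_identity], [loc_killing]) along which [f] is constant. At the zero
   [p] of [Z] the Killing equation reduces to self-adjointness of the
   differential of [Z], hence there are linear coordinates at [p] in which [H] is
   standard and the differential of [Z] is [diag(h)] with [h] real
   ([orthonormal_chart]).

   To linearize [Z] one would average over the compact group of isometries
   generated by the flow of [i Z]. Euler steps [E x = x + i t Z(x)] take the
   place of the flow: since [i Z] is Killing, they distort the metric by
   [1 + O(t^2)] only ([euler_step_distortion]), so that [t^-2] of them stay
   in a fixed ball. The averages of [E^k (1 + i t diag(h))^-k] over [k < t^-2]
   conjugate [E] to its linear part up to [O(t^2)], and a limit [w] for [t]
   tending to 0 satisfies [dw(Z) = w diag(h)] and [dw(0) = 1]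
   ([euler_linearization], [linearizing_chart]).

   In such a chart let [u] be the coefficient of the volume form. The volume
   equation gives [|u|^2 = k e^f det H] with a constant [k]
   ([volume_density]). The maps [diag(e^(i t h))] preserve [f] and [H],
   hence [|u|]; the quotient of [u] and of its image under such a map is
   holomorphic of modulus 1, hence constant, so that [u] is annihilated by [Z]
   ([volume_invariant]). Therefore the map with first component the integral of
   [w_1 u(s w_1, w_2, ..., w_n)] over [0 <= s <= 1] and with the other
   components unchanged still intertwines [Z] with [diag(h)], and its Jacobian
   determinant is [u]; it is the last change of coordinates
   ([volume_coordinate]).

   Both limits are instances of Montel's theorem ([montel]). It rests on Cauchy's
   estimate, for which averages over the orbit of a root of unity close to 1
   replace the integral over a circle ([circle_defect], [cauchy_disc]). These
   arguments need continuous derivatives, while [Z] and the volume form are only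
   assumed complex differentiable; continuity is read off from the equations of
   the soliton ([field_chol], [volume_chol]). *)

(** * Complex numbers and the l^1 norm *)

Section Modulus.
Context {R : realType}.
Local Notation C := (Cx R).
Implicit Types (z w : C) (x : R).

(** [`|z|] is an element of [C]; estimates are made in the ordered field [R]. *)
Definition modulus z : R := complex.Re `|z|.
Definition rc x : C := x%:C.

Lemma normcR z : `|z| = rc (modulus z).
Proof. by rewrite /modulus /rc (normc_def (z : R[i])). Qed.

Lemma modulusE z : modulus z = Num.sqrt (complex.Re z ^+ 2 + complex.Im z ^+ 2).
Proof. by rewrite /modulus (normc_def (z : R[i])). Qed.

Lemma rc_le (a b : R) : (rc a <= rc b) = (a <= b).
Proof. by rewrite /rc; exact: (lecR a b). Qed.
Lemma rc_lt (a b : R) : (rc a < rc b) = (a < b).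
Proof. by rewrite /rc; exact: (ltcR a b). Qed.
Lemma rcD (a b : R) : rc (a + b) = rc a + rc b.
Proof. by apply/eqP; rewrite eq_complex /= addr0 !eqxx. Qed.
Lemma rcN (a : R) : rc (- a) = - rc a.
Proof. by apply/eqP; rewrite eq_complex /= oppr0 !eqxx. Qed.
Lemma rcB (a b : R) : rc (a - b) = rc a - rc b.
Proof. by rewrite rcD rcN. Qed.
Lemma rcM (a b : R) : rc (a * b) = rc a * rc b.
Proof. by apply/eqP; rewrite eq_complex /= !mulr0 mul0r subr0 addr0 !eqxx. Qed.
Lemma rc0 : rc 0 = 0. Proof. by []. Qed.
Lemma rc1 : rc 1 = 1. Proof. by []. Qed.
Lemma rcV (a : R) : rc a^-1 = (rc a)^-1.
Proof. exact: (fmorphV (real_complex R)). Qed.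
Lemma rc_nat k : rc k%:R = k%:R.
Proof. exact: (rmorph_nat (real_complex R)). Qed.
Lemma rcX (a : R) k : rc (a ^+ k) = rc a ^+ k.
Proof. exact: (rmorphXn (real_complex R)). Qed.
Lemma rc_eq0 (a : R) : (rc a == 0) = (a == 0).
Proof. by rewrite -rc0 eq_complex /= eqxx andbT. Qed.
Lemma rc_inj : injective rc. Proof. by move=> a b []. Qed.

Lemma reD z w : complex.Re (z + w) = complex.Re z + complex.Re w.
Proof. by case: z w => a b []. Qed.
Lemma imD z w : complex.Im (z + w) = complex.Im z + complex.Im w.
Proof. by case: z w => a b []. Qed.
Lemma reN z : complex.Re (- z) = - complex.Re z. Proof. by case: z. Qed.
Lemma imN z : complex.Im (- z) = - complex.Im z. Proof. by case: z. Qed.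
Lemma reB z w : complex.Re (z - w) = complex.Re z - complex.Re w.
Proof. by rewrite reD reN. Qed.
Lemma imB z w : complex.Im (z - w) = complex.Im z - complex.Im w.
Proof. by rewrite imD imN. Qed.
Lemma reM z w : complex.Re (z * w) = 
  complex.Re z * complex.Re w - complex.Im z * complex.Im w.
Proof. by case: z w => a b []. Qed.
Lemma imM z w : complex.Im (z * w) = 
  complex.Re z * complex.Im w + complex.Im z * complex.Re w.
Proof. by case: z w => a b [c d]; rewrite /= addrC. Qed.
Lemma re_rc x : complex.Re (rc x) = x. Proof. by []. Qed.
Lemma im_rc x : complex.Im (rc x) = 0. Proof. by []. Qed.
Lemma reZ x z : complex.Re (rc x * z) = x * complex.Re z.
Proof. by rewrite reM re_rc im_rc mul0r subr0. Qed.
Lemma imZ x z : complex.Im (rc x * z) = x * complex.Im z.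
Proof. by rewrite imM re_rc im_rc mul0r addr0. Qed.
Lemma re_sum I (r : seq I) (P : pred I) (F : I -> C) :
  complex.Re (\sum_(i <- r | P i) F i) = \sum_(i <- r | P i) complex.Re (F i).
Proof. by elim/big_rec2: _ => [//|i y1 y2 _ <-]; exact: reD. Qed.
Lemma conjE z : Num.conj z = (complex.Re z -i* complex.Im z)%C.
Proof. by case: z. Qed.
Lemma re_conj z : complex.Re (Num.conj z) = complex.Re z.
Proof. by rewrite conjE. Qed.
Lemma im_conj z : complex.Im (Num.conj z) = - complex.Im z.
Proof. by rewrite conjE. Qed.
Lemma imagE : 'i = (0 +i* 1)%C :> C.
Proof. by symmetry; exact: (complexiE R). Qed.
Lemma re_i z : complex.Re ('i * z) = - complex.Im z.
Proof. by rewrite reM imagE /= mul0r mul1r sub0r. Qed.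
Lemma im_i z : complex.Im ('i * z) = complex.Re z.
Proof. by rewrite imM imagE /= mul0r mul1r add0r. Qed.
Lemma complex_ext z w : complex.Re z = complex.Re w ->
  complex.Im z = complex.Im w -> z = w.
Proof. by case: z w => a b [c d] /= -> ->. Qed.

Lemma modulus_ge0 z : 0 <= modulus z.
Proof. by rewrite modulusE sqrtr_ge0. Qed.
Lemma modulusD z w : modulus (z + w) <= modulus z + modulus w.
Proof. by rewrite -rc_le rcD -!normcR ler_normD. Qed.
Lemma modulusM z w : modulus (z * w) = modulus z * modulus w.
Proof. by apply: rc_inj; rewrite rcM -!normcR normrM. Qed.
Lemma modulusN z : modulus (- z) = modulus z.
Proof. by rewrite /modulus normrN. Qed.
Lemma modulusX z k : modulus (z ^+ k) = modulus z ^+ k.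
Proof. by apply: rc_inj; rewrite rcX -!normcR normrX. Qed.
Lemma modulusV z : modulus z^-1 = (modulus z)^-1.
Proof. by apply: rc_inj; rewrite rcV -!normcR normfV. Qed.
Lemma modulus0 : modulus 0 = 0.
Proof. by rewrite /modulus normr0. Qed.
Lemma modulus1 : modulus 1 = 1.
Proof. by rewrite /modulus normr1. Qed.
Lemma modulus_rc x : modulus (rc x) = `|x|.
Proof. by rewrite modulusE /= expr0n /= addr0 sqrtr_sqr. Qed.
Lemma modulus_i : modulus 'i = 1.
Proof. by rewrite modulusE imagE /= expr0n add0r expr1n sqrtr1. Qed.
Lemma modulus_nat k : modulus k%:R = k%:R.
Proof. by rewrite -rc_nat modulus_rc normr_nat. Qed.
Lemma modulus_conj z : modulus (Num.conj z) = modulus z.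
Proof. by rewrite !modulusE re_conj im_conj sqrrN. Qed.
Lemma modulus_eq0 z : (modulus z == 0) = (z == 0).
Proof. by rewrite -rc_eq0 -normcR normr_eq0. Qed.
Lemma modulusB z w : modulus (z - w) = modulus (w - z).
Proof. by rewrite -modulusN opprB. Qed.
Lemma modulus_sum I (r : seq I) (P : pred I) (F : I -> C) :
  modulus (\sum_(i <- r | P i) F i) <= \sum_(i <- r | P i) modulus (F i).
Proof.
elim/big_rec2: _ => [|i y1 y2 _ h]; first by rewrite modulus0.
by apply: (le_trans (modulusD _ _)); rewrite lerD2l.
Qed.
Lemma re_le_modulus z : `|complex.Re z| <= modulus z.
Proof. by rewrite modulusE -sqrtr_sqr ler_sqrt ?lerDl ?addr_ge0 ?sqr_ge0. Qed.
Lemma im_le_modulus z : `|complex.Im z| <= modulus z.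
Proof. by rewrite modulusE -sqrtr_sqr ler_sqrt ?lerDr ?addr_ge0 ?sqr_ge0. Qed.
Lemma modulus_le z : modulus z <= `|complex.Re z| + `|complex.Im z|.
Proof.
rewrite [in leLHS](_ : z = rc (complex.Re z) + 'i * rc (complex.Im z)).
  by apply: (le_trans (modulusD _ _)); rewrite modulusM modulus_i mul1r !modulus_rc.
by apply: complex_ext; rewrite ?reD ?imD ?re_i ?im_i ?re_rc ?im_rc ?oppr0 ?addr0 ?add0r.
Qed.
Lemma mul_conj z : z * Num.conj z = rc (modulus z ^+ 2).
Proof. by rewrite -normCK normcR rcX. Qed.

(** A unit phase rotates a complex number onto the positive axis; it turns a
   norm inequality into one about real parts. *)
Lemma phaseP z : exists2 a : C, modulus a = 1 & a * z = rc (modulus z).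
Proof.
have [->|z0] := eqVneq z 0; first by exists 1; rewrite ?modulus1 // mulr0 modulus0.
have m0 : rc (modulus z) != 0 by rewrite rc_eq0 modulus_eq0.
exists (Num.conj z / rc (modulus z)).
  rewrite modulusM modulusV modulus_conj modulus_rc ger0_norm ?modulus_ge0 //.
  by rewrite divff // modulus_eq0.
by rewrite mulrAC [_ * z]mulrC mul_conj rcX expr2 mulfK.
Qed.

End Modulus.

Section Norm1.
Context {R : realType}.
Local Notation C := (Cx R).

(** The norm of ['rV[C]_n] takes its values in [C]. Of the equivalent real valued
   norms, the l^1 norm is additive over coordinates. *)
Definition norm1 n (x : 'rV[C]_n) : R := \sum_j modulus (x 0 j).

Variable n : nat.
Implicit Types x y : 'rV[C]_n.

Lemma norm1_ge0 x : 0 <= norm1 x.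
Proof. by apply: sumr_ge0 => j _; exact: modulus_ge0. Qed.
Lemma norm1D x y : norm1 (x + y) <= norm1 x + norm1 y.
Proof.
by rewrite /norm1 -big_split; apply: ler_sum => j _; rewrite mxE modulusD.
Qed.
Lemma norm1Z (a : C) x : norm1 (a *: x) = modulus a * norm1 x.
Proof. by rewrite /norm1 mulr_sumr; apply: eq_bigr => j _; rewrite mxE modulusM. Qed.
Lemma norm1N x : norm1 (- x) = norm1 x.
Proof. by apply: eq_bigr => j _; rewrite mxE modulusN. Qed.
Lemma norm10 : norm1 (0 : 'rV[C]_n) = 0.
Proof. by apply: big1 => j _; rewrite mxE modulus0. Qed.
Lemma norm1B x y : norm1 (x - y) = norm1 (y - x).
Proof. by rewrite -norm1N opprB. Qed.
Lemma norm1_coord x j : modulus (x 0 j) <= norm1 x.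
Proof.
rewrite /norm1 (bigD1 j) //= lerDl; apply: sumr_ge0 => k _; exact: modulus_ge0.
Qed.
Lemma norm1_eq0 x : (norm1 x == 0) = (x == 0).
Proof.
apply/idP/eqP => [/eqP h|->]; last by rewrite norm10.
apply/rowP => j; rewrite mxE; apply/eqP; rewrite -modulus_eq0.
by rewrite eq_le modulus_ge0 andbT -h norm1_coord.
Qed.
Lemma norm1_gt0 x : (0 < norm1 x) = (x != 0).
Proof. by rewrite lt_def norm1_ge0 andbT norm1_eq0. Qed.
Lemma norm1_triangle x y z : norm1 (x - z) <= norm1 (x - y) + norm1 (y - z).
Proof. by apply: le_trans (norm1D _ _); rewrite addrA subrK. Qed.
Lemma norm1_sum I (r : seq I) (P : pred I) (F : I -> 'rV[C]_n) :
  norm1 (\sum_(i <- r | P i) F i) <= \sum_(i <- r | P i) norm1 (F i).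
Proof.
elim/big_rec2: _ => [|i y1 y2 _ h]; first by rewrite norm10.
by apply: (le_trans (norm1D _ _)); rewrite lerD2l.
Qed.

Definition mnorm1 m (A : 'M[C]_(n, m)) : R := \sum_i \sum_j modulus (A i j).
Lemma mnorm1_ge0 m (A : 'M[C]_(n, m)) : 0 <= mnorm1 A.
Proof. by apply: sumr_ge0 => i _; apply: sumr_ge0 => j _; exact: modulus_ge0. Qed.
Lemma norm1_mulmx m x (A : 'M[C]_(n, m)) : norm1 (x *m A) <= norm1 x * mnorm1 A.
Proof.
rewrite /mnorm1 mulr_sumr.
apply: (@le_trans _ _ (\sum_i modulus (x 0 i) * \sum_j modulus (A i j))); last first.
  apply: ler_sum => i _; rewrite ler_wpM2r ?norm1_coord //.
  by apply: sumr_ge0 => j _; exact: modulus_ge0.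
under [leRHS]eq_bigr do rewrite mulr_sumr.
rewrite exchange_big /=; apply: ler_sum => j _; rewrite mxE.
apply: (le_trans (modulus_sum _ _ _)); apply: ler_sum => i _.
by rewrite modulusM.
Qed.
Lemma norm1_delta i : norm1 (delta_mx 0 i : 'rV[C]_n) = 1.
Proof.
rewrite /norm1 (bigD1 i) //= big1 ?addr0 => [|j ji].
  by rewrite !mxE !eqxx modulus1.
by rewrite !mxE (negbTE ji) andbF modulus0.
Qed.

Lemma nbhs_norm1P x (A : set 'rV[C]_n) : nbhs x A <->
  exists2 e : R, 0 < e & forall y, norm1 (y - x) < e -> A y.
Proof.
split=> [/nbhs_ballP[e /= e0 sA]|[e e0 sA]].
  have e' : e = rc (complex.Re e).
    by rewrite /rc RRe_real // gtr0_real.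
  exists (complex.Re e); first by rewrite -rc_lt -e'.
  move=> y xy; apply: sA; split=> // i j; rewrite /ball /= e' normcR rc_lt.
  rewrite modulusB; apply: le_lt_trans xy; rewrite (ord1 i).
  by have := norm1_coord (y - x) j; rewrite !mxE.
have d0 : 0 < e / (n%:R + 1) by rewrite divr_gt0 // ltr_wpDl.
apply/nbhs_ballP; exists (rc (e / (n%:R + 1))); first by rewrite /= -rc0 rc_lt.
move=> y xy; apply: sA.
apply: (@le_lt_trans _ _ (n%:R * (e / (n%:R + 1)))).
  rewrite mulr_natl -[n in _ *+ n]card_ord -sumr_const.
  apply: ler_sum => j _; rewrite ltW // !mxE modulusB.
  by have := xy.2 0 j; rewrite /ball /= normcR rc_lt.
rewrite mulrCA -[ltRHS]mulr1 ltr_pM2l // ltr_pdivrMr ?mul1r ?ltrDl //.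
Qed.

End Norm1.

(** * Real differentiability and mean value inequalities *)

Section RealDifferential.
Context {R : realType}.
Local Notation C := (Cx R).

Definition rlinear n (L : 'rV[C]_n -> C) : Prop :=
  forall (a : R) h k, L (rc a *: h + k) = rc a * L h + L k.

(** Real differentiability on [C^n]: it covers holomorphic maps, whose
   differential is given by a complex matrix ([cdiff], acting on row vectors),
   as well as the components of a Hermitian metric. *)
Definition rdiff n (G : 'rV[C]_n -> C) (x : 'rV[C]_n) (L : 'rV[C]_n -> C) :=
  rlinear L /\ forall e : R, 0 < e -> exists2 d : R, 0 < d &
    forall h, norm1 h < d -> modulus (G (x + h) - G x - L h) <= e * norm1 h.

Definition ccont n (G : 'rV[C]_n -> C) (x : 'rV[C]_n) :=
  forall e : R, 0 < e -> exists2 d : R, 0 < d &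
    forall y, norm1 (y - x) < d -> modulus (G y - G x) < e.

Definition vdiff n m (f : 'rV[C]_n -> 'rV[C]_m) x (L : 'rV[C]_n -> 'rV[C]_m) :=
  forall j, rdiff (fun y => f y 0 j) x (fun h => L h 0 j).

Definition cdiff n m (f : 'rV[C]_n -> 'rV[C]_m) x (J : 'M[C]_(n, m)) :=
  vdiff f x (fun h => h *m J).

Section Linear.
Variable n : nat.
Implicit Types L M : 'rV[C]_n -> C.

Lemma rlinearD L h k : rlinear L -> L (h + k) = L h + L k.
Proof. by move=> lL; have := lL 1 h k; rewrite rc1 scale1r mul1r. Qed.
Lemma rlinear0 L : rlinear L -> L 0 = 0.
Proof. by move=> lL; apply: (addrI (L 0)); rewrite -rlinearD // !addr0. Qed.
Lemma rlinearZ L (a : R) h : rlinear L -> L (rc a *: h) = rc a * L h.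
Proof. by move=> lL; have := lL a h 0; rewrite (rlinear0 lL) !addr0. Qed.
Lemma rlinearN L h : rlinear L -> L (- h) = - L h.
Proof.
by move=> lL; have := rlinearZ (-1) h lL; rewrite rcN rc1 scaleN1r mulN1r.
Qed.
Lemma rlinear_sum L I (r : seq I) (P : pred I) F : rlinear L ->
  L (\sum_(i <- r | P i) F i) = \sum_(i <- r | P i) L (F i).
Proof.
move=> lL; elim/big_rec2: _ => [|i y1 y2 _ <-]; first exact: rlinear0.
exact: rlinearD.
Qed.

Lemma rlinear_bound L : rlinear L ->
  exists2 K : R, 0 <= K & forall h, modulus (L h) <= K * norm1 h.
Proof.
move=> lL.
pose K := \sum_(j < n) (modulus (L (delta_mx 0 j)) + modulus (L ('i *: delta_mx 0 j))).
have K0 j : 0 <= modulus (L (delta_mx 0 j)) + modulus (L ('i *: delta_mx 0 j)).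
  by rewrite addr_ge0 ?modulus_ge0.
exists K => [|h]; first by apply: sumr_ge0.
rewrite {1}(row_sum_delta h) rlinear_sum // (le_trans (modulus_sum _ _ _)) //.
rewrite /K mulr_suml; apply: ler_sum => j _.
set d := delta_mx 0 j.
have -> : h 0 j *: d = rc (complex.Re (h 0 j)) *: d + rc (complex.Im (h 0 j)) *: ('i *: d).
  rewrite scalerA -scalerDl; congr (_ *: _); apply: complex_ext.
    by rewrite reD reZ imagE /= mulr0 addr0.
  by rewrite imD imZ imagE /= mulr1 add0r.
rewrite lL rlinearZ // (le_trans (modulusD _ _)) // !modulusM !modulus_rc mulrDl.
have hh := norm1_coord h j.
rewrite lerD // mulrC ler_wpM2l ?modulus_ge0 //; apply: le_trans hh.
  exact: re_le_modulus.
exact: im_le_modulus.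
Qed.

End Linear.

Section Rules.
Variable n : nat.
Implicit Types (G H : 'rV[C]_n -> C) (x : 'rV[C]_n) (L M : 'rV[C]_n -> C).

Lemma rdiff_eqL G x L M : (forall h, L h = M h) -> rdiff G x L -> rdiff G x M.
Proof. by move=> LM; have -> : M = L by apply/funext => h. Qed.

Lemma rdiff_near G H x L : (exists2 d : R, 0 < d & forall y, norm1 (y - x) < d ->
  G y = H y) -> rdiff G x L -> rdiff H x L.
Proof.
move=> [d d0 GH] [lL dG]; split=> // e e0; have [d' d'0 hd] := dG e e0.
exists (Num.min d d') => [|h]; first by rewrite lt_min d0.
rewrite lt_min => /andP[h1 h2]; rewrite -!GH ?hd ?subrr ?norm10 //.
by rewrite addrC addKr.
Qed.

Lemma rdiff_cst x (a : C) : rdiff (fun=> a) x (fun=> 0).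
Proof.
split=> [b h k|e e0]; first by rewrite mulr0 addr0.
by exists 1 => // h _; rewrite !subrr modulus0 mulr_ge0 ?norm1_ge0 // ltW.
Qed.

Lemma rdiff_lin x L : rlinear L -> rdiff L x L.
Proof.
move=> lL; split=> // e e0; exists 1 => // h _.
by rewrite rlinearD // [L x + _]addrC addrK subrr modulus0 mulr_ge0 ?norm1_ge0 // ltW.
Qed.

Lemma rdiffD G H x L M : rdiff G x L -> rdiff H x M ->
  rdiff (fun y => G y + H y) x (fun h => L h + M h).
Proof.
move=> [lL dG] [lM dH]; split=> [a h k|e e0].
  by rewrite lL lM mulrDr addrACA.
have e2 : 0 < e / 2 by rewrite divr_gt0.
have [d d0 hG] := dG _ e2; have [d' d'0 hH] := dH _ e2.
exists (Num.min d d') => [|h]; first by rewrite lt_min d0.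
rewrite lt_min => /andP[h1 h2].
rewrite (_ : _ - _ - _ = (G (x + h) - G x - L h) + (H (x + h) - H x - M h)); last ring.
by apply: (le_trans (modulusD _ _)); have := hG h h1; have := hH h h2; lra.
Qed.

Lemma rdiff_sum I (r : seq I) (G : I -> 'rV[C]_n -> C) x (L : I -> _) :
  (forall i, rdiff (G i) x (L i)) ->
  rdiff (fun y => \sum_(i <- r) G i y) x (fun h => \sum_(i <- r) L i h).
Proof.
move=> dG; elim: r => [|i r IH].
  have [-> ->] : (fun y => \sum_(i <- [::]) G i y) = (fun=> 0) /\
     (fun h => \sum_(i <- [::]) L i h) = (fun=> 0).
    by split; apply/funext => y; rewrite big_nil.
  exact: rdiff_cst.
have [-> ->] : (fun y => \sum_(k <- i :: r) G k y) = (fun y => G i y + \sum_(k <- r) G k y)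
   /\ (fun y => \sum_(k <- i :: r) L k y) = (fun y => L i y + \sum_(k <- r) L k y).
  by split; apply/funext => y; rewrite big_cons.
exact: rdiffD.
Qed.

Lemma rdiff_post G x L (T : C -> C) : (forall (a : R) u v, T (rc a * u + v) = rc a * T u + T v) ->
  (forall u, modulus (T u) <= modulus u) ->
  rdiff G x L -> rdiff (fun y => T (G y)) x (fun h => T (L h)).
Proof.
move=> lT bT [lL dG]; split=> [a h k|e e0]; first by rewrite lL lT.
have [d d0 hd] := dG e e0; exists d => // h hh; apply: le_trans (hd h hh).
have TB u v : T u - T v = T (u - v).
  by have := lT (-1) v u; rewrite rcN rc1 !mulN1r ![- _ + _]addrC => ->.
by rewrite !TB.
Qed.

Lemma rdiff_conj G x L : rdiff G x L ->
  rdiff (fun y => Num.conj (G y)) x (fun h => Num.conj (L h)).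
Proof.
apply: (@rdiff_post _ _ _ Num.conj) => [a u v|u]; last by rewrite modulus_conj.
by apply: complex_ext; rewrite !(re_conj, im_conj, reD, imD, reZ, imZ, opprD, mulrN).
Qed.

Lemma rdiff_re G x L : rdiff G x L ->
  rdiff (fun y => rc (complex.Re (G y))) x (fun h => rc (complex.Re (L h))).
Proof.
apply: (@rdiff_post _ _ _ (fun z => rc (complex.Re z))) => [a u v|u].
  by rewrite reD reZ rcD rcM.
by rewrite modulus_rc re_le_modulus.
Qed.

Lemma rdiff_lip G x L : rdiff G x L -> exists2 K : R, 0 < K & exists2 d : R, 0 < d &
  forall h, norm1 h < d -> modulus (G (x + h) - G x) <= K * norm1 h.
Proof.
move=> [lL dG]; have [K K0 bL] := rlinear_bound lL.
have [d d0 hd] := dG 1 ltr01; exists (K + 1); first by rewrite ltr_wpDl.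
exists d => // h hh.
rewrite (_ : _ - _ = (G (x + h) - G x - L h) + L h); last by rewrite subrK.
apply: (le_trans (modulusD _ _)); have := hd h hh; have := bL h; lra.
Qed.

Lemma rdiff_ccont G x L : rdiff G x L -> ccont G x.
Proof.
move=> /rdiff_lip[K K0 [d d0 hd]] e e0.
exists (Num.min d (e / K)) => [|y]; first by rewrite lt_min d0 divr_gt0.
rewrite lt_min ltr_pdivlMr // => /andP[h1 h2].
have := hd _ h1; rewrite [x + _]addrC subrK => /le_lt_trans; apply.
by rewrite mulrC.
Qed.

Lemma rdiffM G H x L M : rdiff G x L -> rdiff H x M ->
  rdiff (fun y => G y * H y) x (fun h => L h * H x + G x * M h).
Proof.
move=> dG dH; have [K K0 [d1 d10 lipG]] := rdiff_lip dG.
have cH := rdiff_ccont dH.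
case: dG dH => [lL dG] [lM dH]; split=> [a h k|e e0].
  by rewrite lL lM; ring.
pose a := modulus (H x) + 1; pose b := modulus (G x) + 1.
have a0 : 0 < a by rewrite ltr_wpDl ?modulus_ge0.
have b0 : 0 < b by rewrite ltr_wpDl ?modulus_ge0.
have [d2 d20 h2] := dG (e / 3 / a) ltac:(by rewrite !divr_gt0).
have [d3 d30 h3] := dH (e / 3 / b) ltac:(by rewrite !divr_gt0).
have [d4 d40 h4] := cH (e / 3 / K) ltac:(by rewrite !divr_gt0).
exists (Num.min (Num.min d1 d2) (Num.min d3 d4)) => [|h].
  by rewrite !lt_min d10 d20 d30.
rewrite !lt_min => /andP[/andP[k1 k2] /andP[k3 k4]].
rewrite (_ : _ - _ - _ = (G (x + h) - G x - L h) * H x + 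
  G x * (H (x + h) - H x - M h) + (G (x + h) - G x) * (H (x + h) - H x)); last ring.
have -> : e * norm1 h = e / 3 * norm1 h + e / 3 * norm1 h + e / 3 * norm1 h by field.
apply: (le_trans (modulusD _ _)); apply: lerD.
  apply: (le_trans (modulusD _ _)); apply: lerD.
    rewrite modulusM; apply: (@le_trans _ _ (e / 3 / a * norm1 h * a)).
      by apply: ler_pM; rewrite ?modulus_ge0 ?h2 // /a lerDl.
    by rewrite mulrAC divfK ?gt_eqF.
  rewrite modulusM mulrC; apply: (@le_trans _ _ (e / 3 / b * norm1 h * b)).
    by apply: ler_pM; rewrite ?modulus_ge0 ?h3 // /b lerDl.
  by rewrite mulrAC divfK ?gt_eqF.
rewrite modulusM mulrC; apply: (@le_trans _ _ (e / 3 / K * (K * norm1 h))).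
  apply: ler_pM; rewrite ?modulus_ge0 ?lipG //; apply/ltW/h4.
  by rewrite addrC addKr.
by rewrite mulrA divfK ?gt_eqF.
Qed.

Lemma rdiffZ G x L (a : C) : rdiff G x L -> rdiff (fun y => a * G y) x (fun h => a * L h).
Proof.
move=> dG; apply: rdiff_eqL (rdiffM (rdiff_cst x a) dG) => h.
by rewrite mul0r add0r.
Qed.

Lemma rdiffN G x L : rdiff G x L -> rdiff (fun y => - G y) x (fun h => - L h).
Proof.
move=> /(rdiffZ (-1)) d.
have -> : (fun y => - G y) = (fun y => -1 * G y) by apply/funext => y; rewrite mulN1r.
by apply: rdiff_eqL d => h; rewrite mulN1r.
Qed.

Lemma rdiffB G H x L M : rdiff G x L -> rdiff H x M ->
  rdiff (fun y => G y - H y) x (fun h => L h - M h).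
Proof. by move=> dG /rdiffN; exact: rdiffD. Qed.

Lemma rdiff_unique G x L M : rdiff G x L -> rdiff G x M -> forall h, L h = M h.
Proof.
move=> [lL dG] [lM dH] h; have [->|h0] := eqVneq h 0.
  by rewrite !rlinear0.
apply/eqP; rewrite -subr_eq0 -modulus_eq0 eq_le modulus_ge0 andbT.
apply/ler_addgt0Pl => e e0; rewrite addr0.
have nh : 0 < norm1 h by rewrite norm1_gt0.
have e2 : 0 < e / 2 / norm1 h by rewrite !divr_gt0.
have [d d0 h1] := dG _ e2; have [d' d'0 h2] := dH _ e2.
pose t := Num.min d d' / 2 / norm1 h.
have m0 : 0 < Num.min d d' by rewrite lt_min d0.
have t0 : 0 < t by rewrite !divr_gt0.
have nt : norm1 (rc t *: h) = Num.min d d' / 2.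
  by rewrite norm1Z modulus_rc gtr0_norm // /t divfK // gt_eqF.
have lt : norm1 (rc t *: h) < Num.min d d' by rewrite nt; lra.
move: (lt); rewrite lt_min => /andP[/h1 k1 /h2 k2].
have : modulus (L (rc t *: h) - M (rc t *: h)) <= e / norm1 h * norm1 (rc t *: h).
  rewrite (_ : L _ - M _ = (G (x + rc t *: h) - G x - M (rc t *: h)) -
    (G (x + rc t *: h) - G x - L (rc t *: h))); last ring.
  apply: (le_trans (modulusD _ _)); rewrite modulusN; move: k1 k2; lra.
rewrite !rlinearZ // -mulrBr modulusM modulus_rc gtr0_norm // norm1Z modulus_rc.
by rewrite gtr0_norm // mulrCA ler_pM2l // divfK // gt_eqF.
Qed.

End Rules.

Lemma vdiffP n m (f : 'rV[C]_n -> 'rV[C]_m) x L : vdiff f x L ->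
  forall e : R, 0 < e -> exists2 d : R, 0 < d &
    forall h, norm1 h < d -> norm1 (f (x + h) - f x - L h) <= e * norm1 h.
Proof.
move=> df e e0; have e' : 0 < e / (m%:R + 1) by rewrite divr_gt0 // ltr_wpDl.
have {}df j := (df j).2 _ e'.
pose D j := projT1 (cid2 (df j)).
have D0 j : 0 < D j by rewrite /D; case: cid2.
have hD j h : norm1 h < D j ->
  modulus (f (x + h) 0 j - f x 0 j - L h 0 j) <= e / (m%:R + 1) * norm1 h.
  by rewrite /D; case: cid2 => d /= _; apply.
exists (\big[Num.min/1]_j D j) => [|h hh].
  by elim/big_ind: _ => // a b a0 b0; rewrite lt_min a0.
apply: (@le_trans _ _ (m%:R * (e / (m%:R + 1) * norm1 h))).
  rewrite mulr_natl -[m in _ *+ m]card_ord -sumr_const.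
  apply: ler_sum => j _; rewrite !mxE; apply: hD; apply: (lt_le_trans hh).
  exact: bigmin_le_cond.
rewrite mulrA ler_wpM2r ?norm1_ge0 // mulrCA ler_piMr ?(ltW e0) //.
by rewrite ler_pdivrMr ?mul1r ?lerDl // ltr_wpDl.
Qed.

Lemma rdiff_comp n m (f : 'rV[C]_n -> 'rV[C]_m) (G : 'rV[C]_m -> C) x L M :
  vdiff f x L -> rdiff G (f x) M -> rdiff (fun y => G (f y)) x (fun h => M (L h)).
Proof.
move=> df dG; split=> [a h k|e e0].
  have -> : L (rc a *: h + k) = rc a *: L h + L k.
    by apply/rowP => j; rewrite !mxE; exact: (df j).1.
  exact: dG.1.
case: (dG) => lM hG; have [K K0 bM] := rlinear_bound lM.
have [B B0 bL] : exists2 B : R, 0 <= B & forall h, norm1 (L h) <= B * norm1 h.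
  have bL j := rlinear_bound (df j).1.
  exists (\sum_j projT1 (cid2 (bL j))) => [|h].
    by apply: sumr_ge0 => j _; case: cid2.
  rewrite mulr_suml; apply: ler_sum => j _; case: cid2 => b /= _; exact.
have K1 : 0 < K + 1 by rewrite ltr_wpDl.
have B1 : 0 < B + 1 by rewrite ltr_wpDl.
have [d d0 h1] := hG (e / 2 / (B + 1)) ltac:(by rewrite !divr_gt0).
pose e' := Num.min 1 (e / 2 / (K + 1)).
have e'0 : 0 < e' by rewrite lt_min ltr01 !divr_gt0.
have [d' d'0 h2] := vdiffP df e'0.
exists (Num.min d' (d / (B + 1))) => [|h].
  by rewrite lt_min d'0 divr_gt0.
rewrite lt_min ltr_pdivlMr // => /andP[hd' hd].
have lip : norm1 (f (x + h) - f x) <= (B + 1) * norm1 h.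
  rewrite -[f _ - _](subrK (L h)); apply: (le_trans (norm1D _ _)).
  rewrite mulrDl addrC lerD ?bL // (le_trans (h2 h hd')) // ler_wpM2r ?norm1_ge0 //.
  by rewrite ge_min lexx.
have hf : norm1 (f (x + h) - f x) < d by apply: le_lt_trans lip _; rewrite mulrC.
have := h1 _ hf; rewrite [f x + _]addrC subrK => h3.
rewrite (_ : _ - _ - _ = (G (f (x + h)) - G (f x) - M (f (x + h) - f x)) +
  M (f (x + h) - f x - L h)); last first.
  by rewrite [M (f _ - _ - L h)]rlinearD // rlinearN //; ring.
apply: (le_trans (modulusD _ _)).
have -> : e * norm1 h = e / 2 * norm1 h + e / 2 * norm1 h by field.
apply: lerD.
  apply: (le_trans h3); apply: (@le_trans _ _ (e / 2 / (B + 1) * ((B + 1) * norm1 h))).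
    by rewrite ler_wpM2l // ltW // !divr_gt0.
  by rewrite mulrA divfK // gt_eqF.
apply: (le_trans (bM _)); apply: (@le_trans _ _ ((K + 1) * (e / 2 / (K + 1) * norm1 h))).
  apply: ler_pM; rewrite ?norm1_ge0 ?lerDl // (le_trans (h2 h hd')) //.
  by rewrite ler_wpM2r ?norm1_ge0 // ge_min lexx orbT.
by rewrite mulrCA mulrA divfK // gt_eqF.
Qed.

Lemma vdiff_comp n m p (f : 'rV[C]_n -> 'rV[C]_m) (g : 'rV[C]_m -> 'rV[C]_p) x L M :
  vdiff f x L -> vdiff g (f x) M -> vdiff (fun y => g (f y)) x (fun h => M (L h)).
Proof. by move=> df dg j; exact: (rdiff_comp df (dg j)). Qed.

Lemma vdiff_eqL n m (f : 'rV[C]_n -> 'rV[C]_m) x L M :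
  (forall h, L h = M h) -> vdiff f x L -> vdiff f x M.
Proof. by move=> LM; have -> : M = L by apply/funext => h. Qed.

Lemma rlinear_coord n (a : C) j : rlinear (fun h : 'rV[C]_n => a * h 0 j).
Proof. by move=> b h k; rewrite !mxE mulrDr mulrCA. Qed.

Lemma vdiff_id n (x : 'rV[C]_n) : vdiff id x id.
Proof. by move=> j; apply: rdiff_lin => a h k; rewrite !mxE. Qed.

Lemma cdiff_comp n m p (f : 'rV[C]_n -> 'rV[C]_m) (g : 'rV[C]_m -> 'rV[C]_p) x A B :
  cdiff f x A -> cdiff g (f x) B -> cdiff (fun y => g (f y)) x (A *m B).
Proof.
move=> df dg; apply: vdiff_eqL (vdiff_comp df dg) => h.
by rewrite mulmxA.
Qed.

Lemma cdiffD n m (f g : 'rV[C]_n -> 'rV[C]_m) x A B :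
  cdiff f x A -> cdiff g x B -> cdiff (fun y => f y + g y) x (A + B).
Proof.
move=> df dg j; have := rdiffD (df j) (dg j).
rewrite (_ : (fun y => (f y + g y) 0 j) = (fun y => f y 0 j + g y 0 j)); last first.
  by apply/funext => y; rewrite mxE.
by apply: rdiff_eqL => h; rewrite mulmxDr [RHS]mxE.
Qed.

Lemma cdiff_mulr n m p (f : 'rV[C]_n -> 'rV[C]_m) (P : 'M[C]_(m, p)) x A :
  cdiff f x A -> cdiff (fun y => f y *m P) x (A *m P).
Proof.
move=> df; apply: (@cdiff_comp n m p f (fun z => z *m P) x A P df) => j.
apply: rdiff_lin => a h k.
by rewrite mulmxDl -scalemxAl !mxE.
Qed.

Lemma cdiff_cst n m (x : 'rV[C]_n) (a : 'rV[C]_m) : cdiff (fun=> a) x 0.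
Proof. by move=> j; apply: rdiff_eqL (rdiff_cst x (a 0 j)) => h; rewrite mulmx0 mxE. Qed.

Lemma cdiff_id n (x : 'rV[C]_n) : cdiff id x 1%:M.
Proof. by apply: vdiff_eqL (vdiff_id x) => h; rewrite mulmx1. Qed.

Lemma cdiffZ n m (f : 'rV[C]_n -> 'rV[C]_m) (a : C) x A :
  cdiff f x A -> cdiff (fun y => a *: f y) x (a *: A).
Proof.
move=> df j; have := rdiffZ a (df j).
rewrite (_ : (fun y => (a *: f y) 0 j) = (fun y => a * f y 0 j)); last first.
  by apply/funext => y; rewrite mxE.
by apply: rdiff_eqL => h; rewrite -scalemxAr [RHS]mxE.
Qed.

Lemma cdiff_sum n m I (r : seq I) (f : I -> 'rV[C]_n -> 'rV[C]_m) x A :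
  (forall i, cdiff (f i) x (A i)) ->
  cdiff (fun y => \sum_(i <- r) f i y) x (\sum_(i <- r) A i).
Proof.
move=> df j; have := rdiff_sum r (fun i => df i j).
rewrite (_ : (fun y => \sum_(i <- r) f i y 0 j) = (fun y => (\sum_(i <- r) f i y) 0 j)); last first.
  by apply/funext => y; rewrite summxE.
by apply: rdiff_eqL => h; rewrite mulmx_sumr [RHS]summxE.
Qed.

Lemma cdiff_unique n m (f : 'rV[C]_n -> 'rV[C]_m) x A B :
  cdiff f x A -> cdiff f x B -> A = B.
Proof.
move=> dA dB; apply/matrixP => i j.
have := rdiff_unique (dA j) (dB j) (delta_mx 0 i).
by rewrite -!rowE !mxE.
Qed.

End RealDifferential.

Lemma is_derive_epsP (R : realType) (V : normedModType R) (f : V -> R) a v (l : R) :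
  is_derive a v f l <-> (forall e : R, 0 < e -> exists2 d : R, 0 < d &
    forall s, `|s| < d -> `|f (a + s *: v) - f a - s * l| <= e * `|s|).
Proof.
split=> [[df dl] e e0|h].
  have /cvgrPdist_le /(_ e e0) : (fun s : R => s^-1 *: ((f \o shift a) (s *: v) - f a)) @ 0^' --> l.
    by rewrite -dl; exact: df.
  rewrite nearE /= => /nbhs_ballP[d /= d0 hd]; exists d => // s sd.
  have [->|s0] := eqVneq s 0; first by rewrite scale0r addr0 subrr mul0r subr0 normr0 mulr0.
  have := hd s; rewrite /ball /= sub0r normrN => /(_ sd s0).
  rewrite -(ler_pM2r (x := `|s|)) ?normr_gt0 // -normrM => hs; apply: le_trans hs.
  rewrite -[s^-1 *: _]/(s^-1 * _) mulrBl mulrAC mulVf // mul1r -normrN /= [s *: v + a]addrC.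
  by rewrite le_eqVlt; apply/orP; left; apply/eqP; congr (`|_|); ring.
have cv : (fun s : R => s^-1 *: ((f \o shift a) (s *: v) - f a)) @ 0^' --> l.
  apply/cvgrPdist_le => e e0; have [d d0 hd] := h e e0.
  near=> s.
  have s0 : s != 0 by near: s; exact: nbhs_dnbhs_neq.
  have sd : `|s| < d by near: s; exact: dnbhs0_lt.
  rewrite -(ler_pM2r (x := `|s|)) ?normr_gt0 // -normrM; apply: le_trans (hd s sd).
  rewrite -[s^-1 *: _]/(s^-1 * _) mulrBl mulrAC mulVf // mul1r -normrN /= [s *: v + a]addrC.
  by rewrite le_eqVlt; apply/orP; left; apply/eqP; congr (`|_|); ring.
by split; [apply/cvg_ex; exists l | exact: (cvg_lim _ cv)].
Unshelve. all: by end_near. Qed.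

Lemma real_mean_value (R : realType) (f df : R -> R) (a b : R) : a <= b ->
  (forall t, a <= t <= b -> is_derive t 1 f (df t)) ->
  exists2 c, a <= c <= b & f b - f a = df c * (b - a).
Proof.
move=> ab dfE; have [] := @MVT_segment R f df a b ab.
- by move=> x /[!in_itv]/= /andP[h1 h2]; apply: dfE; rewrite !ltW.
- apply: derivable_within_continuous => x /[!in_itv]/= /dfE[]; exact.
by move=> c /[!in_itv]/= hc e; exists c.
Qed.

Section MeanValue.
Context {R : realType}.
Local Notation C := (Cx R).

Lemma rdiff_line n (G : 'rV[C]_n -> C) x h L : rdiff G x L ->
  is_derive (0 : R) 1 (fun t : R => complex.Re (G (x + rc t *: h))) (complex.Re (L h)).
Proof.
move=> [lL hG]; apply/is_derive_epsP => e e0.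
have h1 : 0 < norm1 h + 1 by rewrite ltr_wpDl ?norm1_ge0.
have [d d0 hd] := hG (e / (norm1 h + 1)) ltac:(by rewrite divr_gt0).
exists (d / (norm1 h + 1)); first by rewrite divr_gt0.
move=> s; rewrite ltr_pdivlMr // => sd.
have nsh : norm1 (rc s *: h) = `|s| * norm1 h by rewrite norm1Z modulus_rc.
have /hd : norm1 (rc s *: h) < d.
  by rewrite nsh; apply: le_lt_trans sd; rewrite ler_wpM2l // lerDl.
rewrite rlinearZ // nsh => hs.
rewrite -[s *: 1]/(s * 1) mulr1 add0r rc0 scale0r addr0 -reZ -!reB.
apply: (le_trans (re_le_modulus _)); apply: (le_trans hs).
rewrite [leRHS]mulrC mulrCA ler_wpM2l //.
by rewrite mulrAC ler_pdivrMr // ler_wpM2l ?(ltW e0) // lerDl.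
Qed.

Lemma re_mean_value n (G : 'rV[C]_n -> C) (x h : 'rV[C]_n) (L : R -> 'rV[C]_n -> C) (K : R) :
  (forall t : R, 0 <= t <= 1 -> rdiff G (x + rc t *: h) (L t)) ->
  (forall t : R, 0 <= t <= 1 -> complex.Re (L t h) <= K) ->
  complex.Re (G (x + h) - G x) <= K.
Proof.
move=> dG bL; pose phi (t : R) := complex.Re (G (x + rc t *: h)).
have der (t : R) : 0 <= t <= 1 -> is_derive t 1 phi (complex.Re (L t h)).
  move=> /dG/(rdiff_line h)/is_derive_epsP hd; apply/is_derive_epsP => e e0.
  have [d d0 {}hd] := hd e e0; exists d; first exact: d0.
  move=> s /hd.
  rewrite add0r -[s *: 1]/(s * 1) mulr1 rc0 scale0r addr0 /phi rcD scalerDl.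
  by rewrite addrA.
have [c c01] := real_mean_value (@ler01 R) der.
by rewrite subr0 mulr1 /phi rc0 rc1 scale0r scale1r addr0 reB => ->; exact: bL.
Qed.

(** The l^1 norm of a vector is a real part of a functional of norm one, hence
    no constant is lost in passing from real to vector-valued functions. *)
Lemma vector_mean_value n m (f : 'rV[C]_n -> 'rV[C]_m) (x h : 'rV[C]_n) (L : R -> 'rV[C]_n -> 'rV[C]_m) (K : R) :
  (forall t : R, 0 <= t <= 1 -> vdiff f (x + rc t *: h) (L t)) ->
  (forall t : R, 0 <= t <= 1 -> norm1 (L t h) <= K) ->
  norm1 (f (x + h) - f x) <= K.
Proof.
move=> df bL; pose w := f (x + h) - f x.
pose a j := projT1 (cid2 (phaseP (w 0 j))).
have a1 j : modulus (a j) = 1 by rewrite /a; case: cid2.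
have aE j : a j * w 0 j = rc (modulus (w 0 j)) by rewrite /a; case: cid2.
pose G y := \sum_j a j * f y 0 j.
have dG (t : R) : 0 <= t <= 1 -> rdiff G (x + rc t *: h) (fun h => \sum_j a j * L t h 0 j).
  move=> /df dt; exact: (rdiff_sum (index_enum 'I_m) (fun j => rdiffZ (a j) (dt j))).
have -> : norm1 w = complex.Re (G (x + h) - G x).
  rewrite /G -sumrB re_sum; apply: eq_bigr => j _.
  by rewrite -mulrBr -[modulus _]re_rc -aE /w !mxE.
apply: (re_mean_value dG) => t t01; apply: le_trans (bL t t01).
rewrite re_sum; apply: ler_sum => j _; apply: le_trans (ler_norm _) _.
by apply: (le_trans (re_le_modulus _)); rewrite modulusM a1 mul1r.
Qed.
End MeanValue.

(** * Comparison with the Frechet differential *)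

Section Bridge.
Context {R : realType}.
Local Notation C := (Cx R).

Lemma norm_le_norm1 n (x : 'rV[C]_n) : `|x| <= rc (norm1 x).
Proof.
have [x0|/mx_norm_neq0[[i j] e]] := eqVneq (mx_norm x) 0.
  by rewrite -[`|x|]/(mx_norm x) x0 -rc0 rc_le norm1_ge0.
by rewrite -[`|x|]/(mx_norm x) e /= normcR rc_le (ord1 i) norm1_coord.
Qed.

Lemma coord_le_norm n (x : 'rV[C]_n) j : rc (modulus (x 0 j)) <= `|x|.
Proof.
rewrite -normcR -[`|x|]/(mx_norm x) mx_normE -[leLHS]nngE num_le.
exact: (le_bigmax _ (fun ij : 'I_1 * 'I_n => `|x ij.1 ij.2|%:nng) (0, j)).
Qed.

Lemma norm1_le_norm n (x : 'rV[C]_n) : rc (norm1 x) <= n%:R * `|x|.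
Proof.
rewrite /norm1 (_ : rc _ = \sum_j rc (modulus (x 0 j))).
  rewrite mulr_natl -[n in _ *+ n]card_ord -sumr_const; apply: ler_sum => j _.
  exact: coord_le_norm.
by elim/big_rec2: _ => [//|i y1 y2 _ <-]; rewrite rcD.
Qed.

Lemma gt0_rc (e : C) : 0 < e -> exists2 r : R, 0 < r & e = rc r.
Proof.
move=> e0; have e' : e = rc (complex.Re e) by rewrite /rc RRe_real // gtr0_real.
by exists (complex.Re e) => //; rewrite -rc_lt -e'.
Qed.

Lemma nbhs0_norm1 n (P : set 'rV[C]_n) : nbhs (0 : 'rV[C]_n) P <->
  exists2 d : R, 0 < d & forall h, norm1 h < d -> P h.
Proof.
split=> [/nbhs_norm1P[d d0 hd]|[d d0 hd]].
  by exists d; [by []|move=> h; rewrite -[h in norm1 h]subr0; exact: hd].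
by apply/nbhs_norm1P; exists d; [by []|move=> h; rewrite subr0; exact: hd].
Qed.

Lemma differentiable_rdiff n (F : 'rV[C]_n -> C) x : differentiable F x ->
  rdiff F x ('d F x).
Proof.
move=> /diff_locallyP[cd /eqaddoP h]; split=> [a u v|e e0].
  by rewrite linearD linearZ.
have /h : 0 < rc e by rewrite -rc0 rc_lt.
rewrite nearE => /nbhs0_norm1[d d0 hd]; exists d; [by []|move=> k /hd /=].
rewrite -[X in `|X|]/(F (k + x) - (F x + 'd F x k)) normcR opprD addrA [k + x]addrC => hk.
rewrite -rc_le rcM; apply: (le_trans hk); rewrite ler_wpM2l ?norm_le_norm1 //.
by rewrite -rc0 rc_le ltW.
Qed.

Lemma differentiable_cdiff n m (f : 'rV[C]_n -> 'rV[C]_m) x : differentiable f x ->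
  cdiff f x (jacobian f x).
Proof.
move=> /diff_locallyP[cd /eqaddoP h] j; split=> [a u v|e e0].
  by rewrite mulmxDl -scalemxAl !mxE.
have /h : 0 < rc e by rewrite -rc0 rc_lt.
rewrite nearE => /nbhs0_norm1[d d0 hd]; exists d; [by []|move=> k /hd /=].
rewrite -[X in `|X|]/(f (k + x) - (f x + 'd f x k)) opprD addrA [k + x]addrC => hk.
rewrite /jacobian mul_rV_lin1 -rc_le rcM.
have := coord_le_norm (f (x + k) - f x - 'd f x k) j; rewrite !mxE.
move/le_trans; apply; apply: (le_trans hk); rewrite ler_wpM2l ?norm_le_norm1 //.
by rewrite -rc0 rc_le ltW.
Qed.

Lemma cdiff_differentiable n m (f : 'rV[C]_n -> 'rV[C]_m) x J : cdiff f x J ->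
  differentiable f x /\ jacobian f x = J.
Proof.
move=> df; pose L : {linear 'rV[C]_n -> 'rV[C]_m} := mulmxr J.
have cL : continuous L.
  move=> y A /nbhs_norm1P[e e0 sA]; rewrite nbhs_filterE fmapE; apply/nbhs_norm1P.
  have k0 : 0 < mnorm1 J + 1 by rewrite ltr_wpDl ?mnorm1_ge0.
  exists (e / (mnorm1 J + 1)); first by rewrite divr_gt0.
  move=> z; rewrite ltr_pdivlMr // => hz; apply: sA; rewrite /= -mulmxBl.
  apply: le_lt_trans (norm1_mulmx _ _) _; apply: le_lt_trans hz.
  by rewrite ler_wpM2l ?norm1_ge0 // lerDl.
have o : f \o shift x = cst (f x) + L +o_ (0 : 'rV[C]_n) id.
  apply/eqaddoP => e0 /gt0_rc[e e0' ->].
  have e'0 : 0 < e / (n%:R + 1) by rewrite divr_gt0 // ltr_wpDl.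
  rewrite nearE; apply/nbhs0_norm1.
  have [d d0 hd] := vdiffP df e'0; exists d; [by []|move=> h /hd].
  rewrite -[X in _ -> `|X| <= _]/(f (h + x) - (f x + h *m J)) opprD addrA [h + x]addrC.
  move=> hh; apply: (le_trans (norm_le_norm1 _)).
  apply: (@le_trans _ _ (rc (e / (n%:R + 1) * norm1 h))); first by rewrite rc_le.
  rewrite rcM; apply: (@le_trans _ _ (rc (e / (n%:R + 1)) * (n%:R * `|h|))).
    by rewrite ler_wpM2l ?norm1_le_norm // -rc0 rc_le ltW.
  rewrite mulrA ler_wpM2r // -rc_nat -rcM rc_le mulrAC ler_pdivrMr ?ltr_wpDl //.
  by rewrite ler_wpM2l ?(ltW e0') // lerDl.
have dE : 'd f x = L :> (_ -> _) := diff_unique cL o.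
split; first by apply/diff_locallyP; rewrite dE.
apply/row_matrixP => i; rewrite !rowE /jacobian mul_rV_lin1.
by have := congr1 (fun F => F (delta_mx 0 i)) dE.
Qed.

Lemma ccont_cst n (a : C) (x : 'rV[C]_n) : ccont (fun=> a) x.
Proof. by move=> e e0; exists 1 => // y _; rewrite subrr modulus0. Qed.
Lemma ccontD n (G H : 'rV[C]_n -> C) x : ccont G x -> ccont H x ->
  ccont (fun y => G y + H y) x.
Proof.
move=> cG cH e e0; have e2 : 0 < e / 2 by rewrite divr_gt0.
have [d d0 hG] := cG _ e2; have [d' d'0 hH] := cH _ e2.
exists (Num.min d d') => [|y]; first by rewrite lt_min d0.
rewrite lt_min => /andP[/hG h1 /hH h2]; rewrite opprD addrACA.
by apply: le_lt_trans (modulusD _ _) _; lra.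
Qed.

Lemma ccontM n (G H : 'rV[C]_n -> C) x : ccont G x -> ccont H x ->
  ccont (fun y => G y * H y) x.
Proof.
move=> cG cH e e0; pose a := modulus (G x) + modulus (H x) + 1.
have a0 : 0 < a by rewrite ltr_wpDl ?addr_ge0 ?modulus_ge0.
pose e' := Num.min 1 (e / a).
have e'0 : 0 < e' by rewrite lt_min ltr01 divr_gt0.
have [d d0 hG] := cG _ e'0; have [d' d'0 hH] := cH _ e'0.
exists (Num.min d d') => [|y]; first by rewrite lt_min d0.
rewrite lt_min => /andP[/hG h1 /hH h2].
rewrite (_ : _ - _ = (G y - G x) * (H y - H x) + ((G y - G x) * H x + G x * (H y - H x))); last ring.
have h3 : modulus (G y - G x) <= 1 by apply: le_trans (ltW h1) _; rewrite ge_min lexx.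
apply: le_lt_trans (modulusD _ _) _.
apply: (@lt_le_trans _ _ (e' * a)); last by rewrite -ler_pdivlMr // ge_min lexx orbT.
rewrite /a [ltRHS]mulrDr mulr1 addrC ler_ltD //.
  apply: le_trans (modulusD _ _) _; rewrite !modulusM mulrDr addrC.
  by rewrite lerD // ?[modulus (G x) * _]mulrC ler_wpM2r ?modulus_ge0 // ltW.
by rewrite modulusM; apply: le_lt_trans h2; rewrite ler_piMl ?modulus_ge0.
Qed.

Lemma ccont_sum n I (r : seq I) (G : I -> 'rV[C]_n -> C) x :
  (forall i, ccont (G i) x) -> ccont (fun y => \sum_(i <- r) G i y) x.
Proof.
move=> cG; elim: r => [|i r IH].
  rewrite (_ : (fun y => _) = (fun=> 0)); first exact: ccont_cst.
  by apply/funext => y; rewrite big_nil.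
rewrite (_ : (fun y => _) = (fun y => G i y + \sum_(k <- r) G k y)); first exact: ccontD.
by apply/funext => y; rewrite big_cons.
Qed.
Lemma ccont_post n (G : 'rV[C]_n -> C) x (T : C -> C) :
  (forall u v, modulus (T u - T v) <= modulus (u - v)) ->
  ccont G x -> ccont (fun y => T (G y)) x.
Proof.
move=> hT cG e e0; have [d d0 hd] := cG e e0; exists d; [by []|move=> y /hd].
exact: le_lt_trans.
Qed.
Lemma ccontZ n (G : 'rV[C]_n -> C) x (a : C) : ccont G x -> ccont (fun y => a * G y) x.
Proof. by move=> cG; apply: ccontM => //; exact: ccont_cst. Qed.

Definition vcont n m (f : 'rV[C]_n -> 'rV[C]_m) x := forall j, ccont (fun y => f y 0 j) x.

Lemma vcontP n m (f : 'rV[C]_n -> 'rV[C]_m) x : vcont f x ->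
  forall e : R, 0 < e -> exists2 d : R, 0 < d &
    forall y, norm1 (y - x) < d -> norm1 (f y - f x) < e.
Proof.
move=> cf e e0; have e' : 0 < e / (m%:R + 1) by rewrite divr_gt0 // ltr_wpDl.
have {}cf j := cf j _ e'.
pose D j := projT1 (cid2 (cf j)).
have D0 j : 0 < D j by rewrite /D; case: cid2.
have hD j y : norm1 (y - x) < D j -> modulus (f y 0 j - f x 0 j) < e / (m%:R + 1).
  by rewrite /D; case: cid2 => d /= _; apply.
exists (\big[Num.min/1]_j D j) => [|h hh].
  by elim/big_ind: _ => // a b a0 b0; rewrite lt_min a0.
apply: (@le_lt_trans _ _ (m%:R * (e / (m%:R + 1)))).
  rewrite mulr_natl -[m in _ *+ m]card_ord -sumr_const.
  apply: ler_sum => j _; rewrite !mxE ltW //; apply: hD; apply: (lt_le_trans hh).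
  exact: bigmin_le_cond.
by rewrite mulrCA -[ltRHS]mulr1 ltr_pM2l // ltr_pdivrMr ?mul1r ?ltrDl // ltr_wpDl.
Qed.

Lemma ccont_comp n m (f : 'rV[C]_n -> 'rV[C]_m) (G : 'rV[C]_m -> C) x :
  vcont f x -> ccont G (f x) -> ccont (fun y => G (f y)) x.
Proof.
move=> cf cG e e0; have [d d0 hd] := cG e e0.
have [d' d'0 hd'] := vcontP cf d0; exists d'; [by []|move=> y /hd'; exact: hd].
Qed.

Lemma vdiff_vcont n m (f : 'rV[C]_n -> 'rV[C]_m) x L : vdiff f x L -> vcont f x.
Proof. by move=> df j; exact: rdiff_ccont (df j). Qed.

End Bridge.

(** * Ultralimits, uniform continuity and roots of unity *)

Section UltraLimit.
Context {R : realType}.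
Local Notation C := (Cx R).

(** Limits along a free ultrafilter exist for bounded sequences, with no need to
   pass to subsequences. *)
Definition ultra_nat : set_system nat := projT1 (cid (ultraFilterLemma eventually_filter)).

Lemma ultra_natP : UltraFilter ultra_nat.
Proof. by rewrite /ultra_nat; case: cid => U []. Qed.
#[local] Existing Instance ultra_natP.

Lemma ultra_nat_ge (q0 : nat) : ultra_nat [set q | (q0 <= q)%N].
Proof.
rewrite /ultra_nat; case: cid => U [_ sU] /=; apply: sU.
by exists q0.
Qed.

Lemma ultra_natI A B : ultra_nat A -> ultra_nat B -> ultra_nat (A `&` B).
Proof. exact: filterI. Qed.
Lemma ultra_natS (A B : set nat) : A `<=` B -> ultra_nat A -> ultra_nat B.
Proof. exact: filterS. Qed.
Lemma ultra_natT (A : set nat) : (forall q, A q) -> ultra_nat A.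
Proof. by move=> h; apply: ultra_natS filterT => q _; exact: h. Qed.

Lemma ultra_nat_ex (A : set nat) q0 : ultra_nat A -> exists2 q, (q0 <= q)%N & A q.
Proof.
move=> UA; have [q [h1 h2]] := @filter_ex _ _ _ _ (ultra_natI UA (ultra_nat_ge q0)).
by exists q.
Qed.

Lemma ultra_lim_real (a : nat -> R) B : (forall q, `|a q| <= B) ->
  exists l : R, forall e : R, 0 < e -> ultra_nat [set q | `|a q - l| < e].
Proof.
move=> aB; pose S := [set x : R | ultra_nat [set q | x <= a q]].
have SB : S (- B).
  by apply: ultra_natT => q /=; have := aB q; rewrite ler_norml => /andP[].
have uS : ubound S B.
  move=> x /(ultra_nat_ex 0)[q _ /le_trans]; apply.
  by have := aB q; rewrite ler_norml => /andP[].
have hS : has_sup S by split; [exists (- B) | exists B].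
exists (sup S) => e e0.
have h1 : ultra_nat [set q | sup S - e < a q].
  have [x Sx xs] := sup_adherent e0 hS.
  by apply: ultra_natS Sx => q /=; exact: lt_le_trans.
have h2 : ultra_nat [set q | a q < sup S + e].
  have [Sx|] := in_ultra_setVsetC [set q | sup S + e <= a q] ultra_natP.
    suff : sup S + e <= sup S by rewrite gerDl leNgt e0.
    by apply: ub_le_sup => //; exists B.
  by apply: ultra_natS => q /= /negP; rewrite ltNge.
by apply: ultra_natS (ultra_natI h1 h2) => q /= [k1 k2]; rewrite ltr_norml; lra.
Qed.

Definition ultra_lim n (a : nat -> 'rV[C]_n) (l : 'rV[C]_n) :=
  forall e : R, 0 < e -> ultra_nat [set q | norm1 (a q - l) < e].

Lemma ultra_nat_forall (I : finType) (P : I -> set nat) :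
  (forall i, ultra_nat (P i)) -> ultra_nat [set q | forall i, P i q].
Proof. by move=> h; apply: filter_forall. Qed.

Lemma ultra_lim_ex n (a : nat -> 'rV[C]_n) B : (forall q, norm1 (a q) <= B) ->
  exists l, ultra_lim a l.
Proof.
move=> aB.
have bre j q : `|complex.Re (a q 0 j)| <= B.
  by apply: le_trans (aB q); apply: le_trans (norm1_coord _ j); exact: re_le_modulus.
have bim j q : `|complex.Im (a q 0 j)| <= B.
  by apply: le_trans (aB q); apply: le_trans (norm1_coord _ j); exact: im_le_modulus.
pose lr j := projT1 (cid (ultra_lim_real (bre j))).
pose li j := projT1 (cid (ultra_lim_real (bim j))).
exists (\row_j ((lr j +i* li j)%C : C)) => e e0.
have e' : 0 < e / 2 / (n%:R + 1) by rewrite !divr_gt0 // ltr_wpDl.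
have hr : ultra_nat [set q | forall j, `|complex.Re (a q 0 j) - lr j| < e / 2 / (n%:R + 1)].
  by apply: ultra_nat_forall => j; rewrite /lr; case: cid => l /= /(_ _ e').
have hi : ultra_nat [set q | forall j, `|complex.Im (a q 0 j) - li j| < e / 2 / (n%:R + 1)].
  by apply: ultra_nat_forall => j; rewrite /li; case: cid => l /= /(_ _ e').
apply: ultra_natS (ultra_natI hr hi) => q /= [h1 h2].
apply: (@le_lt_trans _ _ (n%:R * (e / (n%:R + 1)))).
  rewrite mulr_natl -[n in _ *+ n]card_ord -sumr_const.
  apply: ler_sum => j _; rewrite !mxE; apply: (le_trans (modulus_le _)).
  rewrite reB imB /= ltW // (@lt_le_trans _ _ (e / 2 / (n%:R + 1) + e / 2 / (n%:R + 1))) //.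
    by rewrite ltrD ?h1 ?h2.
  by rewrite -mulrDl -splitr.
by rewrite mulrCA -[ltRHS]mulr1 ltr_pM2l // ltr_pdivrMr ?mul1r ?ltrDl // ltr_wpDl.
Qed.

Lemma ultra_lim_le n m (a : nat -> 'rV[C]_n) (b : nat -> 'rV[C]_m) la lb
  (T : 'rV[C]_n -> 'rV[C]_m -> R) K :
  ultra_lim a la -> ultra_lim b lb ->
  (exists2 c : R, 0 <= c & forall x y x' y', T x y <= T x' y' + c * (norm1 (x' - x) + norm1 (y' - y))) ->
  ultra_nat [set q | T (a q) (b q) <= K] -> T la lb <= K.
Proof.
move=> ha hb [c c0 hT] hK; apply/ler_addgt0Pl => e e0.
have e' : 0 < e / 2 / (c + 1) by rewrite !divr_gt0 // ltr_wpDl.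
have /(ultra_nat_ex 0)[q _ [[h1 h2] h3]] := ultra_natI (ultra_natI (ha _ e') (hb _ e')) hK.
have := hT la lb (a q) (b q); rewrite /= in h1 h2 h3.
have : c * (norm1 (a q - la) + norm1 (b q - lb)) <= e.
  apply: (@le_trans _ _ ((c + 1) * (e / 2 / (c + 1) + e / 2 / (c + 1)))).
    by apply: ler_pM; rewrite ?addr_ge0 ?norm1_ge0 ?lerDl // lerD // ltW.
  by rewrite -mulrDl -splitr mulrC divfK // gt_eqF // ltr_wpDl.
lra.
Qed.

(** If [d = 1/(q+1)] failed for every [q], there would be two sequences with
   a common ultralimit in the ball, at which [f] is not continuous. *)
Lemma uniform_continuity n m (f : 'rV[C]_n -> 'rV[C]_m) a r :
  (forall x, norm1 (x - a) <= r -> vcont f x) ->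
  forall e : R, 0 < e -> exists2 d : R, 0 < d & forall x y, norm1 (x - a) <= r ->
    norm1 (y - a) <= r -> norm1 (x - y) < d -> norm1 (f x - f y) <= e.
Proof.
move=> cf e e0; apply: contrapT => noD.
have ex q : exists xy : 'rV[C]_n * 'rV[C]_n, [/\ norm1 (xy.1 - a) <= r,
   norm1 (xy.2 - a) <= r, norm1 (xy.1 - xy.2) < q.+1%:R^-1 & e < norm1 (f xy.1 - f xy.2)].
  apply: contrapT => no; apply: noD; exists q.+1%:R^-1; first by rewrite invr_gt0.
  move=> x y hx hy hxy; rewrite leNgt; apply/negP => hf; apply: no.
  by exists (x, y).
pose s q := projT1 (cid (ex q)).
have sP q : [/\ norm1 ((s q).1 - a) <= r, norm1 ((s q).2 - a) <= r,
  norm1 ((s q).1 - (s q).2) < q.+1%:R^-1 & e < norm1 (f (s q).1 - f (s q).2)].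
  by rewrite /s; case: cid.
have [l hl] := @ultra_lim_ex _ (fun q => (s q).1 - a) r (fun q => let: And4 h _ _ _ := sP q in h).
have lr : norm1 l <= r.
  apply: (@ultra_lim_le _ _ _ _ _ _ (fun x y => norm1 x) _ hl hl).
    exists 1 => // x y x' y'; rewrite mul1r.
    have := norm1_triangle x x' 0; rewrite !subr0 norm1B.
    have := norm1_ge0 (y' - y); lra.
  by apply: ultra_natT => q /=; case: (sP q).
have ca : vcont f (a + l) by apply: cf; rewrite addrC addKr.
have e2 : 0 < e / 2 by rewrite divr_gt0.
have [d d0 hd] := vcontP ca e2.
have d2 : 0 < d / 2 by rewrite divr_gt0.
have [q0 hq0] : exists q0, q0.+1%:R^-1 < d / 2.
  exists (Num.truncn (d / 2)^-1); rewrite invf_plt ?posrE //.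
  exact: truncnS_gt.
have [q qq0 /= hq] := ultra_nat_ex q0 (hl _ d2).
have [_ _ h1 h2] := sP q.
have k1 : norm1 ((s q).1 - (a + l)) < d / 2 by rewrite opprD addrA.
have k2 : norm1 ((s q).1 - (s q).2) < d / 2.
  apply: (lt_trans h1); apply: le_lt_trans hq0.
  by rewrite lef_pV2 ?posrE // ler_nat.
have k3 : norm1 ((s q).2 - (a + l)) < d.
  have := norm1_triangle (s q).2 (s q).1 (a + l).
  by rewrite (norm1B (s q).2 (s q).1); lra.
have k4 : norm1 ((s q).1 - (a + l)) < d by lra.
have j1 := hd _ k4; have j2 := hd _ k3.
have := norm1_triangle (f (s q).1) (f (a + l)) (f (s q).2).
by rewrite (norm1B (f (a + l))); lra.
Qed.

End UltraLimit.

Section RootsOfUnity.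
Context {R : realType}.
Local Notation C := (Cx R).

Definition cis (t : R) : C := (cos t +i* sin t)%C.

Lemma cisD s t : cis (s + t) = cis s * cis t.
Proof.
apply: complex_ext; first by rewrite reM /= cosD.
by rewrite imM /= sinD addrC.
Qed.
Lemma cis0 : cis 0 = 1.
Proof. by rewrite /cis cos0 sin0. Qed.
Lemma modulus_cis t : modulus (cis t) = 1.
Proof. by rewrite modulusE /= cos2Dsin2 sqrtr1. Qed.
Lemma cisX t k : cis t ^+ k = cis (k%:R * t).
Proof.
elim: k => [|k IH]; first by rewrite mul0r cis0.
by rewrite exprS IH -cisD -[in RHS]natr1 mulrDl mul1r addrC.
Qed.

Lemma cis_near1 (d : R) : 0 < d -> exists2 e : R, 0 < e & forall t, `|t| < e -> modulus (cis t - 1) < d.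
Proof.
move=> d0; have d2 : 0 < d / 2 by rewrite divr_gt0.
have cc : {for 0, continuous (@cos R)} by exact: continuous_cos.
have cs : {for 0, continuous (@sin R)} by exact: continuous_sin.
have /cvgrPdist_lt /(_ _ d2) /nbhs_ballP [e1 /= e10 h1] := cc.
have /cvgrPdist_lt /(_ _ d2) /nbhs_ballP [e2 /= e20 h2] := cs.
exists (Num.min e1 e2); first by rewrite lt_min e10.
move=> t; rewrite lt_min => /andP[t1 t2].
apply: le_lt_trans (modulus_le _) _; rewrite reB imB /= subr0.
have := h1 t; rewrite /ball /= sub0r normrN cos0 => /(_ t1) k1.
have := h2 t; rewrite /ball /= sub0r normrN sin0 sub0r normrN => /(_ t2) k2.
by rewrite distrC; lra.
Qed.

Lemma root_of_unity_near1 (d : R) : 0 < d ->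
  exists (w : C) (N : nat), [/\ (0 < N)%N, w ^+ N = 1, w != 1, modulus w = 1 & modulus (w - 1) < d].
Proof.
move=> /cis_near1[e e0 he].
pose N := (Num.truncn (2 * pi / e)).+3.
have N0 : (0 : R) < N%:R by rewrite ltr0n.
exists (cis (2 * pi / N%:R)), N; split=> //; last 2 first.
- exact: modulus_cis.
- apply: he; rewrite ger0_norm; last by rewrite divr_ge0 ?ler0n // mulr_ge0 // pi_ge0.
  rewrite ltr_pdivrMr // [e * _]mulrC -ltr_pdivrMr //; apply: lt_trans (truncnS_gt _) _.
  by rewrite ltr_nat /N !ltnS.
- rewrite cisX mulrC divfK ?gt_eqF // mulr_natl.
  by rewrite /cis cos2pi sin2pi.
apply/eqP => /(congr1 (fun z : C => complex.Im z)) /= s0.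
have p0 := pi_gt0 R.
have : 0 < sin (2 * pi / N%:R : R).
  apply: sin_gt0_pi; rewrite divr_gt0 ?mulr_gt0 //= ltr_pdivrMr // mulrC ltr_pM2l //.
  by rewrite ltr_nat.
by rewrite s0 ltxx.
Qed.

End RootsOfUnity.

(** * Cauchy's estimate *)

Section Cauchy.
Context {R : realType}.
Local Notation C := (Cx R).

(** Holomorphic maps with continuous derivative. The Jacobian [J] is kept as
   data because limits of derivatives have to be identified. *)
Definition chol n m (D : set 'rV[C]_n) (f : 'rV[C]_n -> 'rV[C]_m) (J : 'rV[C]_n -> 'M[C]_(n, m)) :=
  forall x, D x -> cdiff f x (J x) /\ forall i j, ccont (fun y => J y i j) x.

Lemma taylor1 n m (f : 'rV[C]_n -> 'rV[C]_m) J (x h : 'rV[C]_n) A (K : R) :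
  (forall t : R, 0 <= t <= 1 -> cdiff f (x + rc t *: h) (J (x + rc t *: h))) ->
  (forall t : R, 0 <= t <= 1 -> norm1 (h *m (J (x + rc t *: h) - A)) <= K) ->
  norm1 (f (x + h) - f x - h *m A) <= K.
Proof.
move=> df bJ.
have := @vector_mean_value R n m (fun y => f y + y *m (- A)) x h
  (fun t k => k *m (J (x + rc t *: h) + - A)) K.
rewrite !mulmxN mulmxDl => H.
rewrite (_ : _ - _ - _ = f (x + h) - (x *m A + h *m A) - (f x - x *m A)).
  apply: H => // t t01.
  apply: cdiffD; first exact: df.
  have := cdiff_mulr (- A) (cdiff_id (x + rc t *: h)).
  by rewrite mul1mx.
apply/rowP => j; rewrite !mxE; ring.
Qed.

Lemma expf_inv_cancel (w : C) k : w != 0 -> w^-1 ^+ k * w ^+ k = 1.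
Proof. by move=> w0; rewrite -exprMn mulVf // expr1n. Qed.

(** Summation by parts over the orbit of a root of unity [w]: the sum of
   [w^-(k+1) U(w^(k+1) r) - w^-k U(w^k r)] vanishes, and to first order in
   [w - 1] its terms are [(1 - w^-1)(r U' - w^-k U)]. *)
Lemma circle_defect m (U E : 'rV[C]_1 -> 'rV[C]_m) (r e : R) (w : C) N :
  w ^+ N = 1 -> w != 1 -> modulus w = 1 ->
  (forall k, norm1 (U (w ^+ k.+1 *: (rc r)%:M) - U (w ^+ k *: (rc r)%:M)
     - ((w - 1) * w ^+ k * rc r) *: E (w ^+ k *: (rc r)%:M)) <= e * modulus (w - 1)) ->
  norm1 (\sum_(k < N) (rc r *: E (w ^+ k *: (rc r)%:M) - w^-1 ^+ k *: U (w ^+ k *: (rc r)%:M)))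
    <= N%:R * e.
Proof.
move=> wN w1 mw hU; pose u k := U (w ^+ k *: (rc r)%:M); pose d k := E (w ^+ k *: (rc r)%:M).
have w0 : w != 0 by rewrite -modulus_eq0 mw oner_eq0.
pose err k := u k.+1 - u k - ((w - 1) * w ^+ k * rc r) *: d k.
have id k : w^-1 ^+ k.+1 *: u k.+1 - w^-1 ^+ k *: u k =
  w^-1 ^+ k.+1 *: err k + (1 - w^-1) *: (rc r *: d k - w^-1 ^+ k *: u k).
  have h1 := expf_inv_cancel k w0; have h2 := mulVf w0.
  rewrite /err; apply/rowP => j; rewrite !mxE exprS.
  have e1 : w^-1 * (w - 1) = 1 - w^-1 by rewrite mulrBr h2 mulr1.
  transitivity (w^-1 * w^-1 ^+ k * (u k.+1 0 j - u k 0 j)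
    - (w^-1 * (w - 1)) * (w^-1 ^+ k * w ^+ k) * rc r * d k 0 j
    + (1 - w^-1) * (rc r * d k 0 j - w^-1 ^+ k * u k 0 j)); last ring.
  by rewrite h1 e1; ring.
have tel : \sum_(k < N) (w^-1 ^+ k.+1 *: u k.+1 - w^-1 ^+ k *: u k) = 0.
  rewrite -(big_mkord xpredT (fun k => w^-1 ^+ k.+1 *: u k.+1 - w^-1 ^+ k *: u k)).
  by rewrite telescope_sumr // /u exprVn wN invr1 !expr0 subrr.
have sE : (1 - w^-1) *: \sum_(k < N) (rc r *: d k - w^-1 ^+ k *: u k) =
  - \sum_(k < N) w^-1 ^+ k.+1 *: err k.
  apply/eqP; rewrite -addr_eq0 addrC scaler_sumr -big_split /= -[X in _ == X]tel; apply/eqP.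
  by apply: eq_bigr => k _; rewrite id.
have mV : modulus (1 - w^-1) = modulus (w - 1).
  by rewrite -[LHS]mul1r -[in LHS]mw -modulusM mulrBr mulr1 mulfV.
have p0 : 0 < modulus (w - 1).
  by rewrite lt_def modulus_ge0 andbT modulus_eq0 subr_eq0.
rewrite -(ler_pM2l p0) -[X in X * _]mV -norm1Z sE norm1N.
apply: (le_trans (norm1_sum _ _ _)).
rewrite [leRHS]mulrCA mulr_natl -[N in _ *+ N]card_ord -sumr_const.
apply: ler_sum => k _; rewrite norm1Z modulusX modulusV mw invr1 expr1n mul1r mulrC.
exact: hU.
Qed.

Lemma rdiffV n (G : 'rV[C]_n -> C) x L : G x != 0 -> rdiff G x L ->
  rdiff (fun y => (G y)^-1) x (fun h => - (G x) ^- 2 * L h).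
Proof.
move=> g0 dG; have [K K0 [d1 d10 lip]] := rdiff_lip dG; have cG := rdiff_ccont dG.
case: dG => lL dG; split=> [a h k|e e0]; first by rewrite lL; ring.
pose g := modulus (G x); have gp : 0 < g by rewrite lt_def modulus_ge0 modulus_eq0 g0.
have [d2 d20 h2] := cG (g / 2) ltac:(by rewrite divr_gt0).
have [d3 d30 h3] := dG (e * g ^+ 2 / 2) ltac:(by rewrite divr_gt0 ?mulr_gt0 ?exprn_gt0).
have [d4 d40 h4] := cG (e * g ^+ 3 / 4 / K) ltac:(by rewrite !divr_gt0 ?mulr_gt0 ?exprn_gt0).
exists (Num.min (Num.min d1 d2) (Num.min d3 d4)) => [|h].
  by rewrite !lt_min d10 d20 d30.
rewrite !lt_min => /andP[/andP[/lip k1 k2] /andP[/h3 k3 k4]].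
rewrite -{1}[h](addKr x) addrC in k2; have {k2}/h2 k2 := k2.
rewrite -{1}[h](addKr x) addrC in k4; have {k4}/h4 k4 := k4.
set y := G (x + h) in k1 k2 k3 k4 *.
have yg : g / 2 <= modulus y.
  have := modulusD (G x - y) y; rewrite subrK -/g modulusB; lra.
have y0 : y != 0 by rewrite -modulus_eq0 gt_eqF //; lra.
rewrite (_ : _ - _ - _ = (y - G x) * (y - G x) / (G x ^+ 2 * y) - (y - G x - L h) / G x ^+ 2); last first.
  by field; rewrite g0 y0.
apply: (le_trans (modulusD _ _)).
have -> : e * norm1 h = e / 2 * norm1 h + e / 2 * norm1 h by field.
have E1 : modulus ((y - G x) * (y - G x) / (G x ^+ 2 * y)) =
    modulus (y - G x) * modulus (y - G x) / (g ^+ 2 * modulus y).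
  by rewrite modulusM modulusV modulusM [modulus (_ * y)]modulusM modulusX.
have E2 : modulus ((y - G x - L h) / G x ^+ 2) = modulus (y - G x - L h) / g ^+ 2.
  by rewrite modulusM modulusV modulusX.
rewrite modulusN E1 E2; apply: lerD.
  rewrite ler_pdivrMr; last by rewrite mulr_gt0 ?exprn_gt0 //; lra.
  apply: (@le_trans _ _ ((e * g ^+ 3 / 4 / K) * (K * norm1 h))).
    by apply: ler_pM; rewrite ?modulus_ge0 // ltW.
  have -> : e * g ^+ 3 / 4 / K * (K * norm1 h) = e / 2 * norm1 h * (g ^+ 2 * (g / 2)).
    by field; rewrite gt_eqF.
  by rewrite ler_wpM2l ?mulr_ge0 ?norm1_ge0 ?ler_wpM2l ?sqr_ge0 // ltW // divr_gt0.
rewrite ler_pdivrMr ?exprn_gt0 //; apply: (le_trans k3).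
by rewrite le_eqVlt; apply/orP; left; apply/eqP; field.
Qed.

(** In one variable: the averages [phi(r) = r^-1 avg_k w^-k U(w^k r)] over the
   orbit of a root of unity [w] are almost independent of [r], by
   [circle_defect], and tend to [U'(0)] as [r] tends to 0. *)
Lemma cauchy_disc m (U E : 'rV[C]_1 -> 'rV[C]_m) (r1 B : R) : 0 < r1 ->
  (forall z, norm1 z <= r1 -> cdiff U z (E z)) ->
  (forall z, norm1 z <= r1 -> vcont E z) ->
  (forall z, norm1 z <= r1 -> norm1 (U z) <= B) ->
  norm1 (E 0) <= B / r1.
Proof.
move=> r10 dU cE bU; apply/ler_addgt0Pl => e e0.
have e2 : 0 < e / 2 by rewrite divr_gt0.
pose pt (r : R) : 'rV[C]_1 := (rc r)%:M.
have npt (a : C) r : norm1 (a *: pt r) = modulus a * `|r|.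
  by rewrite norm1Z /norm1 big_ord1 mxE eqxx mulr1n modulus_rc.
have n0 : norm1 (0 : 'rV[C]_1) <= r1 by rewrite norm10 ltW.
have [d d0 hd] := vdiffP (dU 0 n0) e2.
pose s := Num.min r1 (d / 2).
have s0 : 0 < s by rewrite lt_min r10 divr_gt0.
have sr1 : s <= r1 by rewrite ge_min lexx.
have sd : s < d.
  by apply: (@le_lt_trans _ _ (d / 2)); [rewrite ge_min lexx orbT | lra].
(* [w] is chosen so close to 1 that on all circles of radius between [s] and
   [r1] the derivative varies by at most [e1] along an arc of the orbit; the
   value makes the total variation of [phi] at most [N e / 2] in [MV] *)
pose e1 := e / 2 * s ^+ 2 / r1 / r1.
have e10 : 0 < e1 by rewrite !divr_gt0 ?mulr_gt0 ?exprn_gt0 ?divr_gt0.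
have cE' z : norm1 (z - 0) <= r1 -> vcont E z by rewrite subr0; exact: cE.
have [d1 d10 hd1] := uniform_continuity cE' e10.
have [w [N [N0 wN w1 mw wd]]] := @root_of_unity_near1 R (d1 / r1) ltac:(by rewrite divr_gt0).
have w0 : w != 0 by rewrite -modulus_eq0 mw oner_eq0.
have NR : (0 : R) < N%:R by rewrite ltr0n.
pose psi (z : 'rV[C]_1) := \sum_(k < N) w^-1 ^+ k *: U (w ^+ k *: z).
pose dpsi (z : 'rV[C]_1) := \sum_(k < N) E (w ^+ k *: z).
have mwk k : modulus (w ^+ k) = 1 by rewrite modulusX mw expr1n.
have nwz k z : norm1 (w ^+ k *: z) = norm1 z by rewrite norm1Z mwk mul1r.
have dp z : norm1 z <= r1 -> cdiff psi z (dpsi z).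
  move=> zr; rewrite /dpsi; apply: cdiff_sum => k.
  have h1 : cdiff (fun y : 'rV[C]_1 => w ^+ k *: y) z (w ^+ k *: 1%:M).
    exact: (cdiffZ (w ^+ k) (cdiff_id z)).
  have h2 : cdiff U (w ^+ k *: z) (E (w ^+ k *: z)) by apply: dU; rewrite nwz.
  have := cdiffZ (w^-1 ^+ k) (cdiff_comp h1 h2).
  by rewrite -scalemxAl mul1mx scalerA expf_inv_cancel // scale1r.
have defect r : 0 < r -> r <= r1 -> norm1 (rc r *: dpsi (pt r) - psi (pt r)) <= N%:R * (e1 * r1).
  move=> r0 rr1; rewrite /dpsi /psi scaler_sumr -sumrB.
  apply: circle_defect => // k.
  have hz (t : R) : w ^+ k *: pt r + rc t *: ((w - 1) * w ^+ k *: pt r)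
      = (w ^+ k * (rc (1 - t) + rc t * w)) *: pt r.
    by rewrite !scalerA -scalerDl rcB rc1; congr (_ *: _); ring.
  have hm (t : R) : 0 <= t <= 1 -> modulus (rc (1 - t) + rc t * w) <= 1.
    move=> /andP[t0 t1]; apply: (le_trans (modulusD _ _)).
    by rewrite modulusM mw mulr1 !modulus_rc !ger0_norm ?subr_ge0 // subrK.
  have nz (t : R) : 0 <= t <= 1 -> norm1 (w ^+ k *: pt r + rc t *: ((w - 1) * w ^+ k *: pt r)) <= r1.
    move=> /hm tm; rewrite hz npt modulusM mwk mul1r gtr0_norm //.
    by apply: le_trans rr1; rewrite ler_piMl // ltW.
  have T := @taylor1 _ _ U E (w ^+ k *: pt r) ((w - 1) * w ^+ k *: pt r) (E (w ^+ k *: pt r))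
    (e1 * r1 * modulus (w - 1)) (fun t t01 => dU _ (nz t t01)).
  rewrite (_ : w ^+ k.+1 *: pt r = w ^+ k *: pt r + (w - 1) * w ^+ k *: pt r); last first.
    by rewrite -scalerDl exprS; congr (_ *: _); ring.
  rewrite (_ : ((w - 1) * w ^+ k * rc r) *: _ = ((w - 1) * w ^+ k *: pt r) *m E (w ^+ k *: pt r)); last first.
    by rewrite -scalemxAl mul_scalar_mx scalerA.
  apply: T => t t01; have /andP[t0 t1] := t01.
  rewrite -scalemxAl mul_scalar_mx !norm1Z modulus_rc gtr0_norm //.
  rewrite modulusM mwk mulr1.
  have nE : norm1 (E (w ^+ k *: pt r + rc t *: ((w - 1) * w ^+ k *: pt r)) - E (w ^+ k *: pt r)) <= e1.
    have h0 : norm1 (w ^+ k *: pt r) <= r1 by rewrite npt mwk mul1r gtr0_norm.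
    apply: hd1; rewrite ?subr0 ?nz // addrC addKr scalerA npt !modulusM mwk mulr1.
    rewrite modulus_rc !ger0_norm ?(ltW r0) //; rewrite ltr_pdivlMr // in wd.
    apply: le_lt_trans wd; apply: ler_pM; rewrite ?mulr_ge0 ?modulus_ge0 ?(ltW r0) //.
    by rewrite ler_piMl ?modulus_ge0.
  rewrite mulrC ler_wpM2r ?modulus_ge0 // mulrC ler_pM ?norm1_ge0 // ltW //.
have pt0 r : pt r 0 0 = rc r by rewrite mxE eqxx mulr1n.
pose phi (z : 'rV[C]_1) := (z 0 0)^-1 *: psi z.
(* the derivative of [psi r / r] is [r^-2 (r psi' - psi)], a circle defect *)
have dphi r : 0 < r -> r <= r1 -> vdiff phi (pt r)
    (fun h => (h 0 0 * - (rc r) ^- 2) *: psi (pt r) + (rc r)^-1 *: (h *m dpsi (pt r))).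
  move=> r0 rr1 j.
  have nr : norm1 (pt r) <= r1 by have := npt 1 r; rewrite scale1r modulus1 mul1r gtr0_norm // => ->.
  have dz : rdiff (fun z : 'rV[C]_1 => z 0 0) (pt r) (fun h => h 0 0) := vdiff_id (pt r) 0.
  have z0 : (pt r) 0 0 != 0 by rewrite pt0 rc_eq0 gt_eqF.
  have := rdiffM (rdiffV z0 dz) (dp _ nr j).
  rewrite (_ : (fun y : 'rV[C]_1 => (y 0 0)^-1 * psi y 0 j) = (fun y => phi y 0 j)); last first.
    by apply/funext => y; rewrite /phi mxE.
  by apply: rdiff_eqL => h; rewrite pt0 [RHS]mxE [in RHS]mxE [X in _ = _ + X]mxE; ring.
have MV : norm1 (phi (pt r1) - phi (pt s)) <= N%:R * (e / 2).
  have pD a b : pt (a + b) = pt a + pt b.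
    by apply/rowP => j; rewrite !mxE rcD (ord1 j) eqxx !mulr1n.
  have pZ t a : rc t *: pt a = pt (t * a).
    by apply/rowP => j; rewrite !mxE rcM (ord1 j) eqxx !mulr1n.
  have rt t : 0 <= t <= 1 -> s <= s + t * (r1 - s) <= r1.
    move=> /andP[t0 t1]; rewrite lerDl mulr_ge0 ?subr_ge0 //=.
    have : t * (r1 - s) <= 1 * (r1 - s) by rewrite ler_wpM2r ?subr_ge0.
    lra.
  rewrite (_ : pt r1 = pt s + pt (r1 - s)); last by rewrite -pD subrKC.
  apply: (@vector_mean_value R 1 m phi (pt s) (pt (r1 - s))
    (fun t h => (h 0 0 * - (rc (s + t * (r1 - s))) ^- 2) *: psi (pt (s + t * (r1 - s)))
       + (rc (s + t * (r1 - s)))^-1 *: (h *m dpsi (pt (s + t * (r1 - s)))))).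
    move=> t /rt/andP[h1 h2]; rewrite pZ -pD; apply: dphi => //; exact: lt_le_trans h1.
  move=> t /rt/andP[h1 h2]; set r := s + _ in h1 h2 *.
  have r0 : 0 < r by exact: lt_le_trans h1.
  have rc0' : rc r != 0 by rewrite rc_eq0 gt_eqF.
  rewrite pt0 mul_scalar_mx.
  rewrite (_ : _ + _ = (rc (r1 - s) * rc r ^- 2) *: (rc r *: dpsi (pt r) - psi (pt r))); last first.
    by apply/rowP => j; rewrite !mxE; field.
  rewrite norm1Z modulusM modulusV modulusX !modulus_rc !ger0_norm ?subr_ge0 ?(ltW r0) //.
  apply: (@le_trans _ _ (r1 * s ^- 2 * (N%:R * (e1 * r1)))).
    rewrite ler_pM ?norm1_ge0 ?defect ?mulr_ge0 ?subr_ge0 ?invr_ge0 ?sqr_ge0 //.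
    rewrite ler_pM ?subr_ge0 ?invr_ge0 ?sqr_ge0 //; first lra.
    rewrite lef_pV2 ?posrE ?exprn_gt0 // lerXn2r // nnegrE ltW //.
  by rewrite le_eqVlt; apply/orP; left; apply/eqP; rewrite /e1; field; rewrite !gt_eqF.
have Pr1 : norm1 (phi (pt r1)) <= N%:R * (B / r1).
  rewrite /phi pt0 norm1Z modulusV modulus_rc gtr0_norm // mulrA [leRHS]mulrC.
  rewrite ler_wpM2l ?invr_ge0 ?(ltW r10) //; apply: (le_trans (norm1_sum _ _ _)).
  rewrite mulr_natl -[N in _ *+ N]card_ord -sumr_const; apply: ler_sum => k _.
  rewrite norm1Z modulusX modulusV mw invr1 expr1n mul1r; apply: bU.
  by rewrite npt mwk mul1r gtr0_norm.
have Ps : norm1 (phi (pt s) - N%:R *: E 0) <= N%:R * (e / 2).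
  have sw : \sum_(k < N) w^-1 ^+ k = 0.
    have : (w^-1 - 1) * \sum_(k < N) w^-1 ^+ k = 0 by rewrite -subrX1 exprVn wN invr1 subrr.
    by move/eqP; rewrite mulf_eq0 subr_eq0 invr_eq1 (negbTE w1) => /eqP.
  have -> : phi (pt s) - N%:R *: E 0 = (rc s)^-1 *: \sum_(k < N) w^-1 ^+ k *:
      (U (0 + w ^+ k *: pt s) - U 0 - (w ^+ k *: pt s) *m E 0).
    have -> : \sum_(k < N) w^-1 ^+ k *: (U (0 + w ^+ k *: pt s) - U 0 - (w ^+ k *: pt s) *m E 0)
       = psi (pt s) - (\sum_(k < N) w^-1 ^+ k) *: U 0 - (N%:R * rc s) *: E 0.
      rewrite scaler_suml (_ : (N%:R * rc s) *: E 0 = \sum_(k < N) rc s *: E 0).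
        rewrite -!sumrB; apply: eq_bigr => k _; rewrite add0r -scalemxAl mul_scalar_mx.
        rewrite !scalerBr; congr (_ - _).
        by rewrite [LHS]scalerA (expf_inv_cancel k w0) scale1r.
      by rewrite big_const card_ord iter_addr addr0 -[RHS]scaler_nat scalerA.
    rewrite sw scale0r subr0 scalerBr scalerA mulrCA mulVf ?rc_eq0 ?gt_eqF // mulr1.
    by rewrite /phi pt0.
  rewrite norm1Z modulusV modulus_rc gtr0_norm // mulrC ler_pdivrMr //.
  apply: (le_trans (norm1_sum _ _ _)); rewrite -mulrA mulr_natl -[N in _ *+ N]card_ord -sumr_const.
  apply: ler_sum => k _; rewrite norm1Z modulusX modulusV mw invr1 expr1n mul1r.
  have := hd (w ^+ k *: pt s); rewrite npt mwk mul1r gtr0_norm //; exact.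
rewrite -(ler_pM2l NR) -[N%:R in leLHS](@modulus_nat R) -norm1Z.
have -> : N%:R * (e + B / r1) = N%:R * (e / 2) + (N%:R * (e / 2) + N%:R * (B / r1)).
  by rewrite -!mulrDr addrA -splitr.
have tri (x y : 'rV[C]_m) : norm1 x <= norm1 (y - x) + norm1 y.
  by have := norm1_triangle x y 0; rewrite !subr0 norm1B.
apply: (le_trans (tri _ (phi (pt s)))); apply: lerD => //.
by apply: (le_trans (tri _ (phi (pt r1)))); apply: lerD.
Qed.

End Cauchy.

(** * Montel's theorem *)

Section Montel.
Context {R : realType}.
Local Notation C := (Cx R).

Definition nball n (a : 'rV[C]_n) (r : R) : set 'rV[C]_n := [set x | norm1 (x - a) < r].

Lemma nballD n (a x h : 'rV[C]_n) r s : norm1 (x - a) < r -> norm1 h <= s ->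
  nball a (r + s) (x + h).
Proof.
move=> h1 h2; rewrite /nball /= addrAC.
by apply: le_lt_trans (norm1D _ _) _; rewrite ltr_leD.
Qed.

Lemma nball_segment n (a x h : 'rV[C]_n) (r t : R) : nball a r x -> nball a r (x + h) ->
  0 <= t <= 1 -> nball a r (x + rc t *: h).
Proof.
rewrite /nball /= => h1 h2 /andP[t0 t1].
rewrite (_ : _ - a = rc (1 - t) *: (x - a) + rc t *: (x + h - a)); last first.
  by apply/rowP => j; rewrite !mxE rcB rc1; ring.
apply: le_lt_trans (norm1D _ _) _; rewrite !norm1Z !modulus_rc !ger0_norm ?subr_ge0 //.
have [->|t0'] := eqVneq t 0; first by rewrite subr0 mul1r mul0r addr0.
have tp : 0 < t by rewrite lt_def t0' t0.
apply: (@lt_le_trans _ _ ((1 - t) * r + t * r)); last by rewrite -mulrDl subrK mul1r.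
by rewrite ler_ltD ?ltr_pM2l // ler_wpM2l ?subr_ge0 // ltW.
Qed.

Lemma chol_vcont n m (D : set 'rV[C]_n) f (J : 'rV[C]_n -> 'M[C]_(n, m)) v x :
  chol D f J -> D x -> vcont (fun y => v *m J y) x.
Proof.
move=> fD Dx j; have [_ cJ] := fD x Dx.
rewrite (_ : (fun y => _) = (fun y => \sum_k v 0 k * J y k j)); last first.
  by apply/funext => y; rewrite mxE.
by apply: ccont_sum => k; apply: ccontZ.
Qed.

Lemma chol_mean_value n m (a : 'rV[C]_n) r (f : 'rV[C]_n -> 'rV[C]_m) J x h K :
  chol (nball a r) f J -> nball a r x -> nball a r (x + h) ->
  (forall y, nball a r y -> norm1 (h *m J y) <= K) -> norm1 (f (x + h) - f x) <= K.
Proof.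
move=> fD ax axh bJ.
apply: (@vector_mean_value _ _ _ _ _ _ (fun t k => k *m J (x + rc t *: h))) => t t01.
  by apply: (fD _ _).1; exact: nball_segment.
by apply: bJ; exact: nball_segment.
Qed.

(** [cauchy_disc] on the complex line [x + z v]. *)
Lemma cauchy_estimate n m (D : set 'rV[C]_n) (f : 'rV[C]_n -> 'rV[C]_m) J x v (r1 B : R) :
  chol D f J -> 0 < r1 -> (forall z : C, modulus z <= r1 -> D (x + z *: v)) ->
  (forall z : C, modulus z <= r1 -> norm1 (f (x + z *: v)) <= B) ->
  norm1 (v *m J x) <= B / r1.
Proof.
move=> fD r10 hD hB.
have mE (z : 'rV[C]_1) : z *m v = z 0 0 *: v.
  by apply/rowP => j; rewrite !mxE big_ord1.
have nE (z : 'rV[C]_1) : norm1 z = modulus (z 0 0) by rewrite /norm1 big_ord1.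
have dl (z : 'rV[C]_1) : cdiff (fun z : 'rV[C]_1 => x + z *m v) z v.
  have := cdiffD (cdiff_cst z x) (cdiff_mulr v (cdiff_id z)).
  by rewrite add0r mul1mx.
have := @cauchy_disc R m (fun z => f (x + z *m v)) (fun z => v *m J (x + z *m v)) r1 B r10.
rewrite mul0mx addr0; apply.
- move=> z; rewrite nE => /hD; rewrite -mE => /fD[dz _].
  exact: (cdiff_comp (dl z) dz).
- move=> z; rewrite nE => /hD; rewrite -mE => Dz j.
  have cf := chol_vcont v fD Dz.
  exact: (@ccont_comp _ _ _ (fun z : 'rV[C]_1 => x + z *m v) (fun y => (v *m J y) 0 j) z
    (vdiff_vcont (dl z)) (cf j)).
- by move=> z; rewrite nE => /hB; rewrite -mE.
Qed.

Lemma cauchy_ball n m (a : 'rV[C]_n) r (f : 'rV[C]_n -> 'rV[C]_m) J B x v : 0 < r ->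
  chol (nball a r) f J -> (forall y, nball a r y -> norm1 (f y) <= B) ->
  nball a (r / 2) x -> norm1 (v *m J x) <= B / (r / 2) * norm1 v.
Proof.
move=> r0 fD fB ax; have [->|v0] := eqVneq v 0.
  by rewrite mul0mx !norm10 mulr0.
have nv : 0 < norm1 v by rewrite norm1_gt0.
have r2 : 0 < r / 2 by rewrite divr_gt0.
have hz (z : C) : modulus z <= r / 2 / norm1 v -> nball a r (x + z *: v).
  rewrite ler_pdivlMr // => h; rewrite (splitr r); apply: nballD => //.
  by rewrite norm1Z.
have := @cauchy_estimate _ _ _ f J x v (r / 2 / norm1 v) B fD.
rewrite divr_gt0 // => /(_ isT hz (fun z hz' => fB _ (hz z hz'))).
by rewrite invf_div mulrCA mulrC.
Qed.

(** [cauchy_ball] applies to the increment [f (z + (x - y)) - f z], which is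
   itself bounded by a multiple of [norm1 (x - y)], again by [cauchy_ball]. *)
Lemma cauchy_lipschitz n m (a : 'rV[C]_n) r (f : 'rV[C]_n -> 'rV[C]_m) J B x y v : 0 < r ->
  chol (nball a r) f J -> (forall y, nball a r y -> norm1 (f y) <= B) ->
  nball a (r / 8) x -> nball a (r / 8) y ->
  norm1 (v *m (J x - J y)) <= 16 * B / r ^+ 2 * norm1 (x - y) * norm1 v.
Proof.
move=> r0 fD fB ax ay; rewrite /nball /= in ax ay.
have nxy : norm1 (x - y) <= r / 4.
  have := norm1_triangle x a y; rewrite (norm1B a y); lra.
pose g z := f (z + (x - y)) - f z.
have r4 : 0 < r / 4 by rewrite divr_gt0.
have sh z : nball a (r / 4) z -> nball a (r / 2) (z + (x - y)).
  by move=> az; rewrite (_ : r / 2 = r / 4 + r / 4); [exact: nballD|field].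
have sub s z : s <= r -> nball a s z -> nball a r z.
  by move=> sr; rewrite /nball /= => /lt_le_trans; apply.
have fD2 : chol (nball a (r / 2)) f J by move=> z /(sub (r / 2)) h; apply: fD; apply: h; lra.
have gD : chol (nball a (r / 4)) g (fun z => J (z + (x - y)) - J z).
  move=> z az; have [d1 c1] := fD2 _ (sh z az).
  have az' : nball a r z by apply: sub az; lra.
  have [d2 c2] := fD _ az'.
  have dt : cdiff (fun z => z + (x - y)) z 1%:M.
    by have := cdiffD (cdiff_id z) (cdiff_cst z (x - y)); rewrite addr0.
  split=> [|i j].
    have := cdiffD (cdiff_comp dt d1) (cdiffZ (-1) d2); rewrite mul1mx scaleN1r.
    rewrite (_ : (fun z => f (z + (x - y)) + -1 *: f z) = g) //.
    by apply/funext => u; rewrite scaleN1r.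
  rewrite (_ : (fun z => _) = (fun z => J (z + (x - y)) i j + -1 * J z i j)); last first.
    by apply/funext => u; rewrite !mxE mulN1r.
  apply: ccontD; last exact: ccontZ.
  exact: (@ccont_comp _ _ _ (fun z => z + (x - y)) (fun y => J y i j) z (vdiff_vcont dt) (c1 i j)).
have gB z : nball a (r / 4) z -> norm1 (g z) <= B / (r / 2) * norm1 (x - y).
  move=> az; apply: (chol_mean_value fD2).
  - by move: az; rewrite /nball /=; lra.
  - exact: sh.
  - by move=> u au; apply: (cauchy_ball _ r0 fD fB au).
have := @cauchy_ball _ _ a (r / 4) g _ _ y v r4 gD gB.
rewrite subrKC (_ : r / 4 / 2 = r / 8); last by field.
move=> /(_ ay); congr (_ <= _); field; exact: lt0r_neq0.
Qed.

(** The limits of [f q] and [J q] exist pointwise along an ultrafilter. The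
   uniform Lipschitz bound of [cauchy_lipschitz] passes to the limit and shows
   that the second limit is the derivative of the first. Of the convergence only
   the existence of close terms of large index is kept, at one point at a
   time. *)
Lemma montel n m (f : nat -> 'rV[C]_n -> 'rV[C]_m) J (a : 'rV[C]_n) r B : 0 < r ->
  (forall q, chol (nball a r) (f q) (J q)) ->
  (forall q x, nball a r x -> norm1 (f q x) <= B) ->
  exists g G, chol (nball a (r / 8)) g G /\
    forall x, nball a (r / 8) x -> forall (e : R) q0, 0 < e -> exists2 q, (q0 <= q)%N &
      norm1 (f q x - g x) < e /\ forall i, norm1 (row i (J q x) - row i (G x)) < e.
Proof.
move=> r0 fD fB; pose K := 16 * B / r ^+ 2.
have r8 : 0 < r / 8 by rewrite divr_gt0.
have ha : nball a r a by rewrite /nball /= subrr norm10.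
have B0 : 0 <= B by apply: le_trans (fB 0 a ha); exact: norm1_ge0.
have K0 : 0 <= K by rewrite /K divr_ge0 ?sqr_ge0 // mulr_ge0.
have ex x : exists gG : 'rV[C]_m * 'M[C]_(n, m), nball a (r / 8) x ->
    ultra_lim (fun q => f q x) gG.1 /\ forall i, ultra_lim (fun q => row i (J q x)) (row i gG.2).
  have [ax|] := pselect (nball a (r / 8) x); last by move=> nx; exists (0, 0).
  have ax1 : nball a r x by move: ax; rewrite /nball /=; lra.
  have ax2 : nball a (r / 2) x by move: ax; rewrite /nball /=; lra.
  have [l hl] := ultra_lim_ex (fun q => fB q x ax1).
  have bJ i q : norm1 (row i (J q x)) <= B / (r / 2).
    have := cauchy_ball (delta_mx 0 i) r0 (fD q) (fB q) ax2.
    by rewrite norm1_delta mulr1 rowE.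
  pose L i := projT1 (cid (ultra_lim_ex (bJ i))).
  exists (l, \matrix_(i, j) L i 0 j) => _; split=> // i /=.
  rewrite (_ : row i _ = L i); last by apply/rowP => j; rewrite !mxE.
  by rewrite /L; case: cid.
pose g x := (projT1 (cid (ex x))).1; pose G x := (projT1 (cid (ex x))).2.
have gG x : nball a (r / 8) x ->
    ultra_lim (fun q => f q x) (g x) /\ forall i, ultra_lim (fun q => row i (J q x)) (row i (G x)).
  by rewrite /g /G; case: cid.
have near x e : nball a (r / 8) x -> 0 < e -> ultra_nat [set q | norm1 (f q x - g x) < e /\
    forall i, norm1 (row i (J q x) - row i (G x)) < e].
  move=> /gG[h1 h2] e0; apply: ultra_natI; first exact: h1.
  by apply: ultra_nat_forall => i; exact: h2.
have mulB v (A A' : 'M[C]_(n, m)) e : (forall i, norm1 (row i A - row i A') < e) ->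
    norm1 (v *m A - v *m A') <= norm1 v * e.
  move=> h; rewrite -mulmxBr mulmx_sum_row; apply: (le_trans (norm1_sum _ _ _)).
  rewrite [norm1 v]/norm1 mulr_suml; apply: ler_sum => i _.
  by rewrite norm1Z ler_wpM2l ?modulus_ge0 // linearB /= ltW.
have quad x h : nball a (r / 8) x -> nball a (r / 8) (x + h) ->
    norm1 (g (x + h) - g x - h *m G x) <= K * norm1 h * norm1 h.
  move=> ax axh; apply/ler_addgt0Pr => e e0.
  pose e' := e / (2 + norm1 h).
  have p0 : 0 < 2 + norm1 h by rewrite ltr_wpDr ?norm1_ge0.
  have e'0 : 0 < e' by rewrite divr_gt0.
  have [q _ [[h1 _] [h2 h3]]] := ultra_nat_ex 0 (ultra_natI (near _ _ axh e'0) (near _ _ ax e'0)).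
  have T : norm1 (f q (x + h) - f q x - h *m J q x) <= K * norm1 h * norm1 h.
    apply: (@taylor1 _ _ _ _ (J q)) => t t01.
      have := nball_segment ax axh t01; rewrite /nball /= => at1.
      by apply: (fD q _ _).1; rewrite /nball /=; lra.
    have at1 := nball_segment ax axh t01.
    apply: (le_trans (cauchy_lipschitz h r0 (fD q) (fB q) at1 ax)).
    rewrite addrC addKr norm1Z modulus_rc ler_wpM2r ?norm1_ge0 // ler_wpM2l //.
    by case/andP: t01 => t0 t1; rewrite ger0_norm // ler_piMl ?norm1_ge0.
  rewrite (_ : _ - _ - _ = (f q (x + h) - f q x - h *m J q x) + ((h *m J q x - h *m G x)
     + ((f q x - g x) - (f q (x + h) - g (x + h))))); last first.
    by apply/rowP => j; rewrite !mxE; ring.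
  apply: (le_trans (norm1D _ _)); apply: lerD => //.
  apply: (le_trans (norm1D _ _)).
  rewrite (_ : e = norm1 h * e' + (e' + e')); last first.
    by rewrite /e'; field; rewrite gt_eqF.
  apply: lerD; first exact: mulB.
  by apply: (le_trans (norm1D _ _)); rewrite norm1N lerD // ltW.
have lipG x y v : nball a (r / 8) x -> nball a (r / 8) y ->
    norm1 (v *m (G x - G y)) <= K * norm1 (x - y) * norm1 v.
  move=> ax ay; apply/ler_addgt0Pr => e e0.
  pose e' := e / (2 * norm1 v + 1).
  have p0 : 0 < 2 * norm1 v + 1 by rewrite ltr_wpDl ?mulr_ge0 ?norm1_ge0.
  have e'0 : 0 < e' by rewrite divr_gt0.
  have [q _ [[_ h1] [_ h2]]] := ultra_nat_ex 0 (ultra_natI (near _ _ ax e'0) (near _ _ ay e'0)).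
  rewrite (_ : v *m _ = v *m (J q x - J q y) + ((v *m J q y - v *m G y) - (v *m J q x - v *m G x))); last first.
    by rewrite !mulmxBr; apply/rowP => j; rewrite !mxE; ring.
  apply: (le_trans (norm1D _ _)); apply: lerD.
    exact: cauchy_lipschitz (fD q) (fB q) ax ay.
  apply: (le_trans (norm1D _ _)); rewrite norm1N.
  apply: (@le_trans _ _ (norm1 v * e' + norm1 v * e')); first by rewrite lerD ?mulB.
  rewrite -mulrDr /e' -mulr2n mulrnAr mulrCA -mulrnAr ler_piMr ?(ltW e0) //.
  rewrite -mulrnAl ler_pdivrMr // mul1r mulr_natl; lra.
have K1 : 0 < K + 1 by rewrite ltr_wpDl.
exists g, G; split; last first.
  by move=> x ax e q0 e0; exact: ultra_nat_ex q0 (near x e ax e0).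
move=> x ax; have room : 0 < r / 8 - norm1 (x - a) by rewrite subr_gt0.
split=> [j|i j].
  split=> [b h k|e e0]; first by rewrite mulmxDl -scalemxAl !mxE.
  exists (Num.min (r / 8 - norm1 (x - a)) (e / (K + 1))) => [|h].
    by rewrite lt_min room divr_gt0 // ltr_wpDl.
  rewrite lt_min ltr_pdivlMr // => /andP[h1 h2].
  have axh : nball a (r / 8) (x + h).
    by rewrite /nball /= addrAC; apply: le_lt_trans (norm1D _ _) _; lra.
  have := norm1_coord (g (x + h) - g x - h *m G x) j; rewrite !mxE => /le_trans; apply.
  apply: (le_trans (quad x h ax axh)); rewrite ler_wpM2r ?norm1_ge0 //.
  by apply: le_trans (ltW h2); rewrite mulrC ler_wpM2l ?norm1_ge0 // lerDl.
move=> e e0; exists (Num.min (r / 8 - norm1 (x - a)) (e / (K + 1))) => [|y].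
  by rewrite lt_min room divr_gt0 // ltr_wpDl.
rewrite lt_min ltr_pdivlMr // => /andP[h1 h2].
have ay : nball a (r / 8) y.
  by rewrite /nball /=; have := norm1_triangle y x a; lra.
apply: le_lt_trans h2.
have := lipG y x (delta_mx 0 i) ay ax; rewrite norm1_delta mulr1 -rowE => h.
have := norm1_coord (row i (G y - G x)) j; rewrite !mxE => /le_trans; apply.
by apply: (le_trans h); rewrite mulrC ler_wpM2l ?norm1_ge0 // lerDl.
Qed.

End Montel.

(** * Linearization of a field that almost preserves a quadratic form *)

Section Linearization.
Context {R : realType}.
Local Notation C := (Cx R).

Lemma chol_comp n m p (D : set 'rV[C]_n) (D' : set 'rV[C]_m) (f : 'rV[C]_n -> 'rV[C]_m) J
  (g : 'rV[C]_m -> 'rV[C]_p) G : chol D f J -> chol D' g G -> (forall x, D x -> D' (f x)) ->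
  chol D (fun x => g (f x)) (fun x => J x *m G (f x)).
Proof.
move=> fD gD fDD x Dx; have [df cf] := fD x Dx; have [dg cg] := gD _ (fDD x Dx).
split=> [|i j]; first exact: cdiff_comp df dg.
rewrite (_ : (fun y => _) = (fun y => \sum_k J y i k * G (f y) k j)); last first.
  by apply/funext => y; rewrite mxE.
apply: ccont_sum => k; apply: ccontM => //.
exact: (@ccont_comp _ _ _ f (fun z => G z k j) x (vdiff_vcont df) (cg k j)).
Qed.

Lemma cholS n m (D D' : set 'rV[C]_n) (f : 'rV[C]_n -> 'rV[C]_m) J :
  D' `<=` D -> chol D f J -> chol D' f J.
Proof. by move=> s h x /s; exact: h. Qed.

Lemma cholD n m (D : set 'rV[C]_n) (f g : 'rV[C]_n -> 'rV[C]_m) J G :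
  chol D f J -> chol D g G -> chol D (fun x => f x + g x) (fun x => J x + G x).
Proof.
move=> fD gD x Dx; have [df cf] := fD x Dx; have [dg cg] := gD x Dx.
split=> [|i j]; first exact: cdiffD.
rewrite (_ : (fun y => _) = (fun y => J y i j + G y i j)); first exact: ccontD.
by apply/funext => y; rewrite mxE.
Qed.

Lemma chol_lin n m (D : set 'rV[C]_n) (A : 'M[C]_(n, m)) : chol D (fun x => x *m A) (fun=> A).
Proof.
move=> x Dx; split=> [|i j]; last exact: ccont_cst.
by have := cdiff_mulr A (cdiff_id x); rewrite mul1mx.
Qed.

Lemma chol_id n (D : set 'rV[C]_n) : chol D id (fun=> 1%:M).
Proof. by move=> x Dx; split=> [|i j]; [exact: cdiff_id | exact: ccont_cst]. Qed.

Lemma chol_mulr n m p (D : set 'rV[C]_n) (f : 'rV[C]_n -> 'rV[C]_m) J (A : 'M[C]_(m, p)) :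
  chol D f J -> chol D (fun x => f x *m A) (fun x => J x *m A).
Proof. by move=> fD; apply: (chol_comp fD (@chol_lin _ _ setT A)). Qed.

Lemma cholZ n m (D : set 'rV[C]_n) (f : 'rV[C]_n -> 'rV[C]_m) J (a : C) :
  chol D f J -> chol D (fun x => a *: f x) (fun x => a *: J x).
Proof.
move=> fD; have := chol_mulr a%:M fD.
rewrite (_ : (fun x => _) = (fun x => a *: f x)); last first.
  by apply/funext => x; rewrite mul_mx_scalar.
rewrite (_ : (fun x => J x *m _) = (fun x => a *: J x)) //.
by apply/funext => x; rewrite mul_mx_scalar.
Qed.

Lemma chol_sum n m I (r : seq I) (D : set 'rV[C]_n) (f : I -> 'rV[C]_n -> 'rV[C]_m) J :
  (forall i, chol D (f i) (J i)) ->
  chol D (fun x => \sum_(i <- r) f i x) (fun x => \sum_(i <- r) J i x).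
Proof.
move=> fD; elim: r => [|i r IH].
  rewrite (_ : (fun x => _) = (fun=> 0)); last by apply/funext => x; rewrite big_nil.
  rewrite (_ : (fun x => \sum_(i <- [::]) J i x) = (fun=> 0)); last first.
    by apply/funext => x; rewrite big_nil.
  by move=> x _; split=> [|i j]; [exact: cdiff_cst | exact: ccont_cst].
rewrite (_ : (fun x => _) = (fun x => f i x + \sum_(k <- r) f k x)); last first.
  by apply/funext => x; rewrite big_cons.
rewrite (_ : (fun x => \sum_(k <- i :: r) J k x) = (fun x => J i x + \sum_(k <- r) J k x)).
  exact: cholD.
by apply/funext => x; rewrite big_cons.
Qed.

Definition cdiag n (d : 'I_n -> C) : 'M[C]_n := diag_mx (\row_j d j).

Lemma mulmx_cdiag n (y : 'rV[C]_n) d j : (y *m cdiag d) 0 j = y 0 j * d j.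
Proof. by rewrite mul_mx_diag !mxE. Qed.

Lemma cdiagM n (d e : 'I_n -> C) : cdiag d *m cdiag e = cdiag (fun j => d j * e j).
Proof. by rewrite /cdiag mulmx_diag; congr diag_mx; apply/rowP => j; rewrite !mxE. Qed.

Lemma norm1_cdiag n (y : 'rV[C]_n) d (b : R) : (forall j, modulus (d j) <= b) ->
  norm1 (y *m cdiag d) <= norm1 y * b.
Proof.
move=> hd; rewrite /norm1 mulr_suml; apply: ler_sum => j _.
by rewrite mulmx_cdiag modulusM ler_wpM2l ?modulus_ge0.
Qed.

Section Euler.
Variables (n : nat) (r0 : R) (Z : 'rV[C]_n -> 'rV[C]_n) (A : 'rV[C]_n -> 'M[C]_n).
Variables (h : 'I_n -> R) (q : 'rV[C]_n -> 'rV[C]_n -> R) (m M K t0 : R).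
Hypothesis r00 : 0 < r0.
Hypothesis ZD : chol (nball 0 r0) Z A.
Hypothesis Z0 : Z 0 = 0.
Hypothesis A0 : A 0 = cdiag (fun j => rc (h j)).
Hypothesis m0 : 0 < m.
Hypothesis M0 : 0 <= M.
Hypothesis K0 : 0 <= K.
Hypothesis t00 : 0 < t0.
Hypothesis qm : forall x v, nball 0 r0 x -> m * norm1 v ^+ 2 <= q x v.
Hypothesis qM : forall x v, nball 0 r0 x -> q x v <= M * norm1 v ^+ 2.
(* The left-hand side is [q x v + O(t^2)] when [q] is a metric for which [i Z]
   is a Killing field. *)
Hypothesis qK : forall x v (t : R), nball 0 r0 x -> 0 <= t <= t0 ->
  nball 0 r0 (x + (rc t * 'i) *: Z x) ->
  q (x + (rc t * 'i) *: Z x) (v + (rc t * 'i) *: (v *m A x)) <= (1 + K * t ^+ 2) * q x v.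

(** The Euler method for the flow of [i Z]. *)
Definition euler (t : R) (x : 'rV[C]_n) := x + (rc t * 'i) *: Z x.
Fixpoint euler_jac (t : R) k (x : 'rV[C]_n) : 'M[C]_n :=
  if k is k'.+1 then euler_jac t k' x *m (1%:M + (rc t * 'i) *: A (iter k' (euler t) x))
  else 1%:M.

Lemma euler0 t k : iter k (euler t) 0 = 0.
Proof. by elim: k => //= k ->; rewrite /euler Z0 scaler0 addr0. Qed.

(** Euler steps of length [t] distort [q] only by [1 + O(t^2)], so up to
   [t^-2] of them remain uniformly Lipschitz, hence stay in a fixed ball. *)
Lemma euler_iter_bounded : exists r1 r2 t1 : R, [/\ 0 < r1, 0 < r2, 0 < t1,
  (r1 <= r2 <= r0) /\ (forall x, nball 0 r2 x -> norm1 (Z x) <= 1) &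
  forall (t : R) N, 0 < t <= t1 -> N%:R * t ^+ 2 <= 1 -> forall k, (k <= N)%N ->
   chol (nball 0 r1) (iter k (euler t)) (euler_jac t k) /\
   (forall x, nball 0 r1 x -> nball 0 r2 (iter k (euler t) x))].
Proof.
have n0 : nball 0 r0 (0 : 'rV[C]_n) by rewrite /nball /= subrr norm10.
have [d d0 hd] := vcontP (vdiff_vcont (ZD n0).1) (@ltr01 R).
pose r2 := Num.min d (r0 / 2).
have r20 : 0 < r2 by rewrite lt_min d0 divr_gt0.
have r2r0 : r2 <= r0 / 2 by rewrite ge_min lexx orbT.
have Z1 (x : 'rV[C]_n) : nball 0 r2 x -> norm1 (Z x) <= 1.
  rewrite /nball /= => xr; have := hd x; rewrite Z0 !subr0 in xr * => H; apply/ltW/H.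
  by apply: (lt_le_trans xr); rewrite ge_min lexx.
have sub20 (x : 'rV[C]_n) : nball 0 r2 x -> nball 0 r0 x.
  by rewrite /nball /= => /lt_le_trans; apply; lra.
pose L := expR K * M / m + 1.
have L1 : 1 <= L by rewrite lerDr divr_ge0 ?mulr_ge0 ?expR_ge0 // ltW.
have L0 : 0 < L by exact: lt_le_trans L1.
pose r1 := r2 / L; have r10 : 0 < r1 by rewrite divr_gt0.
have r12 : r1 <= r2 by rewrite ler_pdivrMr // ler_peMr // ltW.
pose t1 := Num.min t0 (r0 / 2); have t10 : 0 < t1 by rewrite lt_min t00 divr_gt0.
exists r1, r2, t1; split=> //.
  by split=> //; rewrite r12 /=; lra.
move=> t N /andP[tp tt1] NT.
have tt0 : 0 <= t <= t0 by rewrite ltW //= (le_trans tt1) // ge_min lexx.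
have tr0 : t <= r0 / 2 by rewrite (le_trans tt1) // ge_min lexx orbT.
have sub10 (x : 'rV[C]_n) : nball 0 r1 x -> nball 0 r0 x.
  by move=> xr; apply: sub20; apply: lt_le_trans xr r12.
have eD : chol (nball 0 r0) (euler t) (fun x => 1%:M + (rc t * 'i) *: A x).
  by apply: cholD; [exact: chol_id | exact: cholZ].
suff H k : (k <= N)%N -> [/\ chol (nball 0 r1) (iter k (euler t)) (euler_jac t k),
   (forall x, nball 0 r1 x -> nball 0 r2 (iter k (euler t) x)) &
   (forall x v, nball 0 r1 x -> q (iter k (euler t) x) (v *m euler_jac t k x) <=
      (1 + K * t ^+ 2) ^+ k * q x v)].
  by move=> k /H[].
elim: k => [_|k IH kN].
  split=> [|x xr|x v xr]; first exact: chol_id.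
    exact: lt_le_trans xr r12.
  by rewrite /= mulmx1 expr0 mul1r.
have [fD fr fq] := IH (ltnW kN).
have fD' : chol (nball 0 r1) (iter k.+1 (euler t)) (euler_jac t k.+1).
  have sub x : nball 0 r1 x -> nball 0 r0 (iter k (euler t) x) by move=> /fr; exact: sub20.
  by have := chol_comp fD eD sub.
have fq' x v : nball 0 r1 x -> q (iter k.+1 (euler t) x) (v *m euler_jac t k.+1 x) <=
      (1 + K * t ^+ 2) ^+ k.+1 * q x v.
  move=> xr; have yr := fr x xr.
  have ey : nball 0 r0 (iter k (euler t) x + (rc t * 'i) *: Z (iter k (euler t) x)).
    rewrite [r0]splitr; apply: nballD; first exact: lt_le_trans yr r2r0.
    rewrite norm1Z modulusM modulus_i modulus_rc mulr1 gtr0_norm //.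
    by rewrite (le_trans _ tr0) // ler_piMr ?Z1 // ltW.
  have := qK (v *m euler_jac t k x) (sub20 _ yr) tt0 ey.
  rewrite /= mulmxA mulmxDr mulmx1 -scalemxAr => /le_trans; apply.
  rewrite [_ ^+ k.+1]exprS -[leRHS]mulrA ler_wpM2l ?fq //.
  by rewrite addr_ge0 // mulr_ge0 // sqr_ge0.
have growth : (1 + K * t ^+ 2) ^+ k.+1 <= expR K.
  have a0 : 0 <= 1 + K * t ^+ 2 by rewrite addr_ge0 // mulr_ge0 // sqr_ge0.
  apply: (@le_trans _ _ (expR (K * t ^+ 2) ^+ k.+1)).
    by rewrite lerXn2r ?nnegrE ?expR_ge0 // expR_ge1Dx.
  rewrite -expRM_natl ler_expR mulrCA ler_piMr //.
  by apply: le_trans NT; rewrite ler_wpM2r ?sqr_ge0 // ler_nat.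
have lip x v : nball 0 r1 x -> nball 0 r0 (iter k.+1 (euler t) x) ->
   norm1 (v *m euler_jac t k.+1 x) <= L * norm1 v.
  move=> xr yr; rewrite -(@ler_pXn2r _ 2) ?nnegrE ?mulr_ge0 ?norm1_ge0 ?(ltW L0) //.
  rewrite -(ler_pM2l m0); apply: (le_trans (qm _ yr)); apply: (le_trans (fq' x v xr)).
  apply: (@le_trans _ _ (expR K * (M * norm1 v ^+ 2))).
    have q0 : 0 <= q x v.
      by apply: le_trans (qm v (sub10 _ xr)); rewrite mulr_ge0 ?sqr_ge0 // ltW.
    apply: ler_pM => //; last exact/qM/sub10.
    by rewrite exprn_ge0 // addr_ge0 // mulr_ge0 // sqr_ge0.
  rewrite exprMn mulrA [leRHS]mulrA; apply: ler_wpM2r; first exact: sqr_ge0.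
  apply: (@le_trans _ _ (m * L)); last first.
    by rewrite ler_pM2l // expr2 ler_peMr // ltW.
  by rewrite /L mulrDr mulr1 [m * _]mulrC divfK ?gt_eqF // lerDl ltW.
split=> // x xr.
have zr : nball 0 r1 (0 : 'rV[C]_n) by rewrite /nball /= subrr norm10.
have inr0 y : nball 0 r1 y -> nball 0 r0 (iter k.+1 (euler t) y).
  move=> yr; rewrite iterS [r0]splitr; apply: nballD.
    exact: lt_le_trans (fr y yr) r2r0.
  rewrite norm1Z modulusM modulus_i modulus_rc mulr1 gtr0_norm //.
  by apply: le_trans tr0; rewrite ler_piMr ?(ltW tp) // Z1 //; exact: fr.
have := @chol_mean_value _ _ _ 0 r1 _ _ 0 x (L * norm1 x) fD' zr.
rewrite add0r => /(_ xr (fun y yr => lip y x yr (inr0 y yr))).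
rewrite euler0 subr0 /nball /= subr0 => /le_lt_trans; apply.
by move: xr; rewrite /nball /= subr0 /r1 ltr_pdivlMr // mulrC.
Qed.

Lemma cdiag_expand (t : R) : 1%:M + (rc t * 'i) *: A 0 = cdiag (fun j => 1 + rc t * 'i * rc (h j)).
Proof.
rewrite A0; apply/matrixP => i j; rewrite !mxE.
by have [->|] := eqVneq i j; rewrite ?mulr1n ?mulr0n ?mulr0 ?addr0.
Qed.

Lemma euler_jac0 t k : euler_jac t k 0 = cdiag (fun j => (1 + rc t * 'i * rc (h j)) ^+ k).
Proof.
elim: k => [|k IH] /=.
  by apply/matrixP => i j; rewrite !mxE expr0.
rewrite IH euler0 cdiag_expand cdiagM; congr cdiag; apply/funext => j.
by rewrite exprSr.
Qed.

Lemma euler_eigen_neq0 t j : 1 <= modulus (1 + rc t * 'i * rc (h j)).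
Proof.
apply: le_trans (re_le_modulus _); apply: le_trans (ler_norm _).
by rewrite reD -mulrA reZ re_i im_rc oppr0 mulr0 addr0.
Qed.

(** Averaging the Euler iterates, renormalized by their differential at the
   fixed point, conjugates an Euler step to its linear part up to [O(t^2)]; a
   limit of these averages conjugates [Z] to its linear part. *)
Lemma euler_linearization : exists (r : R) w W, [/\ 0 < r, chol (nball 0 r) w W,
  w 0 = 0, W 0 = 1%:M & forall x, nball 0 r x -> Z x *m W x = w x *m A 0].
Proof.
have [r1 [r2 [t1 [r10 r20 t10 [/andP[r12 r20'] Z1] E]]]] := euler_iter_bounded.
(* [N u = t u ^ -2] steps of length [t u]: the averages over the orbit telescope
   up to [1 / N u], which is negligible compared with [t u]; [N0] makes
   [t u <= t1] and [t u <= r1 / 16] for all [u] *)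
pose N0 := (Num.truncn (Num.max t1^-1 (16 / r1))).+1.
pose p u := (N0 + u)%N.
have p0 u : (0 : R) < (p u)%:R by rewrite ltr0n /p /N0 addSn.
pose t u : R := (p u)%:R^-1; pose N u := (p u ^ 2)%N.
have t0' u : 0 < t u by rewrite invr_gt0.
have Np u : (0 : R) < (N u)%:R by rewrite /N natrX exprn_gt0.
have tN0 u : t u <= N0%:R^-1 by rewrite /t lef_pV2 ?posrE ?ltr0n // ler_nat /p leq_addr.
have bigN : Num.max t1^-1 (16 / r1) < N0%:R by exact: truncnS_gt.
have tt1 u : 0 < t u <= t1.
  rewrite t0' /= (le_trans (tN0 u)) // invf_ple ?posrE ?ltr0n // ltW //.
  by apply: le_lt_trans bigN; rewrite le_max lexx.
have tr1 u : t u <= r1 / 16.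
  rewrite (le_trans (tN0 u)) // invf_ple ?posrE ?ltr0n ?divr_gt0 // invf_div ltW //.
  by apply: le_lt_trans bigN; rewrite le_max lexx orbT.
have t1' u : t u <= 1.
  by rewrite (le_trans (tN0 u)) // invf_le1 ?ltr0n // ler1n.
have tN u : (N u)%:R * t u ^+ 2 = 1.
  by rewrite /N /t natrX -exprMn divff ?expr1n // gt_eqF.
have {}E u k : (k <= N u)%N -> chol (nball 0 r1) (iter k (euler (t u))) (euler_jac (t u) k) /\
   (forall x, nball 0 r1 x -> nball 0 r2 (iter k (euler (t u)) x)).
  by apply: E; rewrite ?tt1 ?tN.
pose c u : C := rc (t u) * 'i.
have mc u : modulus (c u) = t u by rewrite modulusM modulus_i modulus_rc mulr1 gtr0_norm.
pose l u j : C := 1 + c u * rc (h j).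
have l1 u j : 1 <= modulus (l u j) := euler_eigen_neq0 (t u) j.
have l0 u j : l u j != 0 by rewrite -modulus_eq0 gt_eqF // (lt_le_trans ltr01).
pose D u k := cdiag (fun j => (l u j)^-1 ^+ k).
have lV u k j : modulus ((l u j)^-1 ^+ k) <= 1.
  rewrite modulusX modulusV exprn_ile1 ?invr_ge0 ?modulus_ge0 //.
  by rewrite invf_le1 // (lt_le_trans ltr01).
(* the eigenvalues [l u j] have modulus at least 1 because [h j] is real, so the
   renormalization [D u k] does not increase norms *)
pose F u x := (N u)%:R^-1 *: \sum_(k < N u) iter k (euler (t u)) x *m D u k.
pose J u x := (N u)%:R^-1 *: \sum_(k < N u) euler_jac (t u) k x *m D u k.
have FD u : chol (nball 0 r1) (F u) (J u).
  apply: cholZ; apply: chol_sum => k; apply: chol_mulr.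
  exact: (E u k (ltnW (ltn_ord k))).1.
have n2 (x : 'rV[C]_n) : nball 0 r2 x -> norm1 x <= r2.
  by rewrite /nball /= subr0 => /ltW.
have FB u x : nball 0 r1 x -> norm1 (F u x) <= r2.
  move=> xr; rewrite norm1Z modulusV modulus_nat mulrC ler_pdivrMr //.
  apply: (le_trans (norm1_sum _ _ _)); rewrite mulr_natr -[X in _ *+ X]card_ord -sumr_const.
  apply: ler_sum => k _; apply: (le_trans (norm1_cdiag _ (lV u k))).
  by rewrite mulr1; apply: n2; exact: (E u k (ltnW (ltn_ord k))).2.
have [w [W [wD near]]] := montel r10 FD FB.
have r16 : 0 < r1 / 16 by rewrite divr_gt0.
have r8 : 0 < r1 / 8 by rewrite divr_gt0.
have in8 (x : 'rV[C]_n) : nball 0 (r1 / 16) x -> nball 0 (r1 / 8) x.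
  by rewrite /nball /= => /lt_le_trans; apply; lra.
have zr8 : nball 0 (r1 / 8) (0 : 'rV[C]_n) by rewrite /nball /= subrr norm10.
have F0 u : F u 0 = 0.
  rewrite /F big1 ?scaler0 // => k _; by rewrite euler0 mul0mx.
have J0 u : J u 0 = 1%:M.
  rewrite /J (eq_bigr (fun=> 1%:M)) => [|k _].
    by rewrite big_const card_ord iter_addr addr0 -[X in _ *: X]scaler_nat scalerA mulVf ?scale1r // -modulus_eq0 modulus_nat gt_eqF.
  rewrite euler_jac0 cdiagM; apply/matrixP => i j; rewrite !mxE -exprMn mulfV ?l0 //.
  by rewrite expr1n.
exists (r1 / 16), w, W; split=> //.
- by apply: cholS wD.
- apply/eqP; rewrite -norm1_eq0 eq_le norm1_ge0 andbT; apply/ler_addgt0Pl => e e0.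
  have [u _ []] := near 0 zr8 e 0%N e0.
  by rewrite F0 sub0r norm1N addr0 => /ltW.
- apply/row_matrixP => i; apply/eqP; rewrite -subr_eq0 -norm1_eq0 eq_le norm1_ge0 andbT.
  apply/ler_addgt0Pl => e e0; have [u _ [_ /(_ i)]] := near 0 zr8 e 0%N e0.
  by rewrite J0 norm1B addr0 => /ltW.
pose H := \sum_j `|h j|; have H0 : 0 <= H by apply: sumr_ge0.
have hH j : `|h j| <= H by rewrite /H (bigD1 j) //= lerDl; apply: sumr_ge0.
pose K' := 16 * r2 / r1 ^+ 2.
have K'0 : 0 <= K' by rewrite /K' divr_ge0 ?sqr_ge0 // mulr_ge0 // ltW.
pose cst := K' + 2 * r2 * (1 + H).
have cst0 : 0 <= cst by rewrite /cst addr_ge0 // !mulr_ge0 ?addr_ge0 // ltW.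
have step u x : nball 0 (r1 / 16) x -> norm1 (Z x *m J u x - F u x *m A 0) <= cst * t u.
  move=> xr.
  have xr1 : nball 0 r1 x by move: xr; rewrite /nball /=; lra.
  have cZ : norm1 (c u *: Z x) <= t u.
    rewrite norm1Z mc ler_piMr ?(ltW (t0' u)) // Z1 //.
    exact: lt_le_trans xr1 r12.
  have yr : nball 0 (r1 / 8) (x + c u *: Z x).
    rewrite (_ : r1 / 8 = r1 / 16 + r1 / 16); last by field.
    by apply: nballD => //; apply: le_trans cZ (tr1 u).
  have T : norm1 (F u (x + c u *: Z x) - F u x - (c u *: Z x) *m J u x) <= K' * t u * t u.
    have seg s : 0 <= s <= 1 -> nball 0 (r1 / 8) (x + rc s *: (c u *: Z x)).
      by move=> s01; apply: nball_segment => //; exact: in8.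
    apply: (@taylor1 _ _ _ _ (J u)) => s s01.
      by apply: (FD u _ _).1; have := seg s s01; rewrite /nball /=; lra.
    apply: (le_trans (cauchy_lipschitz (c u *: Z x) r10 (FD u) (FB u) (seg s s01) (in8 _ xr))).
    rewrite addrC addKr norm1Z modulus_rc -/K'.
    rewrite -mulrA -[leRHS]mulrA ler_wpM2l // ler_pM ?mulr_ge0 ?norm1_ge0 //.
    by case/andP: s01 => s0 s1; rewrite ger0_norm // (le_trans _ cZ) // ler_piMl ?norm1_ge0.
  have lH j : modulus (l u j) <= 1 + H.
    apply: (le_trans (modulusD _ _)); rewrite modulus1 lerD2l modulusM mc modulus_rc.
    by apply: le_trans (hH j); rewrite ler_piMl.
  pose b k := iter k (euler (t u)) x *m D u k.
  have bE k : iter k (euler (t u)) (x + c u *: Z x) *m D u k = b k.+1 *m cdiag (l u).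
    rewrite -[x + _]/(euler (t u) x) -iterSr /b -mulmxA cdiagM; congr (_ *m cdiag _).
    by apply/funext => j; rewrite exprSr mulfVK ?l0.
  have S : norm1 (F u (x + c u *: Z x) - F u x *m cdiag (l u)) <= 2 * r2 * (1 + H) * (t u) ^+ 2.
    have -> : F u (x + c u *: Z x) - F u x *m cdiag (l u) =
       (N u)%:R^-1 *: ((b (N u) - b 0%N) *m cdiag (l u)).
      rewrite /F -scalemxAl -scalerBr; congr (_ *: _).
      rewrite mulmx_suml -sumrB -(telescope_sumr b (leq0n _)) big_mkord mulmx_suml.
      by apply: eq_bigr => k _; rewrite bE mulmxBl.
    rewrite norm1Z modulusV modulus_nat mulrC ler_pdivrMr //.
    have -> : 2 * r2 * (1 + H) * t u ^+ 2 * (N u)%:R = 2 * r2 * (1 + H).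
      transitivity (2 * r2 * (1 + H) * ((N u)%:R * t u ^+ 2)); first ring.
      by rewrite tN mulr1.
    apply: (le_trans (norm1_cdiag _ lH)); rewrite ler_wpM2r ?addr_ge0 //.
    apply: (le_trans (norm1D _ _)); rewrite norm1N mulr_natl mulr2n.
    by rewrite lerD // (le_trans (norm1_cdiag _ (lV u _))) // mulr1; apply: n2; apply: (E u _ _).2.
  have lE : cdiag (l u) = 1%:M + c u *: A 0 by rewrite cdiag_expand.
  rewrite -(ler_pM2l (t0' u)) -[X in X * _ <= _]mc -norm1Z.
  rewrite (_ : c u *: _ = (F u (x + c u *: Z x) - F u x *m cdiag (l u))
    - (F u (x + c u *: Z x) - F u x - (c u *: Z x) *m J u x)); last first.
    have cancel (a f b' d : 'rV[C]_n) : b' - d = (a - (f + d)) - (a - f - b').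
      by apply/rowP => j; rewrite !mxE; ring.
    rewrite lE mulmxDr mulmx1 -(scalemxAr (c u) (F u x) (A 0)).
    rewrite -(scalemxAl (c u) (Z x) (J u x)) (scalerBr (c u)).
    move: (F u x) (F u _) (c u *: _) (c u *: _) => f a b' d; exact: cancel.
  apply: (le_trans (norm1D _ _)); rewrite norm1N; apply: (le_trans (lerD S T)).
  by rewrite /cst le_eqVlt; apply/orP; left; apply/eqP; ring.
move=> x xr; apply/eqP; rewrite -subr_eq0 -norm1_eq0 eq_le norm1_ge0 andbT.
apply/ler_addgt0Pl => e e0; rewrite addr0.
pose e' := e / (norm1 (Z x) + H + cst + 1).
have d0 : 0 < norm1 (Z x) + H + cst + 1 by have := norm1_ge0 (Z x); lra.
have e'0 : 0 < e' by rewrite divr_gt0.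
have [u uq [h1 h2]] := near x (in8 x xr) e' (Num.truncn e'^-1).+1 e'0.
have te : t u <= e'.
  rewrite invf_ple ?posrE //; apply: le_trans (ltW (truncnS_gt _)) _.
  by rewrite ler_nat (leq_trans uq) // leq_addl.
rewrite (_ : _ - _ = (Z x *m J u x - F u x *m A 0) + ((F u x - w x) *m A 0
   - (Z x *m J u x - Z x *m W x))); last first.
  have cancel (a b d f : 'rV[C]_n) : b - d = (a - f) + ((f - d) - (a - b)).
    by apply/rowP => j; rewrite !mxE; ring.
  by rewrite mulmxBl; exact: cancel.
apply: (le_trans (norm1D _ _)).
apply: (@le_trans _ _ (cst * e' + (H * e' + norm1 (Z x) * e'))); last first.
  rewrite -!mulrDl /e' mulrCA ler_piMr ?(ltW e0) // ler_pdivrMr // mul1r; lra.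
apply: lerD; first by apply: (le_trans (step u x xr)); rewrite ler_wpM2l.
apply: (le_trans (norm1D _ _)); rewrite norm1N; apply: lerD.
  rewrite A0 mulrC; apply: le_trans (norm1_cdiag _ (b := H) _) _.
    by move=> j; rewrite modulus_rc.
  by rewrite ler_wpM2r // ltW.
rewrite -mulmxBr mulmx_sum_row; apply: (le_trans (norm1_sum _ _ _)).
rewrite [norm1 (Z x)]/norm1 mulr_suml; apply: ler_sum => i _.
by rewrite norm1Z ler_wpM2l ?modulus_ge0 // linearB /= ltW.
Qed.

End Euler.
End Linearization.

(** * The inverse function theorem *)

Section InverseFunction.
Context {R : realType}.
Local Notation C := (Cx R).

Lemma mnorm1_cont n m (J : 'rV[C]_n -> 'M[C]_(n, m)) a : (forall i j, ccont (fun y => J y i j) a) ->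
  forall e : R, 0 < e -> exists2 d : R, 0 < d & forall y, norm1 (y - a) < d -> mnorm1 (J y - J a) <= e.
Proof.
move=> cJ e e0; have cv : vcont (fun y => mxvec (J y)) a.
  move=> k; case/mxvec_indexP: k => i j.
  by rewrite (_ : (fun y => _) = (fun y => J y i j)) //; apply/funext => y; rewrite mxvecE.
have [d d0 hd] := vcontP cv e0; exists d; first exact: d0.
move=> y /hd /ltW; apply: le_trans; rewrite -linearB /= /mnorm1 /norm1.
rewrite pair_bigA (reindex _ (curry_mxvec_bij n m)) /=.
rewrite le_eqVlt; apply/orP; left; apply/eqP; apply: eq_bigr => -[i j] _ /=.
by rewrite mxvecE.
Qed.

Lemma unitmx_of_ker0 (F : fieldType) n (A : 'M[F]_n) : (forall v : 'rV[F]_n, v *m A = 0 -> v = 0) -> A \in unitmx.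
Proof.
move=> h; rewrite -row_free_unit -kermx_eq0; apply/eqP/row_matrixP => i.
by rewrite row0; apply: h; apply/sub_kermxP; exact: row_sub.
Qed.

(** Inverse function theorem, by the contraction [x |-> x - (psi x - y) (J a)^-1]. *)
Lemma inverse_function n (psi : 'rV[C]_n -> 'rV[C]_n) J a r : 0 < r ->
  chol (nball a r) psi J -> J a \in unitmx ->
  exists d K : R, [/\ 0 < d, d <= r, 0 < K,
   (forall x y, nball a d x -> nball a d y -> norm1 (x - y) <= K * norm1 (psi x - psi y)) &
   (forall x s, nball a d x -> 0 < s -> exists2 e : R, 0 < e & forall y, norm1 (y - psi x) < e ->
     exists x', [/\ nball a d x', norm1 (x' - x) <= s & psi x' = y])].
Proof.
move=> r0 pD uJ; pose P := invmx (J a).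
have aa : nball a r a by rewrite /nball /= subrr norm10.
have kP0 : 0 < mnorm1 P + 1 by rewrite ltr_wpDl ?mnorm1_ge0.
have [d1 d10 hd1] := mnorm1_cont (pD a aa).2 (e := 1 / 2 / (mnorm1 P + 1)) ltac:(by rewrite !divr_gt0).
pose d := Num.min r d1.
have d0 : 0 < d by rewrite lt_min r0.
have dr : d <= r by rewrite ge_min lexx.
have sub (x : 'rV[C]_n) : nball a d x -> nball a r x by move=> /lt_le_trans; apply.
have JP (x v : 'rV[C]_n) : nball a d x -> norm1 (v *m J x *m P - v) <= norm1 v / 2.
  move=> ax.
  have -> : v *m J x *m P - v = (v *m (J x - J a)) *m P.
    by rewrite mulmxBr mulmxBl mulmxK.
  apply: (le_trans (norm1_mulmx _ _)).
  apply: (@le_trans _ _ (norm1 v * (1 / 2 / (mnorm1 P + 1)) * (mnorm1 P + 1))); last first.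
    by rewrite -mulrA divfK ?gt_eqF // div1r.
  rewrite ler_pM ?norm1_ge0 ?mnorm1_ge0 ?lerDl //.
  apply: (le_trans (norm1_mulmx _ _)); rewrite ler_wpM2l ?norm1_ge0 // hd1 //.
  by apply: lt_le_trans ax _; rewrite ge_min lexx orbT.
have contr x y : nball a d x -> nball a d y ->
    norm1 ((psi x - psi y) *m P - (x - y)) <= norm1 (x - y) / 2.
  move=> ax ay.
  have := @taylor1 R n n (fun z => psi z *m P) (fun z => J z *m P) y (x - y) 1%:M (norm1 (x - y) / 2).
  rewrite subrKC mulmx1 -mulmxBl; apply=> t t01.
    apply: cdiff_mulr; apply: (pD _ _).1; apply: sub; apply: nball_segment => //.
    by rewrite subrKC.
  rewrite mulmxBr mulmx1 mulmxA; apply: JP; apply: nball_segment => //.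
  by rewrite subrKC.
exists d, (2 * (mnorm1 P + 1)); split=> //.
- by rewrite mulr_gt0.
- move=> x y ax ay; have h1 := contr x y ax ay.
  have h2 := norm1_mulmx (psi x - psi y) P.
  have h3 : norm1 (psi x - psi y) * mnorm1 P <= (mnorm1 P + 1) * norm1 (psi x - psi y).
    by rewrite mulrC ler_wpM2r ?norm1_ge0 // lerDl.
  have := norm1_triangle (x - y) ((psi x - psi y) *m P) 0.
  rewrite !subr0 (norm1B (x - y)) -mulrA; lra.
move=> x s ax s0.
pose s1 := Num.min s ((d - norm1 (x - a)) / 2).
have s10 : 0 < s1 by rewrite lt_min s0 divr_gt0 // subr_gt0.
have in_d (z : 'rV[C]_n) : norm1 (z - x) <= s1 -> nball a d z.
  move=> h; have : s1 <= (d - norm1 (x - a)) / 2 by rewrite ge_min lexx orbT.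
  move: ax; have := norm1_triangle z x a; rewrite /nball /=; lra.
exists (s1 / 2 / (mnorm1 P + 1)); first by rewrite !divr_gt0.
move=> y; rewrite ltr_pdivlMr // => hy.
have [T TE] : exists T, forall z, T z = z - (psi z - y) *m P by eexists=> z.
have Tc z z' : norm1 (z - x) <= s1 -> norm1 (z' - x) <= s1 -> norm1 (T z - T z') <= norm1 (z - z') / 2.
  move=> /in_d h /in_d h'; apply: le_trans (contr z z' h h').
  rewrite -norm1N !TE !mulmxBl le_eqVlt; apply/orP; left; apply/eqP; congr norm1.
  by apply/rowP => j; rewrite !mxE; ring.
have Tx : norm1 (T x - x) <= s1 / 2.
  rewrite TE addrC addKr norm1N -norm1N -mulNmx opprB.
  apply: (le_trans (norm1_mulmx _ _)); apply: le_trans (ltW hy).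
  by rewrite ler_wpM2l ?norm1_ge0 // lerDl.
have n0 : norm1 (x - x) <= s1 by rewrite subrr norm10 ltW.
have Ts z : norm1 (z - x) <= s1 -> norm1 (T z - x) <= s1.
  move=> hz; have := norm1_triangle (T z) (T x) x; have := Tc z x hz n0; lra.
have xk k : norm1 (iter k T x - x) <= s1 by elim: k => //= k; exact: Ts.
have step k : norm1 (iter k.+1 T x - iter k T x) <= s1 / 2 ^+ k.
  elim: k => [|k IH]; first by rewrite expr0 divr1 /=; lra.
  apply: (le_trans (Tc _ _ (xk k.+1) (xk k))); rewrite exprSr invfM mulrA.
  by rewrite ler_wpM2r.
have bk k : norm1 (iter k T x) <= s1 + norm1 x.
  by have := norm1_triangle (iter k T x) x 0; rewrite !subr0; have := xk k; lra.
have [l hl] := ultra_lim_ex bk.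
have lx : norm1 (l - x) <= s1.
  apply/ler_addgt0Pr => e e0; have [k _ /= hk] := ultra_nat_ex 0 (hl e e0).
  by have := norm1_triangle l (iter k T x) x; rewrite (norm1B l (iter k T x)); have := xk k; lra.
exists l; split; [exact: in_d | by apply: le_trans lx _; rewrite ge_min lexx |].
have Tl : norm1 (T l - l) <= 0.
  apply/ler_addgt0Pr => e e0; rewrite add0r.
  have e4 : 0 < e / 4 by rewrite divr_gt0.
  have [k0 hk0] : exists k0 : nat, s1 / (e / 4) < k0%:R.
    by exists (Num.truncn (s1 / (e / 4))).+1; exact: truncnS_gt.
  have [k kk0 /= hk] := ultra_nat_ex k0 (hl _ e4).
  have hs : s1 / 2 ^+ k <= e / 4.
    rewrite ler_pdivrMr ?exprn_gt0 // mulrC -ler_pdivrMr //.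
    apply: (le_trans (ltW hk0)); rewrite -natrX ler_nat (leq_trans kk0) //.
    by rewrite ltnW // ltn_expl.
  have := Tc l (iter k T x) lx (xk k); have := step k.
  have := norm1_triangle (T l) (T (iter k T x)) l.
  have := norm1_triangle (T (iter k T x)) (iter k T x) l.
  rewrite /= (norm1B l (iter k T x)); lra.
have {}Tl : T l - l = 0 by apply/eqP; rewrite -norm1_eq0 eq_le Tl norm1_ge0.
have : (psi l - y) *m P = 0.
  by move: Tl; rewrite TE addrC addKr => /eqP; rewrite oppr_eq0 => /eqP.
move=> /(congr1 (mulmx^~ (J a))); rewrite /= mulmxKV // mul0mx => /eqP.
by rewrite subr_eq0 => /eqP.
Qed.

(** At a point where [phi] inverts [psi], Lipschitz continuity of [phi] turns
   the differential of [psi] into that of [phi]. *)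
Lemma cdiff_inverse n (psi phi : 'rV[C]_n -> 'rV[C]_n) A x (K : R) : 0 < K ->
  cdiff psi x A -> A \in unitmx -> phi (psi x) = x ->
  (exists2 e : R, 0 < e & forall y, norm1 (y - psi x) < e ->
     psi (phi y) = y /\ norm1 (phi y - x) <= K * norm1 (y - psi x)) ->
  cdiff phi (psi x) (invmx A).
Proof.
move=> K0 dp uA px [e1 e10 he1].
have k0 : 0 < mnorm1 (invmx A) + 1 by rewrite ltr_wpDl ?mnorm1_ge0.
move=> j; split=> [b h k|e e0]; first by rewrite mulmxDl -scalemxAl !mxE.
have [d d0 hd] := vdiffP dp (e := e / K / (mnorm1 (invmx A) + 1)) ltac:(by rewrite !divr_gt0).
exists (Num.min e1 (d / K)) => [|h]; first by rewrite lt_min e10 divr_gt0.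
rewrite lt_min ltr_pdivlMr // => /andP[h1 h2].
have [] := he1 (psi x + h); first by rewrite addrC addKr.
rewrite [psi x + h - _]addrC addKr; set y := phi (psi x + h) => py ly.
have hyx : norm1 (y - x) < d by apply: le_lt_trans ly _; rewrite mulrC.
have := hd (y - x) hyx; rewrite subrKC py [psi x + h - _]addrC addKr => T.
rewrite px; have := norm1_coord (y - x - h *m invmx A) j; rewrite !mxE => /le_trans; apply.
have -> : y - x - h *m invmx A = - ((h - (y - x) *m A) *m invmx A).
  by rewrite mulmxBl mulmxK // opprB.
rewrite norm1N; apply: (le_trans (norm1_mulmx _ _)).
apply: (@le_trans _ _ (e / K / (mnorm1 (invmx A) + 1) * (K * norm1 h) * (mnorm1 (invmx A) + 1))).
  rewrite ler_pM ?norm1_ge0 ?mnorm1_ge0 ?lerDl //; apply: (le_trans T).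
  by rewrite ler_wpM2l // ltW // !divr_gt0.
by rewrite mulrAC divfK ?gt_eqF // mulrA divfK ?gt_eqF.
Qed.

(** A kernel vector of [A] would be contracted by [psi] to first order. *)
Lemma lipschitz_inverse_unit n (psi : 'rV[C]_n -> 'rV[C]_n) A x (K : R) : 0 < K ->
  cdiff psi x A ->
  (exists2 d : R, 0 < d & forall h, norm1 h < d -> norm1 h <= K * norm1 (psi (x + h) - psi x)) ->
  A \in unitmx.
Proof.
move=> K0 dp [d d0 hd]; apply: unitmx_of_ker0 => v vA; apply/eqP; apply: contraT => v0.
have nv : 0 < norm1 v by rewrite norm1_gt0.
have [d' d'0 hd'] := vdiffP dp (e := K^-1 / 2) ltac:(by rewrite divr_gt0 // invr_gt0).
have m0 : 0 < Num.min d d' by rewrite lt_min d0.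
pose t := Num.min d d' / 2 / norm1 v; have t0 : 0 < t by rewrite !divr_gt0.
have nt : norm1 (rc t *: v) = Num.min d d' / 2.
  by rewrite norm1Z modulus_rc gtr0_norm // /t divfK // gt_eqF.
have : norm1 (rc t *: v) < Num.min d d' by rewrite nt; lra.
rewrite lt_min => /andP[/hd h1 /hd']; rewrite -scalemxAl vA scaler0 subr0 => h2.
have : norm1 (rc t *: v) <= K * (K^-1 / 2 * norm1 (rc t *: v)).
  by apply: (le_trans h1); rewrite ler_wpM2l // ltW.
rewrite !mulrA divff ?gt_eqF // mul1r nt; lra.
Qed.

End InverseFunction.

(** * Changes of charts *)

Section Charts.
Context {R : realType} {n : nat}.
Local Notation C := (Cx R).

Lemma norm1_openP (O : set 'rV[C]_n) :
  (forall a, O a -> exists2 r : R, 0 < r & nball a r `<=` O) -> open O.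
Proof.
move=> h; rewrite openE => a /h[r r0 hr]; apply/nbhs_norm1P.
by exists r; [exact: r0 | move=> x; exact: hr].
Qed.

Section OneChart.
Context {T : topologicalType} (c : chart R n T).

Lemma cmap_continuous_at x (U : set 'rV[C]_n) : cdom c x -> nbhs (cmap c x) U ->
  nbhs x (cmap c @^-1` U).
Proof.
move=> cx Ux; have := @cmap_continuous _ _ _ c.
rewrite continuous_open_subspace; last exact: cdom_open.
move=> /(_ x (mem_set cx)) /(_ U Ux).
by rewrite nbhs_filterE fmapE.
Qed.

Lemma cinv_continuous_at x (U : set T) : cdom c x -> nbhs x U ->
  nbhs (cmap c x) (cinv c @^-1` U).
Proof.
move=> cx Ux; have := @cinv_continuous _ _ _ c.
rewrite continuous_open_subspace; last exact: cimage_open.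
have im : (cmap c @` cdom c) (cmap c x) by exists x.
move=> /(_ _ (mem_set im)); rewrite /continuous_at /= cmapK // => /(_ U Ux).
by rewrite nbhs_filterE fmapE.
Qed.

Lemma cinvK y : (cmap c @` cdom c) y -> cdom c (cinv c y) /\ cmap c (cinv c y) = y.
Proof. by move=> [x cx <-]; rewrite cmapK. Qed.

Lemma cmap_image_nbhs x (U : set T) : cdom c x -> open U -> U x ->
  nbhs (cmap c x) [set y | cdom c (cinv c y) /\ U (cinv c y) /\ cmap c (cinv c y) = y].
Proof.
move=> cx oU Ux; have h1 : nbhs x (U : set T) by exact: open_nbhs_nbhs.
have h2 := cinv_continuous_at cx h1.
have h3 : nbhs (cmap c x) (cmap c @` cdom c).
  by apply: open_nbhs_nbhs; split; [exact: cimage_open | exists x].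
by apply: filterS (filterI h2 h3) => y /= [k1 /cinvK[k2 k3]].
Qed.

End OneChart.

(** By [inverse_function], [psi] is injective with open image near [cmap c p], so
   that [psi \o cmap c] is a chart there; [cdiff_inverse] makes it compatible with
   the atlas. Its domain is cut down to [W] as well. *)
Lemma change_chart (M : complex_manifold R n) (c : chart R n M) p (W : set M) psi J (r : R) :
  hol_chart c -> cdom c p -> open W -> W p -> 0 < r ->
  chol (nball (cmap c p) r) psi J -> J (cmap c p) \in unitmx ->
  exists z : chart R n M, [/\ hol_chart z, cdom z p & forall x, cdom z x ->
    [/\ cdom c x, W x, nball (cmap c p) r (cmap c x), cmap z x = psi (cmap c x) &
      transition_jacobian c z x = J (cmap c x)]].
Proof.
move=> hc cp oW Wp r0 pD uJ.
have [d [K [d0 dr K0 lip surj]]] := inverse_function r0 pD uJ.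
set a := cmap c p in pD uJ lip surj *.
pose V : set 'rV[C]_n := nball a d.
have oV : open V.
  apply: norm1_openP => x ax; exists (d - norm1 (x - a)); first by rewrite subr_gt0.
  by move=> y; rewrite /V /nball /= => h; have := norm1_triangle y x a; lra.
pose D : set M := [set x | cdom c x /\ W x /\ V (cmap c x)].
have Dnbhs x : D x -> nbhs x D.
  move=> [cx [Wx Vx]].
  have h1 : nbhs x (cdom c : set M) by apply: open_nbhs_nbhs; split; [exact: cdom_open|].
  have h2 : nbhs x (W : set M) by apply: open_nbhs_nbhs.
  have h3 : nbhs x (cmap c @^-1` V) by apply: cmap_continuous_at => //; exact: open_nbhs_nbhs.
  by apply: filterS (filterI h1 (filterI h2 h3)) => y [k1 [k2 k3]].
have oD : open D by rewrite openE => x /Dnbhs.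
have inj y y' : V y -> V y' -> psi y = psi y' -> y = y'.
  move=> Vy Vy' e; have := lip y y' Vy Vy'; rewrite e subrr norm10 mulr0 => h.
  by apply/eqP; rewrite -subr_eq0 -norm1_eq0 eq_le h norm1_ge0.
pose E : set 'rV[C]_n := cmap c @` D.
have EV y : E y -> V y by move=> [x [_ [_ ?]] <-].
have Eimg x : D x -> exists2 e : R, 0 < e & forall y, norm1 (y - psi (cmap c x)) < e ->
    exists2 y', E y' & psi y' = y.
  move=> Dx; have [cx [Wx Vx]] := Dx.
  have oWV : open (D : set M) := oD.
  have /nbhs_norm1P[s s0 hs] := cmap_image_nbhs cx oD Dx.
  have s2 : 0 < s / 2 by rewrite divr_gt0.
  have [e e0 he] := surj _ _ Vx s2; exists e; first exact: e0.
  move=> y /he[y' [Vy' yy' py']]; exists y' => //.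
  have [k1 [k2 k3]] := hs y' ltac:(by apply: le_lt_trans yy' _; lra).
  by exists (cinv c y').
pose inv y := xget a [set y' | E y' /\ psi y' = y].
have invP y : (exists2 y', E y' & psi y' = y) -> E (inv y) /\ psi (inv y) = y.
  move=> [y' Ey' py']; rewrite /inv; case: xgetP => [y'' _ []//|/(_ y')].
  by move=> /= h; exfalso; apply: h.
have invK y : E y -> inv (psi y) = y.
  move=> Ey; have [Ei pi'] := invP (psi y) (ex_intro2 _ _ y Ey erefl).
  by apply: inj; [exact: EV | exact: EV |].
have EcD y : E y -> D (cinv c y) /\ cmap c (cinv c y) = y.
  by move=> [x Dx <-]; rewrite cmapK //; case: Dx.
pose zmap x := psi (cmap c x); pose zinv y := cinv c (inv y).
have zK x : D x -> zinv (zmap x) = x.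
  move=> Dx; rewrite /zinv /zmap invK; last by exists x.
  by apply: cmapK; case: Dx.
have zimg y : (zmap @` D) y -> exists2 y', E y' & psi y' = y.
  by move=> [x Dx <-]; exists (cmap c x) => //; exists x.
have oim : open (zmap @` D).
  apply: norm1_openP => _ [x Dx <-]; have [e e0 he] := Eimg x Dx.
  exists e; first exact: e0.
  by move=> y /he[_ [x' Dx' <-] <-]; exists x'.
have pdiff x : D x -> cdiff psi (cmap c x) (J (cmap c x)).
  by move=> [_ [_ Vx]]; apply: (pD _ _).1; apply: lt_le_trans Vx dr.
have invlip x : D x -> exists2 e : R, 0 < e & forall y, norm1 (y - psi (cmap c x)) < e ->
     psi (inv y) = y /\ norm1 (inv y - cmap c x) <= K * norm1 (y - psi (cmap c x)).
  move=> Dx; have [e e0 he] := Eimg x Dx; exists e; first exact: e0.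
  move=> y /he /invP[Ey py]; split=> //; have := lip (inv y) (cmap c x).
  by rewrite py; apply; [exact: EV | case: Dx => _ []].
have unit x : D x -> J (cmap c x) \in unitmx.
  move=> Dx; apply: (lipschitz_inverse_unit K0 (pdiff x Dx)).
  have [_ [_ Vx]] := Dx; exists (d - norm1 (cmap c x - a)); first by rewrite subr_gt0.
  move=> h hh; have := lip (cmap c x + h) (cmap c x).
  rewrite (_ : cmap c x + h - cmap c x = h); last by rewrite addrC addKr.
  apply => //; rewrite /V /nball /= addrAC.
  by apply: le_lt_trans (norm1D _ _) _; lra.
have dinv x : D x -> differentiable inv (psi (cmap c x)).
  move=> Dx; apply: (proj1 (cdiff_differentiable _)).
  apply: (cdiff_inverse K0 (pdiff x Dx) (unit x Dx)); last exact: invlip.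
  by apply: invK; exists x.
have cz : {within D, continuous zmap}.
  rewrite continuous_open_subspace // => x /set_mem Dx U.
  have dp : {for cmap c x, continuous psi}.
    by apply: differentiable_continuous; exact: (cdiff_differentiable (pdiff x Dx)).1.
  move=> /dp; rewrite !nbhs_filterE !fmapE; apply: cmap_continuous_at.
  by case: Dx.
have ci : {within zmap @` D, continuous zinv}.
  rewrite continuous_open_subspace // => _ /set_mem [x Dx <-] U.
  have di : {for psi (cmap c x), continuous inv} by exact: differentiable_continuous (dinv x Dx).
  rewrite zK // => Ux.
  have cx : cdom c x by case: Dx.
  have hE : nbhs (inv (psi (cmap c x))) (cinv c @^-1` U).
    by rewrite invK; [exact: cinv_continuous_at | exists x].
  by move/di : hE; rewrite !nbhs_filterE !fmapE.
exists (@Chart R n M D zmap zinv oD oim zK cz ci); split.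
- move=> e Ae x /= Dx ex; have [cx [Wx Vx]] := Dx.
  have [h1 h2] := hc e Ae x cx ex; split.
    have h1' : differentiable (transition c e) (inv (psi (cmap c x))).
      by rewrite invK; [exact: h1 | exists x].
    exact: (differentiable_comp (dinv x Dx) h1').
  have dp : differentiable psi (transition e c (cmap e x)).
    rewrite /transition /= cmapK; last exact: ex.
    exact: (cdiff_differentiable (pdiff x Dx)).1.
  exact: (differentiable_comp h2 dp).
- by split=> //; split=> //; rewrite /V /nball /= subrr norm10.
move=> x /= Dx; have [cx [Wx Vx]] := Dx; split=> //.
  exact: lt_le_trans Vx dr.
rewrite /transition_jacobian; apply: (proj2 (cdiff_differentiable _)) => j.
apply: rdiff_near (pdiff x Dx j).
have /nbhs_norm1P[s s0 hs] := cmap_image_nbhs cx (@openT M) I.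
exists s; first exact: s0.
by move=> y /hs[_ [_ h]]; rewrite /transition /= /zmap h.
Qed.

End Charts.

(** * Smooth functions of the real coordinates *)

Section PartialDerivatives.
Context {R : realType} {N : nat}.
Implicit Types (u : 'rV[R]_N -> R) (D : set 'rV[R]_N).

Lemma coord_le_rnorm (y : 'rV[R]_N) j : `|y 0 j| <= `|y|.
Proof.
rewrite -[`|y|]/(mx_norm y) mx_normrE.
exact: (le_bigmax _ (fun ij : 'I_1 * 'I_N => `|y ij.1 ij.2|) (0, j)).
Qed.

Lemma rnorm_le (y : 'rV[R]_N) (e : R) : 0 <= e -> (forall j, `|y 0 j| <= e) -> `|y| <= e.
Proof.
move=> e0 h; rewrite -[`|y|]/(mx_norm y) mx_normrE; apply: bigmax_le => // -[i j] _ /=.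
by rewrite (ord1 i).
Qed.

Lemma continuous_eps u y : {for y, continuous u} ->
  forall e : R, 0 < e -> exists2 d : R, 0 < d & forall z, `|z - y| < d -> `|u z - u y| < e.
Proof.
move=> /cvgrPdist_lt cu e e0; have /nbhs_ballP[d /= d0 hd] := cu e e0.
exists d; first exact: d0.
move=> z zy; rewrite distrC; apply: hd.
by rewrite -ball_normE /ball_ /= distrC.
Qed.

Lemma is_derive_line u y (v : 'rV[R]_N) (t l : R) : is_derive (y + t *: v) v u l ->
  is_derive t 1 (fun s : R => u (y + s *: v)) l.
Proof.
move=> /is_derive_epsP h; apply/is_derive_epsP => e e0; have [d d0 hd] := h e e0.
exists d; first exact: d0.
move=> s sd; rewrite -[s *: 1]/(s * 1) mulr1 scalerDl addrA; exact: hd.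
Qed.

Lemma shift3 (x a b : 'rV[R]_N) : x + a + b - x = a + b.
Proof. by rewrite addrAC [x + a]addrC addrK. Qed.

Definition open_at D y := exists2 d : R, 0 < d & forall z, `|z - y| < d -> D z.

Definition C1_on D u := forall y, D y -> forall a,
  {for y, continuous (pderiv a u)} /\ derivable u y (frame a).

Lemma pderivP D u y a : C1_on D u -> D y -> is_derive y (frame a) u (pderiv a u y).
Proof. by move=> uD /uD/(_ a)[_ du]; exact: DeriveDef. Qed.

(** Continuous partial derivatives give differentiability: reach [y + h] by
   changing one coordinate at a time. *)
Lemma C1_differentiable D u y : C1_on D u -> open_at D y -> forall e : R, 0 < e ->
  exists2 d : R, 0 < d & forall h, `|h| < d ->
    `|u (y + h) - u y - \sum_a h 0 a * pderiv a u y| <= e * `|h|.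
Proof.
move=> uD [d0 d00 hd0] e e0.
have Dy : D y by apply: hd0; rewrite subrr normr0.
have e'0 : 0 < e / (N%:R + 1) by rewrite divr_gt0 // ltr_wpDl.
have cp a := continuous_eps (uD y Dy a).1 e'0.
pose dl a := projT1 (cid2 (cp a)).
have dl0 a : 0 < dl a by rewrite /dl; case: cid2.
have hdl a z : `|z - y| < dl a -> `|pderiv a u z - pderiv a u y| < e / (N%:R + 1).
  by rewrite /dl; case: cid2 => d /= _; apply.
pose d := \big[Num.min/d0]_a dl a.
have dp : 0 < d by rewrite /d; elim/big_ind: _ => // a b a0 b0; rewrite lt_min a0.
have dd0 : d <= d0 by exact: bigmin_le_id.
have dda a : d <= dl a by exact: bigmin_le_cond.
exists d; first exact: dp.
move=> h hd.
pose hk (k : nat) : 'rV[R]_N := \row_j (if (j < k)%N then h 0 j else 0).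
have hkN : hk N = h by apply/rowP => j; rewrite mxE ltn_ord.
have hk0 : hk 0%N = 0 by apply/rowP => j; rewrite !mxE.
have small (z : 'rV[R]_N) : (forall j, `|z 0 j| <= `|h 0 j|) -> `|z| <= `|h|.
  by move=> hz; apply: rnorm_le => // j; apply: (le_trans (hz j)); exact: coord_le_rnorm.
have step (a : 'I_N) : `|u (y + hk a.+1) - u (y + hk a) - h 0 a * pderiv a u y|
    <= e / (N%:R + 1) * `|h|.
  have hkS : hk a.+1 = hk a + h 0 a *: frame a.
    apply/rowP => j; rewrite !mxE eqxx /= ltnS leq_eqVlt.
    have [->|ja] := eqVneq j a; first by rewrite eqxx ltnn /= mulr1 add0r.
    by rewrite (negbTE (ja : nat_of_ord j != a)) /= mulr0 addr0.
  have pt (t : R) : 0 <= t <= 1 -> `|hk a + (t * h 0 a) *: frame a| <= `|h|.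
    move=> /andP[t0 t1]; apply: small => j; rewrite !mxE eqxx /=.
    have [->|ja] := eqVneq j a.
      by rewrite ltnn add0r mulr1 normrM ger0_norm // ler_piMl.
    by rewrite mulr0 addr0; case: ifP => _ //; rewrite normr0.
  have der (t : R) : 0 <= t <= 1 -> is_derive t 1 (fun s : R => u (y + hk a + s *: (h 0 a *: frame a)))
      (h 0 a * pderiv a u (y + hk a + t *: (h 0 a *: frame a))).
    move=> t01; apply: is_derive_line.
    have Dz : D (y + hk a + t *: (h 0 a *: frame a)).
      apply: hd0; rewrite shift3 scalerA.
      by apply: le_lt_trans (pt t t01) _; exact: lt_le_trans dd0.
    have /is_derive_epsP H := pderivP a uD Dz.
    apply/is_derive_epsP => e1 e10.
    have k0 : 0 < `|h 0 a| + 1 by rewrite ltr_wpDl.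
    have [d1 d10 hd1] := H (e1 / (`|h 0 a| + 1)) ltac:(by rewrite divr_gt0).
    exists (d1 / (`|h 0 a| + 1)); first by rewrite divr_gt0.
    move=> s; rewrite ltr_pdivlMr // => sd.
    have : `|s * h 0 a| < d1.
      by rewrite normrM; apply: le_lt_trans sd; rewrite ler_wpM2l // lerDl.
    move=> /hd1; rewrite !scalerA -mulrA => /le_trans; apply.
    rewrite normrM mulrCA [leRHS]mulrC ler_wpM2l // mulrAC ler_pdivrMr //.
    by rewrite ler_wpM2l ?(ltW e10) // lerDl.
  have [t t01] := real_mean_value (@ler01 R) der.
  rewrite scale1r scale0r addr0 subr0 mulr1 hkS addrA => ->.
  rewrite -mulrBr normrM mulrC; apply: ler_pM => //; last exact: coord_le_rnorm.
  apply/ltW/hdl; rewrite shift3 scalerA.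
  by apply: le_lt_trans (pt t t01) _; exact: lt_le_trans (dda a).
have -> : u (y + h) - u y - \sum_a h 0 a * pderiv a u y =
    \sum_(a < N) (u (y + hk a.+1) - u (y + hk a) - h 0 a * pderiv a u y).
  rewrite sumrB -(big_mkord xpredT (fun a => u (y + hk a.+1) - u (y + hk a))).
  by rewrite (telescope_sumr (fun k => u (y + hk k))) // hkN hk0 addr0.
apply: (le_trans (ler_norm_sum _ _ _)).
apply: (@le_trans _ _ (N%:R * (e / (N%:R + 1) * `|h|))).
  rewrite mulr_natl -[X in _ *+ X]card_ord -sumr_const; apply: ler_sum => a _.
  exact: step.
rewrite mulrA ler_wpM2r // mulrCA ler_piMr ?(ltW e0) //.
by rewrite ler_pdivrMr ?mul1r ?lerDl // ltr_wpDl.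
Qed.

(** The mean value theorem in the direction [a] for the increment of [u] by
   [s] in the direction [b], then in the direction [b]. *)
Lemma second_difference D u y a b (s : R) : C1_on D u -> C1_on D (pderiv a u) -> 0 < s ->
  (forall z, `|z - y| <= 2 * s -> D z) ->
  exists2 z, `|z - y| <= 2 * s & u (y + s *: frame a + s *: frame b) - u (y + s *: frame a)
     - (u (y + s *: frame b) - u y) = s * (s * pderiv b (pderiv a u) z).
Proof.
move=> uD duD s0 hD.
have nf (p : R) (c : 'I_N) : 0 <= p <= s -> `|p *: frame c| <= s.
  move=> /andP[p0 ps]; apply: rnorm_le; first exact: ltW.
  by move=> j; rewrite !mxE eqxx; case: (j == c); rewrite ?mulr1 ?mulr0 ?normr0 ?(ltW s0) // ger0_norm.
have sq (p q : R) : 0 <= p <= s -> 0 <= q <= s ->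
    `|y + p *: frame a + q *: frame b - y| <= 2 * s.
  move=> hp hq; rewrite shift3 mulr_natl mulr2n.
  by apply: (le_trans (ler_normD _ _)); rewrite lerD ?nf.
have s01 : 0 <= s <= s by rewrite lexx ltW.
have z01 : 0 <= (0 : R) <= s by rewrite lexx ltW.
have d1 (t : R) : 0 <= t <= s -> is_derive t 1
   (fun t : R => u (y + s *: frame b + t *: frame a) - u (y + t *: frame a))
   (pderiv a u (y + s *: frame b + t *: frame a) - pderiv a u (y + t *: frame a)).
  move=> t0.
  have D1 : D (y + s *: frame b + t *: frame a) by apply: hD; rewrite [y + s *: frame b + _]addrAC; exact: sq.
  have D2 : D (y + t *: frame a).
    by apply: hD; have := sq t 0 t0 z01; rewrite scale0r addr0.
  exact: (is_deriveB (is_derive_line (pderivP a uD D1)) (is_derive_line (pderivP a uD D2))).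
have [t t0] := real_mean_value (ltW s0) d1.
rewrite scale0r !addr0 subr0 [y + s *: frame b + _]addrAC => ->.
have d2 (r : R) : 0 <= r <= s -> is_derive r 1
   (fun r : R => pderiv a u (y + t *: frame a + r *: frame b))
   (pderiv b (pderiv a u) (y + t *: frame a + r *: frame b)).
  by move=> r0; apply: is_derive_line; apply: (pderivP b duD); apply: hD; exact: sq.
have [r r0] := real_mean_value (ltW s0) d2.
rewrite scale0r addr0 subr0 [y + s *: frame b + _]addrAC => ->.
by exists (y + t *: frame a + r *: frame b); [exact: sq | ring].
Qed.

(** The second difference is symmetric in [a] and [b]. *)
Lemma pderiv_sym D u y a b : C1_on D u -> (forall c, C1_on D (pderiv c u)) -> open_at D y ->
  pderiv b (pderiv a u) y = pderiv a (pderiv b u) y.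
Proof.
move=> uD duD [d0 d00 hd0].
have Dy : D y by apply: hd0; rewrite subrr normr0.
apply/eqP; rewrite -subr_eq0 -normr_eq0 eq_le normr_ge0 andbT.
apply/ler_addgt0Pl => e e0; rewrite addr0.
have e2 : 0 < e / 2 by rewrite divr_gt0.
have [d1 d10 h1] := continuous_eps (duD a y Dy b).1 e2.
have [d2 d20 h2] := continuous_eps (duD b y Dy a).1 e2.
pose d := Num.min d0 (Num.min d1 d2); have dp : 0 < d by rewrite !lt_min d00 d10.
have s0 : 0 < d / 4 by rewrite divr_gt0.
have quarter (x : R) : 0 < x -> 2 * (x / 4) < x by move=> ?; lra.
have hD (z : 'rV[R]_N) : `|z - y| <= 2 * (d / 4) -> D z.
  move=> h; apply: hd0; apply: le_lt_trans h _.
  by apply: (@lt_le_trans _ _ d); [exact: quarter | rewrite ge_min lexx].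
have [z1 hz1 E1] := second_difference b uD (duD a) s0 hD.
have [z2 hz2 E2] := second_difference a uD (duD b) s0 hD.
have E : pderiv b (pderiv a u) z1 = pderiv a (pderiv b u) z2.
  apply: (mulfI (lt0r_neq0 s0)); apply: (mulfI (lt0r_neq0 s0)).
  rewrite -E1 -E2 [y + _ *: frame b + _]addrAC; ring.
have k1 : `|z1 - y| < d1.
  apply: (le_lt_trans hz1); apply: (@lt_le_trans _ _ d); first exact: quarter.
  by rewrite !ge_min lexx orbT.
have k2 : `|z2 - y| < d2.
  apply: (le_lt_trans hz2); apply: (@lt_le_trans _ _ d); first exact: quarter.
  by rewrite !ge_min lexx !orbT.
have := h1 z1 k1; have := h2 z2 k2; rewrite E => j2 j1.
move: j1 j2; move: (pderiv a (pderiv b u) z2) (pderiv b (pderiv a u) y) (pderiv a (pderiv b u) y).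
move=> p q r j1 j2; rewrite (_ : q - r = (p - r) - (p - q)); last ring.
by apply: (le_trans (ler_normB _ _)); rewrite [leRHS]splitr lerD // ltW.
Qed.

Lemma smooth_on_C1 D u : smooth_on D u -> C1_on D u.
Proof.
move=> sD y Dy a; split; last exact: (sD [::] y Dy).2.
exact: (sD [:: a] y Dy).1.
Qed.

Lemma smooth_on_pderiv D u a : smooth_on D u -> smooth_on D (pderiv a u).
Proof. by move=> sD s y Dy; have := sD (rcons s a) y Dy; rewrite foldr_rcons. Qed.

End PartialDerivatives.

Section ComplexCoordinates.
Context {R : realType} {n : nat}.
Local Notation C := (Cx R).

Definition to_real (x : 'rV[C]_n) : 'rV[R]_(n + n) :=
  row_mx (map_mx (fun z : C => complex.Re z) x) (map_mx (fun z : C => complex.Im z) x).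

Lemma to_realK x : to_complex (to_real x) = x.
Proof.
apply/rowP => j; rewrite mxE /to_real row_mxEl row_mxEr.
by apply: complex_ext; rewrite /= mxE.
Qed.

Lemma to_complexK (y : 'rV[R]_(n + n)) : to_real (to_complex y) = y.
Proof.
apply/rowP => j; case: (split_ordP j) => k ->.
  by rewrite /to_real row_mxEl 2!mxE.
by rewrite /to_real row_mxEr 2!mxE.
Qed.

Lemma to_real_lin (a : R) x y : to_real (rc a *: x + y) = a *: to_real x + to_real y.
Proof.
apply/rowP => j; case: (split_ordP j) => k ->.
  by rewrite [RHS]mxE [in RHS]mxE /to_real !row_mxEl !mxE reD reZ.
by rewrite [RHS]mxE [in RHS]mxE /to_real !row_mxEr !mxE imD imZ.
Qed.
Lemma to_realD x y : to_real (x + y) = to_real x + to_real y.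
Proof. by have := to_real_lin 1 x y; rewrite rc1 !scale1r. Qed.
Lemma to_realB x y : to_real (x - y) = to_real x - to_real y.
Proof. by have := to_real_lin (-1) y x; rewrite rcN rc1 !scaleN1r [- y + _]addrC [- to_real y + _]addrC. Qed.

Lemma to_real_norm x : `|to_real x| <= norm1 x.
Proof.
apply: rnorm_le; first exact: norm1_ge0.
move=> j; case: (split_ordP j) => k ->; apply: le_trans (norm1_coord x k).
  by rewrite /to_real row_mxEl mxE re_le_modulus.
by rewrite /to_real row_mxEr mxE im_le_modulus.
Qed.

Lemma norm1_to_complex (y : 'rV[R]_(n + n)) : norm1 (to_complex y) <= (2 * n)%:R * `|y|.
Proof.
rewrite mulnC natrM -mulrA mulr_natl -[X in _ *+ X]card_ord -sumr_const.
apply: ler_sum => j _; rewrite !mxE; apply: (le_trans (modulus_le _)) => /=.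
by rewrite mulr_natl mulr2n lerD // coord_le_rnorm.
Qed.

(** The data of a soliton are functions of the real coordinates in [R^(n + n)];
   [lift] moves them to [C^n], where they meet the holomorphic data. *)
Definition lift (u : 'rV[R]_(n + n) -> R) (x : 'rV[C]_n) : C := rc (u (to_real x)).
Definition dlift (u : 'rV[R]_(n + n) -> R) (x v : 'rV[C]_n) : C :=
  \sum_a rc (to_real v 0 a) * lift (pderiv a u) x.

Lemma rdiff_lift D u x : C1_on D u -> open_at D (to_real x) -> rdiff (lift u) x (dlift u x).
Proof.
move=> uD oD; split=> [a h k|e e0].
  rewrite /dlift to_real_lin mulr_sumr -big_split; apply: eq_bigr => j _ /=.
  by rewrite !mxE rcD rcM; ring.
have [d d0 hd] := C1_differentiable uD oD e0; exists d; first exact: d0.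
move=> h hh; have nh := to_real_norm h.
apply: (@le_trans _ _ (e * `|to_real h|)); last by rewrite ler_wpM2l // ltW.
apply: le_trans (hd _ (le_lt_trans nh hh)).
rewrite /lift /dlift to_realD /lift -rcB (_ : \sum_a _ =
   rc (\sum_a to_real h 0 a * pderiv a u (to_real x))).
  by rewrite -rcB modulus_rc.
by elim/big_rec2: _ => [|i y1 y2 _ ->]; rewrite ?rcD ?rcM.
Qed.

Lemma ccont_lift u x : {for to_real x, continuous u} -> ccont (lift u) x.
Proof.
move=> /continuous_eps cu e e0; have [d d0 hd] := cu e e0; exists d; first exact: d0.
move=> y yx; rewrite /lift -rcB modulus_rc; apply: hd; rewrite -to_realB.
exact: le_lt_trans (to_real_norm _) yx.
Qed.

Lemma open_at_lift (D : set 'rV[R]_(n + n)) x (r : R) : 0 < r ->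
  (forall y, norm1 (y - x) < r -> D (to_real y)) -> open_at D (to_real x).
Proof.
move=> r0 hD; exists (r / ((2 * n)%:R + 1)); first by rewrite divr_gt0 // ltr_wpDl.
move=> z; rewrite ltr_pdivlMr ?ltr_wpDl // => zx; rewrite -[z]to_complexK; apply: hD.
have -> : to_complex z - x = to_complex (z - to_real x).
  by rewrite -[LHS]to_realK to_realB to_complexK.
apply: le_lt_trans (norm1_to_complex _) _; apply: le_lt_trans zx.
by rewrite mulrC ler_wpM2l // lerDl.
Qed.

End ComplexCoordinates.

(** * Hermitian forms *)

Section Hermitian.
Context {R : realType} {n : nat}.
Local Notation C := (Cx R).
Implicit Types (M : 'M[C]_n) (u v w : 'rV[C]_n).

Definition hform M u v : C := \sum_i \sum_j M i j * (u 0 i * Num.conj (v 0 j)).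

Lemma hformDl M u1 u2 v : hform M (u1 + u2) v = hform M u1 v + hform M u2 v.
Proof.
rewrite /hform -big_split; apply: eq_bigr => i _; rewrite -big_split.
by apply: eq_bigr => j _; rewrite mxE /=; ring.
Qed.
Lemma hformDr M u v1 v2 : hform M u (v1 + v2) = hform M u v1 + hform M u v2.
Proof.
rewrite /hform -big_split; apply: eq_bigr => i _; rewrite -big_split.
by apply: eq_bigr => j _; rewrite mxE rmorphD /=; ring.
Qed.
Lemma hformZl M a u v : hform M (a *: u) v = a * hform M u v.
Proof.
rewrite /hform mulr_sumr; apply: eq_bigr => i _; rewrite mulr_sumr.
by apply: eq_bigr => j _; rewrite mxE /=; ring.
Qed.
Lemma hformZr M a u v : hform M u (a *: v) = Num.conj a * hform M u v.
Proof.
rewrite /hform mulr_sumr; apply: eq_bigr => i _; rewrite mulr_sumr.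
by apply: eq_bigr => j _; rewrite mxE rmorphM /=; ring.
Qed.
Lemma conj_i : Num.conj ('i : C) = - 'i.
Proof. by rewrite conjCi. Qed.
Lemma hformDM M1 M2 u v : hform (M1 + M2) u v = hform M1 u v + hform M2 u v.
Proof.
rewrite /hform -big_split; apply: eq_bigr => i _; rewrite -big_split.
by apply: eq_bigr => j _; rewrite mxE /=; ring.
Qed.
Lemma hformZM a M u v : hform (a *: M) u v = a * hform M u v.
Proof.
rewrite /hform mulr_sumr; apply: eq_bigr => i _; rewrite mulr_sumr.
by apply: eq_bigr => j _; rewrite mxE /=; ring.
Qed.
Lemma hform_conj M u v : (map_mx Num.conj M)^T = M -> hform M v u = Num.conj (hform M u v).
Proof.
move=> hM; rewrite /hform rmorph_sum exchange_big; apply: eq_bigr => i _.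
rewrite rmorph_sum; apply: eq_bigr => j _.
rewrite !rmorphM -[in LHS]hM !mxE /= conjCK; ring.
Qed.

Lemma hform_bound M u v : modulus (hform M u v) <= mnorm1 M * (norm1 u * norm1 v).
Proof.
rewrite /hform /mnorm1 mulr_suml; apply: (le_trans (modulus_sum _ _ _)); apply: ler_sum => i _.
rewrite mulr_suml; apply: (le_trans (modulus_sum _ _ _)); apply: ler_sum => j _.
rewrite modulusM ler_wpM2l ?modulus_ge0 // modulusM modulus_conj.
by rewrite ler_pM ?modulus_ge0 ?norm1_coord.
Qed.

(** The infinitesimal isometry property of [i Z] at a point, from: [Z] is the
   gradient of [f], the second differential [d2] of [f] is symmetric, and the
   Kaehler form is closed.  Here [A] is the differential of [Z] and [dH v] the
   derivative of the metric [H] in the direction [v]; the second hypothesis is the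
   derivative of the identity [Re h(Z, w) = df(w)] in the direction [v]. *)
Lemma killing_identity (H A : 'M[C]_n) (dH : 'rV[C]_n -> 'M[C]_n) (z : 'rV[C]_n)
    (d2 : 'rV[C]_n -> 'rV[C]_n -> R) v :
  (forall u, (map_mx Num.conj (dH u))^T = dH u) ->
  (forall v w, complex.Re (hform (dH v) z w + hform H (v *m A) w) = d2 v w) ->
  (forall v w, d2 v w = d2 w v) ->
  (forall u v w, complex.Im (hform (dH u) v w) + complex.Im (hform (dH v) w u)
     + complex.Im (hform (dH w) u v) = 0) ->
  complex.Re (hform (dH ('i *: z)) v v) + 2 * complex.Re (hform H ('i *: (v *m A)) v) = 0.
Proof.
move=> hH gradient sym closed.
have Av : ('i *: v) *m A = 'i *: (v *m A) by rewrite scalemxAl.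
have S := sym v ('i *: v); rewrite -!gradient Av hformZl !hformZr conj_i in S.
have c1 := closed v ('i *: v) z.
have c2 := closed v ('i *: v) ('i *: z).
move: S c1 c2; rewrite !(hformZl, hformZr) conj_i.
rewrite (hform_conj z v (hH v)) (hform_conj v v (hH _)) => S c1 c2.
move: S c1 c2; rewrite !(reD, mulNr, reN, imN, re_i, im_i, imD, re_conj, im_conj, conjE) /=.
lra.
Qed.

(** Polarization, also at [i v]. *)
Lemma hform_skew_selfadjoint (H A : 'M[C]_n) : (map_mx Num.conj H)^T = H ->
  (forall v, complex.Im (hform H (v *m A) v) = 0) ->
  forall u v, hform H (u *m A) v = hform H u (v *m A).
Proof.
move=> hH h.
have sym u v : complex.Im (hform H (u *m A) v) = complex.Im (hform H u (v *m A)).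
  have := h (u + v); rewrite mulmxDl !(hformDl, hformDr) !imD !h.
  rewrite (hform_conj u (v *m A) hH) im_conj; lra.
move=> u v; apply: complex_ext; last exact: sym.
have := sym u ('i *: v); rewrite -scalemxAl !hformZr conj_i !mulNr !imN !im_i; lra.
Qed.

End Hermitian.

(** * A Kaehler Ricci soliton in a chart *)

Section RealStructure.
Context {R : realType} {n : nat}.
Local Notation C := (Cx R).
Implicit Types (H : 'M[C]_n).

Lemma to_complex_lin (a : R) (u v : 'rV[R]_(n + n)) :
  to_complex (a *: u + v) = rc a *: to_complex u + to_complex v.
Proof.
apply/rowP => j; rewrite !mxE; apply: complex_ext; rewrite ?(reD, imD, reZ, imZ) //=.
Qed.
Lemma to_complex0 : to_complex (0 : 'rV[R]_(n + n)) = 0.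
Proof. by apply/rowP => j; rewrite !mxE; apply: complex_ext. Qed.
Lemma to_complex_sum I (s : seq I) (F : I -> 'rV[R]_(n + n)) :
  to_complex (\sum_(i <- s) F i) = \sum_(i <- s) to_complex (F i).
Proof.
elim: s => [|i s IH]; first by rewrite !big_nil to_complex0.
by rewrite !big_cons -IH; have := to_complex_lin 1 (F i) (\sum_(j <- s) F j); rewrite rc1 !scale1r.
Qed.
Lemma to_complexZ (a : R) (u : 'rV[R]_(n + n)) : to_complex (a *: u) = rc a *: to_complex u.
Proof. by have := to_complex_lin a u 0; rewrite !addr0 to_complex0 addr0. Qed.

Lemma rc_half : (2^-1 : C) = rc 2^-1.
Proof. by rewrite rcV rc_nat. Qed.

Lemma metric_formE H (u v : 'rV[R]_(n + n)) : (map_mx Num.conj H)^T = H ->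
  metric_form H u v = rc (complex.Re (hform H (to_complex u) (to_complex v))).
Proof.
move=> hH; set U := to_complex u; set V := to_complex v.
have -> : metric_form H u v = 2^-1 * (hform H U V + hform H V U).
  rewrite mulrDr /metric_form /hform !mulr_sumr -big_split; apply: eq_bigr => i _.
  rewrite !mulr_sumr -big_split; apply: eq_bigr => j _ /=.
  rewrite /dzbar /dz -/U -/V; ring.
rewrite (hform_conj U V hH) rc_half; apply: complex_ext.
  by rewrite reZ reD re_conj re_rc; field.
by rewrite imZ imD im_conj im_rc subrr mulr0.
Qed.

Lemma real_metric_mul H (u v : 'rV[R]_(n + n)) : (map_mx Num.conj H)^T = H ->
  (u *m real_metric H *m v^T) 0 0 = complex.Re (hform H (to_complex u) (to_complex v)).
Proof.
move=> hH.
have hl U : complex.Re (hform H U (to_complex v)) =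
    \sum_b v 0 b * complex.Re (hform H U (to_complex (frame b))).
  rewrite {1}(row_sum_delta v) to_complex_sum /hform.
  transitivity (\sum_b complex.Re (hform H U (rc (v 0 b) *: to_complex (frame b)))).
    rewrite -re_sum; congr complex.Re; rewrite [RHS]exchange_big; apply: eq_bigr => i _.
    rewrite exchange_big; apply: eq_bigr => j _; rewrite -!mulr_sumr summxE rmorph_sum.
    by congr (_ * (_ * _)); apply: eq_bigr => b _; rewrite to_complexZ.
  apply: eq_bigr => b _; rewrite hformZr reM conjE re_rc im_rc /= oppr0 mul0r subr0 //.
rewrite hl mxE; apply: eq_bigr => b _; rewrite [v^T b 0]mxE mulrC; congr (_ * _).
rewrite mxE {2}(row_sum_delta u) to_complex_sum.
have -> : hform H (\sum_a to_complex (u 0 a *: frame a)) (to_complex (frame b)) =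
  \sum_a hform H (to_complex (u 0 a *: frame a)) (to_complex (frame b)).
  elim/big_rec2: _ => [|a x y _ <-]; last by rewrite hformDl.
  by rewrite -[0 in LHS](scale0r 0) hformZl mul0r.
rewrite re_sum; apply: eq_bigr => a _.
by rewrite mxE metric_formE // re_rc to_complexZ hformZl reZ.
Qed.

Lemma wedge11 (a b : 'rV[R]_(n + n) -> C) (v : 'I_2 -> 'rV[R]_(n + n)) :
  wedge (form1 a) (form1 b) v = a (v 0) * b (v 1) - a (v 1) * b (v 0).
Proof.
pose Mx : 'M[C]_2 := \matrix_(i, j) if j == 0 then a (v i) else b (v i).
transitivity (\det Mx^T).
  rewrite /wedge (_ : 1`! = 1%N) // mulr1 invr1 mul1r /determinant; apply: eq_bigr => s _.
  rewrite !big_ord_recl big_ord0 mulr1 !mxE /= /form1; congr (_ * (a (v (s _)) * b (v (s _)))).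
    by apply/val_inj.
  by apply/val_inj.
rewrite det_tr (expand_det_row Mx 0) !big_ord_recl big_ord0 addr0 /cofactor !det_mx11 !mxE /=.
have -> : fintype.lift 0 0 = 1 :> 'I_2 by apply/val_inj.
by rewrite /bump /= expr0 expr1 mul1r mulN1r mulrN [b _ * a _]mulrC.
Qed.

Lemma kahler_formE H (v : 'I_2 -> 'rV[R]_(n + n)) : (map_mx Num.conj H)^T = H ->
  kahler_form H v = - rc (complex.Im (hform H (to_complex (v 0)) (to_complex (v 1)))).
Proof.
move=> hH; set U := to_complex (v 0); set V := to_complex (v 1).
have -> : kahler_form H v = 'i / 2 * (hform H U V - hform H V U).
  rewrite /kahler_form /hform -sumrB; congr (_ * _); apply: eq_bigr => i _.
  rewrite -sumrB; apply: eq_bigr => j _.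
  by rewrite wedge11 /dzbar /dz -/U -/V mulrBr.
rewrite (hform_conj U V hH) rc_half -mulrA; apply: complex_ext.
  by rewrite re_i reN re_rc imZ imB im_conj; field.
by rewrite im_i imN im_rc reZ reB re_conj subrr mulr0 oppr0.
Qed.

Lemma rdiff_is_derive (G : 'rV[C]_n -> C) x L (v : 'rV[R]_(n + n)) : rdiff G x L ->
  is_derive (to_real x) v (fun y => complex.Re (G (to_complex y))) (complex.Re (L (to_complex v))).
Proof.
move=> /(@rdiff_line _ _ _ _ (to_complex v))/is_derive_epsP h; apply/is_derive_epsP => e e0.
have [d d0 hd] := h e e0; exists d; first exact: d0.
move=> s /hd; rewrite -[s *: 1]/(s * 1) mulr1 add0r rc0 scale0r addr0.
rewrite to_realK [to_real x + _]addrC to_complex_lin to_realK [x + _]addrC; exact.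
Qed.

Lemma hol_vector_type10 (w : 'rV[C]_n) (X : 'rV[R]_(n + n)) :
  hol_vector w = 2^-1 *: (complexify X - 'i *: complexify (Jrot X)) -> w = to_complex X.
Proof.
move=> hZ; apply/rowP => j.
have := congr1 (fun y : 'rV[C]_(n + n) => 2 * y 0 (lshift n j)) hZ.
have JE : (Jrot X) 0 (lshift n j) = - X 0 (rshift n j).
  by rewrite /Jrot row_mxEl 2!mxE.
move: (Jrot X) JE => Y JE; rewrite /hol_vector row_mxEl !mxE JE.
rewrite !mulrA divff ?pnatr_eq0 // !mul1r => ->.
by apply: complex_ext; rewrite ?reB ?imB ?re_i ?im_i /=; ring.
Qed.

Lemma rdiff_hform (Hf : 'rV[C]_n -> 'M[C]_n) (u : 'rV[C]_n -> 'rV[C]_n) w x (dH : 'rV[C]_n -> 'M[C]_n) L :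
  (forall i j, rdiff (fun y => Hf y i j) x (fun v => dH v i j)) -> vdiff u x L ->
  rdiff (fun y => hform (Hf y) (u y) w) x (fun v => hform (dH v) (u x) w + hform (Hf x) (L v) w).
Proof.
move=> hH hu.
have := rdiff_sum (index_enum 'I_n) (fun i => rdiff_sum (index_enum 'I_n) (fun j =>
  rdiffM (hH i j) (rdiffZ (Num.conj (w 0 j)) (hu i)))).
rewrite (_ : (fun y => \sum_i \sum_j Hf y i j * (Num.conj (w 0 j) * u y 0 i)) =
  (fun y => hform (Hf y) (u y) w)); last first.
  apply/funext => y; apply: eq_bigr => i _; apply: eq_bigr => j _; ring.
apply: rdiff_eqL => v; rewrite /hform -big_split; apply: eq_bigr => i _.
by rewrite -big_split; apply: eq_bigr => j _ /=; ring.
Qed.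

Lemma rdiff_kahler (Hf : 'rV[C]_n -> 'M[C]_n) (y : 'I_2 -> 'rV[R]_(n + n)) x (dH : 'rV[C]_n -> 'M[C]_n) :
  (forall i j, rdiff (fun y => Hf y i j) x (fun v => dH v i j)) ->
  rdiff (fun z => kahler_form (Hf z) y) x (fun v => kahler_form (dH v) y).
Proof.
move=> hH; apply: rdiffZ; apply: rdiff_sum => i; apply: rdiff_sum => j.
set k := wedge _ _ _.
rewrite (_ : (fun z => Hf z i j * k) = (fun z => k * Hf z i j)); last first.
  by apply/funext => z; rewrite mulrC.
by apply: rdiff_eqL (rdiffZ k (hH i j)) => v; rewrite mulrC.
Qed.

End RealStructure.

Section LocalData.
Context {R : realType} {n : nat}.
Local Notation C := (Cx R).
Variables (M : complex_manifold R n) (Z : hol_vector_field M) (W : set M).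
Variables (g : kahler_metric W) (f : M -> R) (c : chart R n M) (a : 'rV[C]_n) (r : R).
Hypothesis hc : hol_chart c.
Hypothesis soliton : gradient_soliton g f.
Hypothesis assoc : associated_vector_field g f Z.
Hypothesis hr : forall x, nball a r x -> [/\ cdom c (cinv c x), W (cinv c x) & cmap c (cinv c x) = x].

Definition loc_metric x := gcomp g c (cinv c x).
Definition loc_field x := vcomp Z c (cinv c x).
Definition loc_pot := local_expr c f.
Definition gre i j := local_expr c (fun x => complex.Re (gcomp g c x i j)).
Definition gim i j := local_expr c (fun x => complex.Im (gcomp g c x i j)).
Definition loc_dmetric x v : 'M[C]_n :=
  \matrix_(i, j) (dlift (gre i j) x v + 'i * dlift (gim i j) x v).
Definition loc_d2pot x v w : R :=
  complex.Re (\sum_b rc (to_real w 0 b) * dlift (pderiv b loc_pot) x v).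

Local Notation H := loc_metric.
Local Notation F := loc_field.
Local Notation D := (local_dom W c).

Lemma local_exprE (A : Type) (s : M -> A) x : local_expr c s (to_real x) = s (cinv c x).
Proof. by rewrite /local_expr to_realK. Qed.

Lemma loc_dom x : nball a r x -> D (to_real x).
Proof. by move=> /hr[h1 h2 h3]; exists (cinv c x); rewrite ?to_realK. Qed.

Lemma loc_open x : nball a r x -> open_at D (to_real x).
Proof.
move=> ax; apply: (@open_at_lift _ _ _ _ (r - norm1 (x - a))); first by rewrite subr_gt0.
move=> y yx; apply: loc_dom; rewrite /nball /=.
by have := norm1_triangle y x a; lra.
Qed.

Lemma gre_smooth i j : smooth_on D (gre i j). Proof. exact: (gcomp_smooth g i j hc).1. Qed.
Lemma gim_smooth i j : smooth_on D (gim i j). Proof. exact: (gcomp_smooth g i j hc).2. Qed.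
Lemma pot_smooth : smooth_on D loc_pot. Proof. exact: (soliton hc).1. Qed.

Lemma loc_metric_lift x i j : H x i j = lift (gre i j) x + 'i * lift (gim i j) x.
Proof.
rewrite /lift /gre /gim !local_exprE /loc_metric; apply: complex_ext.
  by rewrite reD re_i im_rc oppr0 addr0.
by rewrite imD im_i im_rc add0r.
Qed.

Lemma loc_metric_rdiff x i j : nball a r x -> rdiff (fun y => H y i j) x (fun v => loc_dmetric x v i j).
Proof.
move=> ax; rewrite (_ : (fun y => H y i j) = (fun y => lift (gre i j) y + 'i * lift (gim i j) y)); last first.
  by apply/funext => y; exact: loc_metric_lift.
apply: rdiff_eqL (rdiffD (rdiff_lift (smooth_on_C1 (gre_smooth i j)) (loc_open ax))
  (rdiffZ 'i (rdiff_lift (smooth_on_C1 (gim_smooth i j)) (loc_open ax)))) => v.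
by rewrite mxE.
Qed.

Lemma loc_metric_herm x : nball a r x -> (map_mx Num.conj (H x))^T = H x.
Proof. by move=> /hr[h1 h2 _]; exact: (@gcomp_hermitian _ _ _ _ g). Qed.

Lemma nball_near x : nball a r x -> exists2 d : R, 0 < d & forall y, norm1 (y - x) < d -> nball a r y.
Proof.
move=> ax; exists (r - norm1 (x - a)); first by rewrite subr_gt0.
by move=> y yx; rewrite /nball /=; have := norm1_triangle y x a; lra.
Qed.

Lemma loc_dmetric_herm x v : nball a r x -> (map_mx Num.conj (loc_dmetric x v))^T = loc_dmetric x v.
Proof.
move=> ax; apply/matrixP => i j; rewrite 2![LHS]mxE.
have h1 := rdiff_conj (loc_metric_rdiff j i ax).
have h2 : rdiff (fun y => Num.conj (H y j i)) x (fun v => loc_dmetric x v i j).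
  apply: rdiff_near (loc_metric_rdiff i j ax); have [d d0 hd] := nball_near ax.
  exists d; first exact: d0.
  by move=> y /hd /loc_metric_herm h; rewrite -[in LHS]h !mxE.
exact: rdiff_unique h1 h2 v.
Qed.

Lemma loc_metric_pos x v : nball a r x -> v != 0 -> 0 < complex.Re (hform (H x) v v).
Proof.
move=> ax v0; have [h1 h2 _] := hr ax.
have := @gcomp_pos _ _ _ _ g c (cinv c x) (to_real v) hc h2 h1.
rewrite metric_formE ?to_realK; last exact: loc_metric_herm.
rewrite -rc0 rc_lt; apply; apply: contra_neq v0 => v0.
by rewrite -[v]to_realK v0 to_complex0.
Qed.

Lemma loc_field_cdiff x : nball a r x -> cdiff F x (jacobian F x).
Proof.
move=> /hr[h1 h2 h3]; apply: differentiable_cdiff.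
have := @vcomp_hol _ _ _ Z c (cinv c x) hc h1; rewrite h3; exact.
Qed.

(** The field [Z] is the (1,0)-part of the gradient of [f], and the (1,0)-part
   of a real vector has the complex coordinates of that vector. *)
Lemma loc_gradient x w : nball a r x ->
  complex.Re (hform (H x) (F x) w) = complex.Re (dlift loc_pot x w).
Proof.
move=> ax; have hH := loc_metric_herm ax.
have /= := assoc hc (loc_dom ax); set X := gradient _ _ _.
rewrite !local_exprE => hZ.
have FX : F x = to_complex X := hol_vector_type10 hZ.
have unit : local_metric g c (to_real x) \in unitmx.
  rewrite /local_metric local_exprE -/(H x); apply: unitmx_of_ker0 => v vG.
  apply/eqP; apply: contraT => v0.
  have := @loc_metric_pos x (to_complex v) ax.
  rewrite -real_metric_mul // vG mul0mx mxE ltxx => -> //.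
  by apply: contra_neq v0 => v0; rewrite -[v]to_complexK v0 /to_real; apply/rowP => j;
    case: (split_ordP j) => k ->; rewrite ?row_mxEl ?row_mxEr !mxE.
have GX : X *m (local_metric g c (to_real x))^T = \row_l pderiv l loc_pot (to_real x).
  apply: trmx_inj; rewrite trmx_mul trmxK.
  have -> : X^T = invmx (local_metric g c (to_real x)) *m (\row_l pderiv l loc_pot (to_real x))^T.
    apply/matrixP => k l; rewrite (ord1 l) mxE [LHS]mxE [RHS]mxE.
    by apply: eq_bigr => b _; rewrite !mxE.
  by rewrite mulKVmx.
have := real_metric_mul (to_real w) X hH; rewrite to_realK -FX.
rewrite (hform_conj (F x) w hH) re_conj => <-.
have -> : real_metric (H x) = local_metric g c (to_real x).
  by rewrite /local_metric local_exprE.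
rewrite -mulmxA (_ : _ *m X^T = (\row_l pderiv l loc_pot (to_real x))^T); last first.
  by rewrite -GX trmx_mul trmxK.
rewrite mxE /dlift re_sum; apply: eq_bigr => b _.
by rewrite reZ /lift re_rc !mxE.
Qed.

Lemma loc_dpot_rdiff x w : nball a r x -> rdiff (fun y => dlift loc_pot y w) x
  (fun v => \sum_b rc (to_real w 0 b) * dlift (pderiv b loc_pot) x v).
Proof.
move=> ax; apply: rdiff_sum => b; apply: rdiffZ; apply: rdiff_lift; last exact: loc_open.
exact: smooth_on_C1 (smooth_on_pderiv b pot_smooth).
Qed.

Lemma loc_gradient_deriv x v w : nball a r x ->
  complex.Re (hform (loc_dmetric x v) (F x) w + hform (H x) (v *m jacobian F x) w) = loc_d2pot x v w.
Proof.
move=> ax; apply: rc_inj; have [d d0 hd] := nball_near ax.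
have h1 := rdiff_re (rdiff_hform w (fun i j => loc_metric_rdiff i j ax) (loc_field_cdiff ax)).
have h2 := rdiff_re (loc_dpot_rdiff w ax).
apply: (rdiff_unique (rdiff_near _ h1) h2 v); exists d; first exact: d0.
by move=> y /hd ay; rewrite loc_gradient.
Qed.

Lemma loc_d2pot_sym x v w : nball a r x -> loc_d2pot x v w = loc_d2pot x w v.
Proof.
move=> ax; have E u t : loc_d2pot x u t = \sum_b \sum_e to_real t 0 b * (to_real u 0 e *
    pderiv e (pderiv b loc_pot) (to_real x)).
  rewrite /loc_d2pot re_sum; apply: eq_bigr => b _; rewrite reZ /dlift re_sum mulr_sumr.
  by apply: eq_bigr => e _; rewrite reZ.
have sp := pot_smooth.
have S b e : pderiv e (pderiv b loc_pot) (to_real x) = pderiv b (pderiv e loc_pot) (to_real x).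
  have h1 := smooth_on_C1 sp.
  have h2 k := smooth_on_C1 (smooth_on_pderiv k sp).
  exact: (pderiv_sym b e h1 h2 (loc_open ax)).
rewrite !E exchange_big; apply: eq_bigr => b _; apply: eq_bigr => e _.
rewrite S.
by rewrite mulrCA.
Qed.

(** [ext_deriv] of the Kaehler form has three terms, one for each cyclic
   permutation of the arguments. *)
Lemma loc_closed x u v w : nball a r x ->
  complex.Im (hform (loc_dmetric x u) v w) + complex.Im (hform (loc_dmetric x v) w u)
     + complex.Im (hform (loc_dmetric x w) u v) = 0.
Proof.
move=> ax; pose vv (i : 'I_3) := nth 0 [:: to_real u; to_real v; to_real w] i.
have cl := congr1 (fun z : C => complex.Re z) (@gcomp_closed _ _ _ _ g c (to_real x) vv hc (loc_dom ax)).
have dd (t : 'rV[R]_(n + n)) (y : 'I_2 -> 'rV[R]_(n + n)) :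
    complex.Re (dirder t (fun x' => local_expr c (fun x0 => kahler_form (gcomp g c x0)) x' y) (to_real x)) =
    - complex.Im (hform (loc_dmetric x (to_complex t)) (to_complex (y 0)) (to_complex (y 1))).
  have h := rdiff_is_derive t (rdiff_kahler y (fun i j => loc_metric_rdiff i j ax)).
  rewrite /dirder /= [LHS](@derive_val _ _ _ _ _ _ _ h) kahler_formE ?reN ?re_rc //.
  exact: loc_dmetric_herm.
have sum3 (Q : 'I_3 -> R) : \sum_i Q i = Q 0 + Q 1 + Q 2.
  rewrite !big_ord_recl big_ord0 addr0 addrA; congr (_ + Q _ + Q _); exact/val_inj.
pose vc i := to_complex (vv i).
pose Q (i : 'I_3) : R := (-1) ^+ i * - complex.Im (hform (loc_dmetric x (vc i))
  (vc (fintype.lift i (0 : 'I_2))) (vc (fintype.lift i (1 : 'I_2)))).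
have : \sum_i Q i = 0.
  rewrite -[RHS]cl /ext_deriv re_sum; apply: eq_bigr => i _.
  rewrite (_ : (-1) ^+ i = rc ((-1) ^+ i)); last by rewrite rcX rcN rc1.
  by rewrite reZ dd.
have v0 : vc 0 = u by rewrite /vc /vv /= to_realK.
have v1 : vc 1 = v by rewrite /vc /vv /= to_realK.
have v2 : vc 2 = w by rewrite /vc /vv /= to_realK.
have l00 : fintype.lift (0 : 'I_3) (0 : 'I_2) = 1 by exact/val_inj.
have l01 : fintype.lift (0 : 'I_3) (1 : 'I_2) = 2 by exact/val_inj.
have l10 : fintype.lift (1 : 'I_3) (0 : 'I_2) = 0 by exact/val_inj.
have l11 : fintype.lift (1 : 'I_3) (1 : 'I_2) = 2 by exact/val_inj.
have l20 : fintype.lift (2 : 'I_3) (0 : 'I_2) = 0 by exact/val_inj.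
have l21 : fintype.lift (2 : 'I_3) (1 : 'I_2) = 1 by exact/val_inj.
rewrite sum3 /Q l00 l01 l10 l11 l20 l21 v0 v1 v2.
have -> : (-1) ^+ (nat_of_ord (0 : 'I_3)) = 1 :> R by rewrite expr0.
have -> : (-1) ^+ (nat_of_ord (1 : 'I_3)) = -1 :> R by rewrite expr1.
have -> : (-1) ^+ (nat_of_ord (2 : 'I_3)) = 1 :> R by rewrite sqrrN expr1n.
rewrite (hform_conj u w (loc_dmetric_herm v ax)) im_conj; lra.
Qed.

Lemma loc_killing x v : nball a r x ->
  complex.Re (hform (loc_dmetric x ('i *: F x)) v v)
    + 2 * complex.Re (hform (H x) ('i *: (v *m jacobian F x)) v) = 0.
Proof.
move=> ax; apply: (killing_identity (d2 := loc_d2pot x)).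
- by move=> u; exact: loc_dmetric_herm.
- by move=> u w; exact: loc_gradient_deriv.
- by move=> u w; exact: loc_d2pot_sym.
- by move=> u w t; exact: loc_closed.
Qed.

Lemma loc_pot_invariant x : nball a r x -> complex.Re (dlift loc_pot x ('i *: F x)) = 0.
Proof.
move=> ax; rewrite -loc_gradient // hformZr conj_i mulNr reN re_i opprK.
have := hform_conj (F x) (F x) (loc_metric_herm ax).
by move/(congr1 (fun z : C => complex.Im z)); rewrite im_conj; lra.
Qed.

(** At a zero of [Z] the derivative of the metric drops out of [loc_killing]. *)
Lemma loc_singular_skew x v : nball a r x -> F x = 0 ->
  complex.Im (hform (H x) (v *m jacobian F x) v) = 0.
Proof.
move=> ax F0; have := loc_killing v ax; rewrite F0 scaler0.
have -> : loc_dmetric x 0 = 0.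
  apply/matrixP => i j; have [lL _] := loc_metric_rdiff i j ax.
  by rewrite (rlinear0 lL) mxE.
rewrite hformZl re_i (_ : hform 0 v v = 0) /=; first lra.
by rewrite /hform big1 // => i _; rewrite big1 // => j _; rewrite mxE mul0r.
Qed.

End LocalData.

(** * Distortion of the metric by Euler steps *)

Section Quadratic.
Context {R : realType} {n : nat}.
Local Notation C := (Cx R).

Lemma rdiff_mean_value k (G : 'rV[C]_k -> C) (x h : 'rV[C]_k) (L : R -> 'rV[C]_k -> C) (K : R) :
  (forall t : R, 0 <= t <= 1 -> rdiff G (x + rc t *: h) (L t)) ->
  (forall t : R, 0 <= t <= 1 -> modulus (L t h) <= K) ->
  modulus (G (x + h) - G x) <= K.
Proof.
move=> dG bL; have [al al1 alE] := phaseP (G (x + h) - G x).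
rewrite -[leLHS]re_rc -alE mulrBr.
apply: (@re_mean_value _ _ (fun y => al * G y) _ _ (fun t k => al * L t k)) => t t01.
  exact/rdiffZ/dG.
apply: le_trans (ler_norm _) _; apply: (le_trans (re_le_modulus _)).
by rewrite modulusM al1 mul1r bL.
Qed.

Lemma to_real_coord (x : 'rV[C]_n) b : `|to_real x 0 b| <= norm1 x.
Proof. exact: le_trans (coord_le_rnorm _ _) (to_real_norm _). Qed.

(** Taylor's formula, with the partial derivatives of order at most two bounded
   near [a]. *)
Lemma lift_quadratic (u : 'rV[R]_(n + n) -> R) D (a : 'rV[C]_n) (r : R) : 0 < r -> smooth_on D u ->
  (forall x, nball a r x -> D (to_real x)) ->
  exists s K : R, [/\ 0 < s <= r, 0 <= K,
    (forall x h, nball a s x -> nball a s (x + h) ->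
       modulus (lift u (x + h) - lift u x - dlift u x h) <= K * norm1 h ^+ 2) &
    (forall x h, nball a s x -> modulus (dlift u x h) <= K * norm1 h)].
Proof.
move=> r0 su hD.
have aa : nball a r a by rewrite /nball /= subrr norm10.
have oD x : nball a r x -> open_at D (to_real x).
  move=> ax; apply: (@open_at_lift _ _ _ _ (r - norm1 (x - a))); first by rewrite subr_gt0.
  by move=> y yx; apply: hD; rewrite /nball /=; have := norm1_triangle y x a; lra.
have bd (l : seq 'I_(n + n)) : exists2 s : R, 0 < s & forall x, nball a s x ->
    modulus (lift (foldr pderiv u l) x) <= modulus (lift (foldr pderiv u l) a) + 1.
  have [s s0 hs] := ccont_lift (su l _ (hD _ aa)).1 (@ltr01 R).
  exists s; first exact: s0.
  move=> x /hs h; rewrite -[X in modulus X](subrK (lift (foldr pderiv u l) a)).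
  by apply: (le_trans (modulusD _ _)); rewrite addrC lerD2l ltW.
pose s1 b := projT1 (cid2 (bd [:: b])); pose s2 be := projT1 (cid2 (bd [:: be.1; be.2])).
have s1P b : 0 < s1 b by rewrite /s1; case: cid2.
have s2P be : 0 < s2 be by rewrite /s2; case: cid2.
pose s := Num.min r (Num.min (\big[Num.min/r]_b s1 b) (\big[Num.min/r]_be s2 be)).
have s0 : 0 < s.
  rewrite !lt_min r0 /=; apply/andP; split; apply: (big_ind (fun z : R => 0 < z)) => // x y x0 y0;
    by rewrite lt_min x0.
have sr : s <= r by rewrite ge_min lexx.
pose K := \sum_b (modulus (lift (pderiv b u) a) + 1) +
   \sum_b \sum_e (modulus (lift (pderiv e (pderiv b u)) a) + 1).
have K1 b : modulus (lift (pderiv b u) a) + 1 >= 0 by rewrite addr_ge0 ?modulus_ge0.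
have K2 b e : modulus (lift (pderiv e (pderiv b u)) a) + 1 >= 0 by rewrite addr_ge0 ?modulus_ge0.
have B1 x b : nball a s x -> modulus (lift (pderiv b u) x) <= modulus (lift (pderiv b u) a) + 1.
  have : s <= s1 b by rewrite !ge_min; apply/orP; right; apply/orP; left; exact: bigmin_le_cond.
  rewrite /s1; case: cid2 => s' /= _ hs' ss' ax; apply: hs'; exact: lt_le_trans ax ss'.
have B2 x b e : nball a s x ->
    modulus (lift (pderiv e (pderiv b u)) x) <= modulus (lift (pderiv e (pderiv b u)) a) + 1.
  have : s <= s2 (e, b).
    by rewrite !ge_min; apply/orP; right; apply/orP; right; exact: bigmin_le_cond.
  rewrite /s2; case: cid2 => s' /= _ hs' ss' ax; apply: hs'; exact: lt_le_trans ax ss'.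
have S1 : 0 <= \sum_b (modulus (lift (pderiv b u) a) + 1) by apply: sumr_ge0.
have S2 : 0 <= \sum_b \sum_e (modulus (lift (pderiv e (pderiv b u)) a) + 1).
  by apply: sumr_ge0 => b _; apply: sumr_ge0.
exists s, K; split; first by rewrite s0.
- by rewrite addr_ge0.
- move=> x h ax axh.
  have seg (t : R) : 0 <= t <= 1 -> nball a s (x + rc t *: h) by exact: nball_segment.
  have sub (y : 'rV[C]_n) : nball a s y -> nball a r y by move=> /lt_le_trans; apply.
  have dl' (y : 'rV[C]_n) w : nball a r y -> smooth_on D w -> rdiff (lift w) y (dlift w y).
    by move=> ay sw; apply: rdiff_lift (smooth_on_C1 sw) (oD _ ay).
  have [lL _] := dl' x u (sub _ ax) su.
  have := @rdiff_mean_value _ (fun y => lift u y - dlift u x y) x h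
    (fun t k => dlift u (x + rc t *: h) k - dlift u x k) (K * norm1 h ^+ 2).
  rewrite (rlinearD _ _ lL) (_ : _ - _ - (_ - _) = lift u (x + h) - lift u x - dlift u x h); last ring.
  apply=> t t01.
    apply: rdiffB; first by apply: dl' => //; exact/sub/seg.
    exact: rdiff_lin.
  have D1 b : modulus (lift (pderiv b u) (x + rc t *: h) - lift (pderiv b u) x) <=
      norm1 h * \sum_e (modulus (lift (pderiv e (pderiv b u)) a) + 1).
    have t1 : norm1 (rc t *: h) <= norm1 h.
      case/andP: t01 => t0 t1.
      by rewrite norm1Z modulus_rc ger0_norm // ler_piMl ?norm1_ge0.
    apply: (@rdiff_mean_value _ _ _ _ (fun t' => dlift (pderiv b u) (x + rc t' *: (rc t *: h)))).
      move=> t' t'01; apply: dl'; last exact: smooth_on_pderiv.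
      by apply/sub/nball_segment => //; exact: seg.
    move=> t' t'01; rewrite mulr_sumr /dlift; apply: (le_trans (modulus_sum _ _ _)).
    apply: ler_sum => e _; rewrite modulusM modulus_rc; apply: ler_pM; rewrite ?modulus_ge0 //.
      by apply: le_trans t1; exact: to_real_coord.
    by apply: B2; apply: nball_segment => //; exact: seg.
  rewrite /dlift -sumrB; apply: (le_trans (modulus_sum _ _ _)).
  apply: (@le_trans _ _ (\sum_b norm1 h * (norm1 h * \sum_e (modulus (lift (pderiv e (pderiv b u)) a) + 1)))).
    apply: ler_sum => b _; rewrite -mulrBr modulusM modulus_rc.
    by apply: ler_pM; rewrite ?modulus_ge0 ?to_real_coord ?D1.
  rewrite -!mulr_sumr mulrA -expr2 mulrC ler_wpM2r ?sqr_ge0 // lerDr //.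
move=> x h ax; rewrite /dlift; apply: (le_trans (modulus_sum _ _ _)).
apply: (@le_trans _ _ (\sum_b norm1 h * (modulus (lift (pderiv b u) a) + 1))).
  apply: ler_sum => b _; rewrite modulusM modulus_rc.
  by apply: ler_pM; rewrite ?modulus_ge0 ?to_real_coord ?B1.
by rewrite -mulr_sumr mulrC ler_wpM2r ?norm1_ge0 // lerDl.
Qed.

Lemma sqr_norm1_le (v : 'rV[C]_n) : norm1 v ^+ 2 <= n%:R * \sum_j modulus (v 0 j) ^+ 2.
Proof.
rewrite expr2 /norm1 mulr_suml.
apply: (@le_trans _ _ (\sum_i \sum_j (modulus (v 0 i) ^+ 2 + modulus (v 0 j) ^+ 2) / 2)).
  apply: ler_sum => i _; rewrite mulr_sumr; apply: ler_sum => j _.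
  have := sqr_ge0 (modulus (v 0 i) - modulus (v 0 j)); rewrite sqrrB; lra.
under eq_bigr do rewrite -mulr_suml big_split /= big_const card_ord iter_addr addr0.
rewrite -mulr_suml big_split /= big_const card_ord iter_addr addr0 sumrMnl -mulr2n.
by rewrite -[X in X / 2]mulr_natl mulrAC mulfV ?mul1r ?mulr_natl // pnatr_eq0.
Qed.

Lemma sum_sqr_le (v : 'rV[C]_n) : \sum_j modulus (v 0 j) ^+ 2 <= norm1 v ^+ 2.
Proof.
rewrite expr2 {1}/norm1 mulr_suml; apply: ler_sum => i _; rewrite expr2.
by rewrite ler_wpM2l ?modulus_ge0 // norm1_coord.
Qed.

Lemma hform1 (v : 'rV[C]_n) : complex.Re (hform 1%:M v v) = \sum_j modulus (v 0 j) ^+ 2.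
Proof.
rewrite /hform re_sum; apply: eq_bigr => i _; rewrite (bigD1 i) //= big1 => [|j ji].
  by rewrite mxE eqxx mul1r addr0 mul_conj re_rc.
by rewrite mxE eq_sym (negbTE ji) mul0r.
Qed.

End Quadratic.

Lemma hform_quadratic (R : realType) n (H : 'M[Cx R]_n) (v xi : 'rV[Cx R]_n) (t : R) :
  (map_mx Num.conj H)^T = H ->
  complex.Re (hform H (v + rc t *: xi) (v + rc t *: xi)) = complex.Re (hform H v v)
      + t * (2 * complex.Re (hform H xi v)) + t ^+ 2 * complex.Re (hform H xi xi).
Proof.
move=> herm; rewrite !(hformDl, hformDr, hformZl, hformZr) (hform_conj xi v herm).
have ct : Num.conj (rc t : Cx R) = rc t.
  by apply: complex_ext; rewrite ?re_conj ?im_conj ?im_rc ?oppr0.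
rewrite ct !(reD, reZ) re_conj; ring.
Qed.

Lemma step_identity (R : realType) (t q p b k e y : R) : p + 2 * b = 0 ->
  e + (q + t * (2 * b) + t ^+ 2 * k) + t * (p + y) = q + e + t * y + t ^+ 2 * k.
Proof. move=> h; have -> : 2 * b = - p by rewrite -(addr0_eq h).
ring. Qed.

Section MetricEstimates.
Context {R : realType} {n : nat}.
Local Notation C := (Cx R).
Variables (M : complex_manifold R n) (Z : hol_vector_field M) (W : set M).
Variables (g : kahler_metric W) (f : M -> R) (c : chart R n M) (a : 'rV[C]_n) (r : R).
Hypothesis hc : hol_chart c.
Hypothesis soliton : gradient_soliton g f.
Hypothesis assoc : associated_vector_field g f Z.
Hypothesis r0 : 0 < r.
Hypothesis hr : forall x, nball a r x -> [/\ cdom c (cinv c x), W (cinv c x) & cmap c (cinv c x) = x].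

Local Notation H := (loc_metric g c).
Local Notation F := (loc_field Z c).
Local Notation dH := (loc_dmetric g c).

Lemma nball_le (s t : R) (x : 'rV[C]_n) : s <= t -> nball a s x -> nball a t x.
Proof. by move=> st; rewrite /nball /=; move=> /lt_le_trans; apply. Qed.

Lemma metric_quadratic : exists s K : R, [/\ 0 < s <= r, 0 <= K,
    (forall x h, nball a s x -> nball a s (x + h) ->
       mnorm1 (H (x + h) - H x - dH x h) <= K * norm1 h ^+ 2) &
    (forall x h, nball a s x -> mnorm1 (dH x h) <= K * norm1 h)].
Proof.
pose P u (p : R * R) := [/\ 0 < p.1 <= r, 0 <= p.2,
    (forall x h, nball a p.1 x -> nball a p.1 (x + h) ->
       modulus (lift u (x + h) - lift u x - dlift u x h) <= p.2 * norm1 h ^+ 2) &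
    (forall x h, nball a p.1 x -> modulus (dlift u x h) <= p.2 * norm1 h)].
have ex u : smooth_on (local_dom W c) u -> exists p, P u p.
  move=> su; have [s [K h]] := lift_quadratic r0 su (fun x ax => loc_dom hr ax).
  by exists (s, K).
have exre (ij : 'I_n * 'I_n) := ex _ (gre_smooth g hc ij.1 ij.2).
have exim (ij : 'I_n * 'I_n) := ex _ (gim_smooth g hc ij.1 ij.2).
pose sr ij := (projT1 (cid (exre ij))).1; pose si ij := (projT1 (cid (exim ij))).1.
pose Kr ij := (projT1 (cid (exre ij))).2; pose Ki ij := (projT1 (cid (exim ij))).2.
have Pr ij : P (gre g c ij.1 ij.2) (sr ij, Kr ij).
  by rewrite /sr /Kr; case: (cid (exre ij)) => -[].
have Pi ij : P (gim g c ij.1 ij.2) (si ij, Ki ij).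
  by rewrite /si /Ki; case: (cid (exim ij)) => -[].
pose s := Num.min r (Num.min (\big[Num.min/r]_ij sr ij) (\big[Num.min/r]_ij si ij)).
have s0 : 0 < s.
  rewrite !lt_min r0 /=; apply/andP; split; apply: (big_ind (fun z : R => 0 < z)) => //.
  - by move=> x y x0 y0; rewrite lt_min x0.
  - by move=> ij _; case: (Pr ij) => /andP[].
  - by move=> x y x0 y0; rewrite lt_min x0.
  - by move=> ij _; case: (Pi ij) => /andP[].
have ssr ij : s <= sr ij by rewrite !ge_min; apply/orP; right; apply/orP; left; exact: bigmin_le_cond.
have ssi ij : s <= si ij by rewrite !ge_min; apply/orP; right; apply/orP; right; exact: bigmin_le_cond.
pose K := \sum_i \sum_j (Kr (i, j) + Ki (i, j)).
have split_i (x y : C) : modulus (x + 'i * y) <= modulus x + modulus y.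
  by apply: (le_trans (modulusD _ _)); rewrite modulusM modulus_i mul1r.
exists s, K; split; first by rewrite s0 ge_min lexx.
- by apply: sumr_ge0 => i _; apply: sumr_ge0 => j _; rewrite addr_ge0 //; [case: (Pr (i, j))|case: (Pi (i, j))].
- move=> x h ax axh; rewrite /K mulr_suml; apply: ler_sum => i _; rewrite mulr_suml; apply: ler_sum => j _.
  have [_ _ h1 _] := Pr (i, j); have [_ _ h2 _] := Pi (i, j).
  have {}h1 := h1 x h (nball_le (ssr _) ax) (nball_le (ssr _) axh).
  have {}h2 := h2 x h (nball_le (ssi _) ax) (nball_le (ssi _) axh).
  rewrite mulrDl; apply: le_trans (lerD h1 h2); apply: le_trans (split_i _ _).
  rewrite le_eqVlt; apply/orP; left; apply/eqP; congr modulus.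
  have eB (A B : 'M[C]_n) : (A - B) i j = A i j - B i j by rewrite !mxE.
  by rewrite !eB !loc_metric_lift [dH x h i j]mxE /=; ring.
move=> x h ax; rewrite /K mulr_suml; apply: ler_sum => i _; rewrite mulr_suml; apply: ler_sum => j _.
have [_ _ _ h1] := Pr (i, j); have [_ _ _ h2] := Pi (i, j).
have {}h1 := h1 x h (nball_le (ssr _) ax).
have {}h2 := h2 x h (nball_le (ssi _) ax).
by rewrite mulrDl; apply: le_trans (lerD h1 h2); rewrite mxE; exact: split_i.
Qed.

Hypothesis H1 : H a = 1%:M.

(** On [C^n] the standard form lies between [norm1 v ^ 2 / (n + 1)] and
   [norm1 v ^ 2]; half of the lower bound is left for the variation of [H]. *)
Lemma metric_bounds : exists s : R, [/\ 0 < s <= r,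
  (forall x v, nball a s x -> (2 * (n%:R + 1))^-1 * norm1 v ^+ 2 <= complex.Re (hform (H x) v v)) &
  (forall x v, nball a s x -> complex.Re (hform (H x) v v) <= 2 * norm1 v ^+ 2)].
Proof.
have aa : nball a r a by rewrite /nball /= subrr norm10.
have n1 : (0 : R) < n%:R + 1 by rewrite ltr_wpDl.
have p0 : (0 : R) < 2 * (n%:R + 1) by rewrite mulr_gt0.
have e0 : (0 : R) < (2 * (n%:R + 1))^-1 by rewrite invr_gt0.
have [d d0 hd] := mnorm1_cont (fun i j => rdiff_ccont (loc_metric_rdiff g hc hr i j aa)) e0.
exists (Num.min d r); split; first by rewrite lt_min d0 r0 ge_min lexx orbT.
  move=> x v ax; have /hd : norm1 (x - a) < d by apply: lt_le_trans ax _; rewrite ge_min lexx.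
  rewrite H1 => hx.
  have -> : hform (H x) v v = hform 1%:M v v + hform (H x - 1%:M) v v by rewrite -hformDM addrC subrK.
  rewrite reD hform1; set S := \sum_j _.
  have b1 : norm1 v ^+ 2 / (n%:R + 1) <= S.
    rewrite ler_pdivrMr //; apply: (le_trans (sqr_norm1_le v)); rewrite mulrC ler_wpM2l ?lerDl //.
    by apply: sumr_ge0 => j _; exact: sqr_ge0.
  have b2 : `|complex.Re (hform (H x - 1%:M) v v)| <= (2 * (n%:R + 1))^-1 * norm1 v ^+ 2.
    apply: (le_trans (re_le_modulus _)); apply: (le_trans (hform_bound _ _ _)).
    by rewrite -expr2 ler_wpM2r ?sqr_ge0.
  have b3 : norm1 v ^+ 2 / (n%:R + 1) = 2 * ((2 * (n%:R + 1))^-1 * norm1 v ^+ 2).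
    by field; rewrite gt_eqF.
  by move: b2; rewrite ler_norml => /andP[b2 _]; rewrite b3 in b1; lra.
move=> x v ax; have /hd : norm1 (x - a) < d by apply: lt_le_trans ax _; rewrite ge_min lexx.
rewrite H1 => hx.
have -> : hform (H x) v v = hform 1%:M v v + hform (H x - 1%:M) v v by rewrite -hformDM addrC subrK.
rewrite reD hform1 mulr_natl mulr2n; apply: lerD; first exact: sum_sqr_le.
apply: le_trans (ler_norm _) _; apply: (le_trans (re_le_modulus _)).
apply: (le_trans (hform_bound _ _ _)); rewrite -expr2 ler_piMl ?sqr_ge0 //.
apply: (le_trans hx); rewrite invf_le1 //.
by have := ler0n R n; lra.
Qed.

Lemma ccont_re k (G : 'rV[C]_k -> C) x : ccont G x -> ccont (fun y => rc (complex.Re (G y))) x.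
Proof.
apply: (@ccont_post _ _ _ _ (fun z => rc (complex.Re z))) => u v.
by rewrite -rcB -reB modulus_rc re_le_modulus.
Qed.

Lemma ccont_hform (Hf : 'rV[C]_n -> 'M[C]_n) (u : 'rV[C]_n -> 'rV[C]_n) w x :
  (forall i j, ccont (fun y => Hf y i j) x) -> vcont u x -> ccont (fun y => hform (Hf y) (u y) w) x.
Proof.
move=> cH cu; apply: ccont_sum => i; apply: ccont_sum => j; apply: ccontM; first exact: cH.
by apply: ccontM; [exact: cu | exact: ccont_cst].
Qed.

Lemma dlift_ccont (u : 'rV[R]_(n + n) -> R) D (v x : 'rV[C]_n) : smooth_on D u -> D (to_real x) -> ccont (fun y => dlift u y v) x.
Proof.
move=> su Dx; apply: ccont_sum => b; apply: ccontZ; apply: ccont_lift.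
exact: (su [:: b] _ Dx).1.
Qed.

(** The differential of [Z] is continuous because it is determined by the
   metric, its first derivatives and the Hessian of the potential. *)
Lemma field_chol : exists s : R, 0 < s <= r /\ chol (nball a s) F (fun x => jacobian F x).
Proof.
have [s [sr qm _]] := metric_bounds; exists s; split=> //.
case/andP: (sr) => s0 sr' x axs; have ax : nball a r x by exact: nball_le axs.
split=> [|i j]; first exact: (loc_field_cdiff Z hc hr ax).
pose v : 'rV[C]_n := delta_mx 0 i; pose J y := jacobian F y.
pose beta (y w : 'rV[C]_n) : C := rc (loc_d2pot f c y v w) - rc (complex.Re (hform (dH y v) (F y) w)).
have betaE y w : nball a r y -> beta y w = rc (complex.Re (hform (H y) (v *m J y) w)).
  move=> ay; rewrite /beta -(loc_gradient_deriv hc soliton assoc hr v w ay).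
  by rewrite reD rcD addrC addKr.
have cbeta w : ccont (beta^~ w) x.
  have Dx := loc_dom hr ax; have sp := pot_smooth hc soliton.
  apply: ccontD.
    apply: ccont_re; apply: ccont_sum => b; apply: ccontZ.
    exact: (dlift_ccont _ (smooth_on_pderiv b sp) Dx).
  apply: (@ccont_post _ _ _ _ (fun z => - z)) => [u t|]; first by rewrite -opprD modulusN.
  apply: ccont_re; apply: ccont_hform => [k l|]; last first.
    exact: vdiff_vcont (loc_field_cdiff Z hc hr ax).
  rewrite (_ : (fun y => _) = (fun y => dlift (gre g c k l) y v + 'i * dlift (gim g c k l) y v)); last first.
    by apply/funext => y; rewrite mxE.
  apply: ccontD; first exact: (dlift_ccont _ (gre_smooth g hc k l) Dx).
  by apply: ccontZ; exact: (dlift_ccont _ (gim_smooth g hc k l) Dx).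
pose e k : 'rV[C]_n := delta_mx 0 k.
pose gam (y : 'rV[C]_n) : 'rV[C]_n := \row_k (beta y (e k) + 'i * beta y ('i *: e k)).
have hrow (A : 'M[C]_n) u k : hform A u (e k) = (u *m A) 0 k.
  rewrite /hform mxE; apply: eq_bigr => l _; rewrite (bigD1 k) //= big1 => [|m mk].
    by rewrite addr0 mxE !eqxx rmorph1 mulr1 mulrC.
  by rewrite mxE (negbTE mk) andbF rmorph0 !mulr0.
have gamE y : nball a r y -> gam y = v *m J y *m H y.
  move=> ay; apply/rowP => k; rewrite mxE !betaE // hformZr conj_i mulNr reN re_i opprK -hrow.
  apply: complex_ext; first by rewrite reD re_i im_rc oppr0 addr0.
  by rewrite imD im_i im_rc add0r.
pose err y : 'rV[C]_n := gam y - v *m J x *m H y.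
have cerr : vcont err x.
  move=> k; rewrite (_ : (fun y => _) = (fun y => gam y 0 k + \sum_l (- (v *m J x) 0 l) * H y l k)).
    apply: ccontD.
      rewrite (_ : (fun y => _) = (fun y => beta y (e k) + 'i * beta y ('i *: e k))); last first.
        by apply/funext => y; rewrite mxE.
      by apply: ccontD; [exact: cbeta | apply: ccontZ; exact: cbeta].
    apply: ccont_sum => l; apply: ccontZ; exact: rdiff_ccont (loc_metric_rdiff g hc hr l k ax).
  have eB (A B : 'rV[C]_n) : (A - B) 0 k = A 0 k - B 0 k by rewrite !mxE.
  apply/funext => y; rewrite /err eB; congr (_ + _).
  by rewrite [(_ *m H y) 0 k]mxE -sumrN; apply: eq_bigr => l _; rewrite mulNr.
have errx : err x = 0 by rewrite /err gamE // subrr.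
move=> ep ep0; have n1 : (0 : R) < 2 * (n%:R + 1) by rewrite mulr_gt0 // ltr_wpDl.
have [d d0 hd] := vcontP cerr (e := ep / (2 * (n%:R + 1))) ltac:(by rewrite divr_gt0).
exists (Num.min d (s - norm1 (x - a))) => [|y]; first by rewrite lt_min d0 subr_gt0.
rewrite lt_min => /andP[/hd]; rewrite errx subr0 => hy ys.
have ays : nball a s y by rewrite /nball /=; have := norm1_triangle y x a; lra.
have ay := nball_le sr' ays.
pose dl := v *m J y - v *m J x.
have eE : err y = dl *m H y by rewrite /err gamE // mulmxBl.
have key : norm1 dl <= (2 * (n%:R + 1)) * norm1 (err y).
  have [->|dl0] := eqVneq dl 0; first by rewrite norm10 mulr_ge0 ?norm1_ge0 // ltW.
  have nd : 0 < norm1 dl by rewrite norm1_gt0.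
  rewrite -ler_pdivrMl // -(ler_pM2r nd) -mulrA -expr2; apply: (le_trans (qm y dl ays)).
  apply: le_trans (ler_norm _) _; apply: (le_trans (re_le_modulus _)).
  rewrite (_ : hform (H y) dl dl = \sum_k err y 0 k * Num.conj (dl 0 k)); last first.
    rewrite /hform exchange_big; apply: eq_bigr => k _; rewrite eE [(dl *m _) 0 k]mxE mulr_suml.
    by apply: eq_bigr => l _; ring.
  apply: (le_trans (modulus_sum _ _ _)); rewrite [norm1 (err y)]/norm1 mulr_suml; apply: ler_sum => k _.
  by rewrite modulusM modulus_conj ler_wpM2l ?modulus_ge0 // norm1_coord.
apply: le_lt_trans (_ : norm1 dl < ep).
  have := norm1_coord dl j; congr (_ <= _).
  have eB (A B : 'rV[C]_n) : (A - B) 0 j = A 0 j - B 0 j by rewrite !mxE.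
  have rE (A : 'M[C]_n) : (v *m A) 0 j = A i j by rewrite /v -rowE mxE.
  rewrite eB; congr (modulus (_ - _)).
    exact: (rE (J y)).
  exact: (rE (J x)).
apply: (le_lt_trans key); rewrite mulrC -ltr_pdivlMr //.
Qed.

(** The metric transported by an Euler step differs from the metric at [x] by
   terms of order [t], which cancel by [loc_killing], and of order [t^2]. *)
Lemma euler_step_distortion : exists s K : R, [/\ 0 < s <= r, 0 <= K &
  forall x v (t : R), nball a s x -> 0 <= t <= 1 -> nball a s (x + (rc t * 'i) *: F x) ->
   complex.Re (hform (H (x + (rc t * 'i) *: F x)) (v + (rc t * 'i) *: (v *m jacobian F x)) (v + (rc t * 'i) *: (v *m jacobian F x)))
    <= (1 + K * t ^+ 2) * complex.Re (hform (H x) v v)].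
Proof.
have [s1 [/andP[s10 s1r] FD]] := field_chol.
have [s2 [/andP[s20 s2r] qm qM]] := metric_bounds.
have [s3 [K [/andP[s30 s3r] K0 quad dHb]]] := metric_quadratic.
have aa1 : nball a s1 a by rewrite /nball /= subrr norm10.
have [d1 d10 hd1] := mnorm1_cont (FD a aa1).2 (@ltr01 R).
have [d2 d20 hd2] := vcontP (vdiff_vcont (FD a aa1).1) (@ltr01 R).
pose B := (norm1 (F a) + 1) + (mnorm1 (jacobian F a) + 1).
have B1 : 1 <= norm1 (F a) + 1 by rewrite lerDr norm1_ge0.
have B2 : 1 <= mnorm1 (jacobian F a) + 1 by rewrite lerDr mnorm1_ge0.
have B0 : 0 <= B by rewrite addr_ge0 // (le_trans ler01).
pose s := Num.min (Num.min d1 d2) (Num.min s1 (Num.min s2 s3)).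
have s0 : 0 < s by rewrite !lt_min d10 d20 s10 s20.
have sd1 : s <= d1 by rewrite !ge_min lexx.
have sd2 : s <= d2 by rewrite !ge_min lexx orbT.
have ss1 : s <= s1 by rewrite !ge_min lexx !orbT.
have ss2 : s <= s2 by rewrite !ge_min lexx !orbT.
have ss3 : s <= s3 by rewrite !ge_min lexx !orbT.
have sr : s <= r by exact: le_trans ss1 s1r.
have FB x : nball a s x -> norm1 (F x) <= B.
  move=> ax; have /hd2 h := nball_le sd2 ax.
  have := norm1_triangle (F x) (F a) 0; rewrite !subr0 => h'.
  by rewrite /B; move: h h' B2; lra.
have JB x v : nball a s x -> norm1 (v *m jacobian F x) <= B * norm1 v.
  move=> ax; have /hd1 h := nball_le sd1 ax.
  rewrite -[jacobian F x](subrK (jacobian F a)) mulmxDr; apply: (le_trans (norm1D _ _)).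
  have h1 := norm1_mulmx v (jacobian F x - jacobian F a).
  have h2 := norm1_mulmx v (jacobian F a).
  have h3 : norm1 v * mnorm1 (jacobian F x - jacobian F a) <= norm1 v * 1 by rewrite ler_wpM2l ?norm1_ge0.
  have h4 : 0 <= norm1 (F a) * norm1 v by rewrite mulr_ge0 ?norm1_ge0.
  have h5 := norm1_ge0 v.
  rewrite /B; move: h1 h2 h3 h4 h5; lra.
pose Cst := K * B ^+ 2 * (1 + B) ^+ 2 + K * B ^+ 2 * (2 + B) + 2 * B ^+ 2.
have C0 : 0 <= Cst.
  have b1 : 0 <= 2 + B by rewrite addr_ge0.
  have q0 : 0 <= B ^+ 2 := sqr_ge0 B; have q1 : 0 <= (1 + B) ^+ 2 := sqr_ge0 _.
  have p1 := mulr_ge0 (mulr_ge0 K0 q0) q1; have p2 := mulr_ge0 (mulr_ge0 K0 q0) b1.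
  exact: addr_ge0 (addr_ge0 p1 p2) (mulr_ge0 (ler0n R 2) q0).
have n1 : (0 : R) < 2 * (n%:R + 1) by rewrite mulr_gt0 // ltr_wpDl.
exists s, (Cst * (2 * (n%:R + 1))); split; first by rewrite s0.
  by rewrite mulr_ge0 // ltW.
move=> x v t ax /andP[t0 t1].
rewrite -!scalerA => axt.
have ax_r : nball a r x := nball_le sr ax.
have herm := loc_metric_herm g hc hr ax_r.
set eta := 'i *: F x in axt *; set xi := 'i *: (v *m jacobian F x).
set v' := v + rc t *: xi; set N := norm1 v.
have kill : complex.Re (hform (dH x eta) v v) + 2 * complex.Re (hform (H x) xi v) = 0.
  exact: (loc_killing hc soliton assoc hr v ax_r).
have Ne : norm1 eta <= B by rewrite norm1Z modulus_i mul1r; exact: FB.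
have Nxi : norm1 xi <= B * N by rewrite norm1Z modulus_i mul1r; exact: JB.
have N0 : 0 <= N by exact: norm1_ge0.
have Nv' : norm1 v' <= (1 + B) * N.
  apply: (le_trans (norm1D _ _)); rewrite mulrDl mul1r lerD2l norm1Z modulus_rc ger0_norm //.
  by apply: le_trans Nxi; rewrite ler_piMl ?norm1_ge0.
have dHl : dH x (rc t *: eta) = rc t *: dH x eta.
  apply/matrixP => i j; have [lL _] := loc_metric_rdiff g hc hr i j ax_r.
  by rewrite (rlinearZ _ _ lL) [RHS]mxE.
have [E EE] : {E | E = H (x + rc t *: eta) - H x - dH x (rc t *: eta)} by exists (H (x + rc t *: eta) - H x - dH x (rc t *: eta)).
have X1 : modulus (hform E v' v') <= K * B ^+ 2 * (1 + B) ^+ 2 * (t ^+ 2 * N ^+ 2).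
  apply: (le_trans (hform_bound _ _ _)).
  have e1 : mnorm1 E <= K * (t ^+ 2 * B ^+ 2).
    rewrite EE; apply: (le_trans (quad _ _ (nball_le ss3 ax) (nball_le ss3 axt))); rewrite ler_wpM2l //.
    rewrite norm1Z modulus_rc ger0_norm // exprMn ler_wpM2l ?sqr_ge0 //.
    by rewrite lerXn2r ?nnegrE ?norm1_ge0.
  apply: (@le_trans _ _ (K * (t ^+ 2 * B ^+ 2) * ((1 + B) * N * ((1 + B) * N)))).
    apply: ler_pM => //; rewrite ?mnorm1_ge0 ?mulr_ge0 ?norm1_ge0 //.
    by apply: ler_pM; rewrite ?norm1_ge0.
  by rewrite le_eqVlt; apply/orP; left; apply/eqP; ring.
have dHe : mnorm1 (dH x eta) <= K * B.
  by apply: (le_trans (dHb _ _ (nball_le ss3 ax))); rewrite ler_wpM2l.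
have Nt : norm1 (rc t *: xi) <= t * (B * N).
  by rewrite norm1Z modulus_rc ger0_norm // ler_wpM2l.
have X2 : modulus (hform (dH x eta) v (rc t *: xi) + hform (dH x eta) (rc t *: xi) v')
    <= K * B ^+ 2 * (2 + B) * (t * N ^+ 2).
  apply: (le_trans (modulusD _ _)).
  apply: (@le_trans _ _ (K * B * (N * (t * (B * N))) + K * B * (t * (B * N) * ((1 + B) * N)))).
    have KB : 0 <= K * B by rewrite mulr_ge0.
    apply: lerD; apply: (le_trans (hform_bound _ _ _)).
      by apply: ler_pM; rewrite ?mnorm1_ge0 ?mulr_ge0 ?norm1_ge0 ?ler_pM ?norm1_ge0.
    by apply: ler_pM; rewrite ?mnorm1_ge0 ?mulr_ge0 ?norm1_ge0 ?ler_pM ?norm1_ge0.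
  by rewrite le_eqVlt; apply/orP; left; apply/eqP; ring.
have X3 : complex.Re (hform (H x) xi xi) <= 2 * B ^+ 2 * N ^+ 2.
  apply: (le_trans (qM _ _ (nball_le ss2 ax))); rewrite -mulrA ler_wpM2l // -exprMn.
  by rewrite lerXn2r ?nnegrE ?norm1_ge0 ?mulr_ge0.
have T : complex.Re (hform (H (x + rc t *: eta)) v' v') = complex.Re (hform (H x) v v)
   + complex.Re (hform E v' v') + t * complex.Re (hform (dH x eta) v (rc t *: xi) + hform (dH x eta) (rc t *: xi) v')
   + t ^+ 2 * complex.Re (hform (H x) xi xi).
  have -> : H (x + rc t *: eta) = E + H x + rc t *: dH x eta.
    by rewrite -dHl EE; apply/matrixP => i j; rewrite !mxE; ring.
  rewrite !hformDM hformZM !reD reZ.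
  have -> : complex.Re (hform (H x) v' v') = complex.Re (hform (H x) v v)
      + t * (2 * complex.Re (hform (H x) xi v)) + t ^+ 2 * complex.Re (hform (H x) xi xi).
    exact: hform_quadratic.
  have -> : hform (dH x eta) v' v' = hform (dH x eta) v v +
      (hform (dH x eta) v (rc t *: xi) + hform (dH x eta) (rc t *: xi) v').
    by rewrite /v' !(hformDl, hformDr); ring.
  rewrite !reD; exact: (step_identity _ _ _ _ _ kill).
have qv := qm x v (nball_le ss2 ax).
have r1 := le_trans (ler_norm _) (le_trans (re_le_modulus _) X1).
have r2 := le_trans (ler_norm _) (le_trans (re_le_modulus _) X2).
rewrite T; apply: (@le_trans _ _ (complex.Re (hform (H x) v v) + Cst * (t ^+ 2 * N ^+ 2))).
  rewrite -!addrA lerD2l /Cst mulrDl mulrDl -!addrA lerD // lerD //.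
    apply: (@le_trans _ _ (t * (K * B ^+ 2 * (2 + B) * (t * N ^+ 2)))); first by rewrite ler_wpM2l.
    by rewrite le_eqVlt; apply/orP; left; apply/eqP; ring.
  apply: (@le_trans _ _ (t ^+ 2 * (2 * B ^+ 2 * N ^+ 2))); first by rewrite ler_wpM2l ?sqr_ge0.
  by rewrite le_eqVlt; apply/orP; left; apply/eqP; ring.
rewrite [leRHS]mulrDl mul1r lerD2l.
have q2 : N ^+ 2 <= 2 * (n%:R + 1) * complex.Re (hform (H x) v v) by rewrite -ler_pdivrMl.
have q3 := ler_wpM2l C0 (ler_wpM2l (sqr_ge0 t) q2).
apply: (le_trans q3); rewrite le_eqVlt; apply/orP; left; apply/eqP.
by move: (Cst) (complex.Re _) => u w; ring.
Qed.

End MetricEstimates.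

(** * Charts that linearize the field *)

Section Diagonalization.
Context {R : realType} {n : nat}.
Local Notation C := (Cx R).
Implicit Types (H A : 'M[C]_n).

Definition adj m k (A : 'M[C]_(m, k)) : 'M[C]_(k, m) := (map_mx Num.conj A)^T.

Lemma adjM m k l (A : 'M[C]_(m, k)) (B : 'M[C]_(k, l)) : adj (A *m B) = adj B *m adj A.
Proof. by rewrite /adj map_mxM trmx_mul. Qed.

Lemma adjK m k (A : 'M[C]_(m, k)) : adj (adj A) = A.
Proof. by apply/matrixP => i j; rewrite !mxE conjCK. Qed.

Lemma adj_delta (j k : 'I_n) : adj (delta_mx 0 j : 'rV[C]_n) k 0 = (k == j)%:R.
Proof. by rewrite !mxE eqxx /=; case: (k == j); rewrite ?conjC1 ?conjC0. Qed.

Lemma adj_cdiag (d : 'I_n -> R) : adj (cdiag (fun j => rc (d j) : C)) = cdiag (fun j => rc (d j)).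
Proof.
apply/matrixP => i j; rewrite !mxE eq_sym; have [->|_] := eqVneq i j; last by rewrite !mulr0n rmorph0.
by rewrite !mulr1n; apply: complex_ext; rewrite ?re_conj ?im_conj ?im_rc ?oppr0.
Qed.

Lemma hform_mulmx H u v : hform H u v = (u *m H *m adj v) 0 0.
Proof.
rewrite /hform exchange_big mxE; apply: eq_bigr => j _; rewrite mxE mulr_suml.
by apply: eq_bigr => i _; rewrite !mxE; ring.
Qed.

Lemma hermitian_diagonal H : adj H = H -> exists (P : 'M[C]_n) (d : 'I_n -> R),
  P *m adj P = 1%:M /\ H = adj P *m cdiag (fun j => rc (d j)) *m P.
Proof.
move=> herm; have hH : H \is hermsymmx.
  by apply/is_hermitianmxP; rewrite expr0 scale1r -map_trmx -[LHS]herm.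
have P := spectral_unitarymx H; have /unitarymxP PP := P.
exists (spectralmx H), (fun j => complex.Re (spectral_diag H 0 j)); split.
  by rewrite /adj map_trmx.
have /orthomx_spectralP := hermitian_normalmx hH.
rewrite (invmx_unitary P) -map_trmx => {1}->; congr (_ *m diag_mx _ *m _).
apply/rowP => j; rewrite mxE.
have /mxOverP/(_ 0 j)/CrealP hj := hermitian_spectral_diag_real hH.
apply: complex_ext; rewrite ?re_rc ?im_rc //.
by have := congr1 (fun z : C => complex.Im z) hj; rewrite im_conj; lra.
Qed.

(** Take a square root [T] of [H] and diagonalize [T^-1 A T], which is Hermitian.
   The rows of [Q^-1] are an orthonormal basis of eigenvectors of [A]. *)
Lemma orthonormal_eigenbasis H A : adj H = H ->
  (forall v, v != 0 -> 0 < complex.Re (hform H v v)) ->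
  (forall u v, hform H (u *m A) v = hform H u (v *m A)) ->
  exists (Q : 'M[C]_n) (h : 'I_n -> R),
    [/\ Q \in unitmx, H = Q *m adj Q & A *m Q = Q *m cdiag (fun j => rc (h j))].
Proof.
move=> herm pos self.
have [P [d [PP HE]]] := hermitian_diagonal herm.
have PP' : adj P *m P = 1%:M by exact: mulmx1C.
have dpos j : 0 < d j.
  have r0 : delta_mx 0 j *m P != 0 :> 'rV[C]_n.
    apply: contraTneq isT => r0; have := congr1 (fun w => w *m adj P) r0.
    rewrite mul0mx -mulmxA PP mulmx1 => /rowP/(_ j); rewrite !mxE !eqxx => /eqP.
    by rewrite oner_eq0.
  have := pos _ r0; rewrite hform_mulmx HE adjM !mulmxA.
  rewrite -[_ *m P *m adj P]mulmxA PP mulmx1 -[_ *m P *m adj P]mulmxA PP mulmx1.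
  rewrite mxE (bigD1 j) //= big1 => [|k kj].
    by rewrite mulmx_cdiag adj_delta mxE !eqxx mulr1 mul1r addr0 re_rc.
  by rewrite adj_delta (negbTE kj) mulr0.
pose S : 'M[C]_n := cdiag (fun j => rc (Num.sqrt (d j))).
pose S' : 'M[C]_n := cdiag (fun j => rc (Num.sqrt (d j))^-1).
have SS' : S *m S' = 1%:M.
  rewrite cdiagM; apply/matrixP => i j; rewrite !mxE; have [->|_] := eqVneq i j; rewrite ?mulr0n //.
  by rewrite !mulr1n -rcM mulfV ?rc1 // gt_eqF // sqrtr_gt0.
have [T [T' [TT' HT]]] : exists T T' : 'M[C]_n, T *m T' = 1%:M /\ H = T *m adj T.
  exists (adj P *m S), (S' *m P); split.
    by rewrite mulmxA -[_ *m S *m S']mulmxA SS' mulmx1.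
  rewrite adjM adjK adj_cdiag HE !mulmxA -[_ *m S *m cdiag _]mulmxA cdiagM.
  congr (_ *m cdiag _ *m _); apply/funext => j.
  by rewrite -rcM -expr2 sqr_sqrtr // ltW.
have T'T : T' *m T = 1%:M by exact: mulmx1C.
have AH : A *m H = H *m adj A.
  apply/matrixP => i j; have := self (delta_mx 0 i) (delta_mx 0 j).
  rewrite !hform_mulmx adjM -!mulmxA.
  have E (B : 'M[C]_n) : ((delta_mx 0 i : 'rV_n) *m (B *m adj (delta_mx 0 j : 'rV_n))) 0 0 = B i j.
    rewrite mulmxA -rowE mxE (bigD1 j) //= big1 => [|k kj].
      by rewrite adj_delta eqxx mulr1 addr0 mxE.
    by rewrite adj_delta (negbTE kj) mulr0.
  have E2 := E (H *m adj A); rewrite -!mulmxA in E2.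
  by have E1 := E (A *m H); rewrite -!mulmxA in E1; rewrite E1 => ->.
pose A1 := T' *m A *m T.
have herm1 : adj A1 = A1.
  have := congr1 (fun B => T' *m B *m adj T') AH; rewrite HT !mulmxA T'T mul1mx.
  rewrite -[_ *m adj T *m adj T']mulmxA -adjM T'T.
  have -> : adj (1%:M : 'M[C]_n) = 1%:M by rewrite /adj map_mx1 trmx1.
  by rewrite mulmx1 /A1 !adjM mulmxA => ->.
have [U [h [UU A1E]]] := hermitian_diagonal herm1.
have UU' : adj U *m U = 1%:M by exact: mulmx1C.
exists (T *m adj U), h; split.
- have : (T *m adj U) *m (U *m T') = 1%:M.
    by rewrite mulmxA -[_ *m adj U *m U]mulmxA UU' mulmx1.
  by case/mulmx1_unit.
- by rewrite adjM adjK mulmxA -[_ *m adj U *m U]mulmxA UU' mulmx1.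
have -> : A *m (T *m adj U) = T *m A1 *m adj U.
  by rewrite /A1 !mulmxA TT' mul1mx.
by rewrite A1E !mulmxA -[_ *m U *m adj U]mulmxA UU mulmx1.
Qed.

End Diagonalization.

Section OrthonormalChart.
Context {R : realType} {n : nat}.
Local Notation C := (Cx R).

Lemma chart_ball (M : complex_manifold R n) (c : chart R n M) p (W : set M) :
  cdom c p -> open W -> W p -> exists2 r : R, 0 < r & forall x, nball (cmap c p) r x ->
    [/\ cdom c (cinv c x), W (cinv c x) & cmap c (cinv c x) = x].
Proof.
move=> cp oW Wp; have /nbhs_norm1P[r r0 hr] := cmap_image_nbhs cp oW Wp.
by exists r => // x /hr[h1 [h2 h3]].
Qed.

Lemma field_transition (M : complex_manifold R n) (Z : hol_vector_field M)
    (c d : chart R n M) (x : M) : hol_chart c -> hol_chart d -> cdom c x -> cdom d x ->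
  loc_field Z d (cmap d x) = loc_field Z c (cmap c x) *m transition_jacobian c d x.
Proof.
by move=> hc hd cx dx; rewrite /loc_field !cmapK //; exact: vcomp_change.
Qed.

(** By [loc_singular_skew] the differential of [Z] at [p] is self-adjoint, so an
   orthonormal basis of eigenvectors gives the coordinates. *)
Lemma orthonormal_chart (M : complex_manifold R n) (Z : hol_vector_field M) (W : set M)
    (g : kahler_metric W) (f : M -> R) p :
  gradient_soliton g f -> associated_vector_field g f Z -> open W -> W p -> singular_point Z p ->
  exists (d : chart R n M) (h : 'I_n -> R), [/\ hol_chart d, cdom d p, cmap d p = 0,
    loc_metric g d 0 = 1%:M & jacobian (loc_field Z d) 0 = cdiag (fun j => rc (h j))].
Proof.
move=> soliton assoc oW Wp sing.
have [c ac cp] := atlas_cover p.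
have hc : hol_chart c by move=> d ad; exact: atlas_compatible.
have [r r0 hr] := chart_ball cp oW Wp; set a := cmap c p in hr.
have aa : nball a r a by rewrite /nball /= subrr norm10.
have Fa : loc_field Z c a = 0 by rewrite /loc_field cmapK //; exact: sing.
have herm := loc_metric_herm g hc hr aa.
have self := hform_skew_selfadjoint herm (fun v => loc_singular_skew hc soliton assoc hr v aa Fa).
have [Q [h [uQ HQ AQ]]] := orthonormal_eigenbasis herm (fun v => loc_metric_pos g hc hr aa) self.
pose psi (x : 'rV[C]_n) := (x - a) *m Q.
have psiD : chol (nball a r) psi (fun=> Q).
  move=> x _; split=> [|i j]; last exact: ccont_cst.
  by have := cdiff_mulr Q (cdiffD (cdiff_id x) (cdiff_cst x (- a))); rewrite addr0 mul1mx.
have [d [hd dp dE]] := change_chart hc cp oW Wp r0 psiD uQ.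
have d0 : cmap d p = 0 by have [_ _ _ -> _] := dE p dp; rewrite /psi subrr mul0mx.
exists d, h; split=> //.
  have [_ _ _ _ tJ] := dE p dp.
  have := gcomp_change g hc hd Wp cp dp; rewrite tJ.
  rewrite -[gcomp g c p]/(gcomp g c p) -{1}(cmapK cp) -/a -/(loc_metric g c a) HQ.
  rewrite /loc_metric -d0 cmapK // -/(adj Q) => e.
  have uQ' : adj Q \in unitmx by rewrite unitmx_tr map_unitmx.
  have := congr1 (fun B => invmx Q *m B *m invmx (adj Q)) e.
  by rewrite !mulmxA !mulVmx // !mul1mx mulmxV // mulmxK // => <-.
have [r' r'0 hr'] := chart_ball dp oW Wp; rewrite d0 in hr'.
have ball0 : nball 0 r' (0 : 'rV[C]_n) by rewrite /nball /= subrr norm10.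
have dF := loc_field_cdiff Z hd hr' ball0.
apply: cdiff_unique dF _.
pose th (y : 'rV[C]_n) := y *m invmx Q + a.
have dth : cdiff th 0 (invmx Q).
  have := cdiffD (cdiff_mulr (invmx Q) (cdiff_id (0 : 'rV[C]_n))) (cdiff_cst 0 a).
  by rewrite mul1mx addr0.
have th0 : th 0 = a by rewrite /th mul0mx add0r.
have dG : cdiff (fun y => loc_field Z c (th y) *m Q) 0 (cdiag (fun j => rc (h j))).
  have -> : cdiag (fun j => rc (h j)) = invmx Q *m jacobian (loc_field Z c) a *m Q.
    by rewrite -mulmxA AQ mulmxA mulVmx // mul1mx.
  apply: cdiff_mulr; apply: cdiff_comp dth _; rewrite th0.
  exact: (loc_field_cdiff Z hc hr aa).
move=> j; apply: rdiff_near (dG j); exists r' => // y hy.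
have [dy Wy yE] := hr' y hy.
have [cy _ _ zE tJ] := dE _ dy.
have {zE} thy : th y = cmap c (cinv d y).
  by rewrite /th -[y in LHS]yE zE /psi mulmxK // subrK.
by rewrite -[in RHS]yE (field_transition Z hc hd cy dy) tJ thy.
Qed.

End OrthonormalChart.

Section LinearizingChart.
Context {R : realType} {n : nat}.
Local Notation C := (Cx R).

(** In an orthonormal chart [iZ] almost preserves the metric in the sense required
   by [euler_linearization]. *)
Lemma linearizing_chart (M : complex_manifold R n) (Z : hol_vector_field M) (W : set M)
    (g : kahler_metric W) (f : M -> R) p :
  gradient_soliton g f -> associated_vector_field g f Z -> open W -> W p -> singular_point Z p ->
  exists (d : chart R n M) (h : 'I_n -> R), [/\ hol_chart d, cdom d p, cmap d p = 0 &
    forall x, cdom d x -> W x /\ vcomp Z d x = cmap d x *m cdiag (fun j => rc (h j))].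
Proof.
move=> soliton assoc oW Wp sing.
have [c [h [hc cp c0 H1 A1]]] := orthonormal_chart soliton assoc oW Wp sing.
have [r r0 hr] := chart_ball cp oW Wp; rewrite c0 in hr.
have [s1 [/andP[s10 s1r] FD]] := field_chol hc soliton assoc r0 hr H1.
have [s2 [/andP[s20 s2r] qm qM]] := metric_bounds hc r0 hr H1.
have [s3 [K [/andP[s30 s3r] K0 euler]]] := euler_step_distortion hc soliton assoc r0 hr H1.
pose s := Num.min s1 (Num.min s2 s3).
have s0 : 0 < s by rewrite !lt_min s10 s20 s30.
have ss1 : s <= s1 by rewrite ge_min lexx.
have ss2 : s <= s2 by rewrite !ge_min lexx orbT.
have ss3 : s <= s3 by rewrite !ge_min lexx !orbT.
have F0 : loc_field Z c 0 = 0 by rewrite /loc_field -[X in cinv c X]c0 cmapK //; exact: sing.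
have m0 : (0 : R) < (2 * (n%:R + 1))^-1 by rewrite invr_gt0 mulr_gt0 // ltr_wpDl.
have [rw [w [J [rw0 wD w0 J0 wZ]]]] := @euler_linearization R n s (loc_field Z c)
  (fun x => jacobian (loc_field Z c) x) h (fun x v => complex.Re (hform (loc_metric g c x) v v))
  _ 2 K 1 s0 (cholS (fun x => @nball_le _ _ _ _ _ x ss1) FD) F0 A1 m0 (ler0n _ _) K0 ltr01
  (fun x v sx => qm x v (nball_le ss2 sx)) (fun x v sx => qM x v (nball_le ss2 sx))
  (fun x v t sx ht sy => euler x v t (nball_le ss3 sx) ht (nball_le ss3 sy)).
have uJ : J (cmap c p) \in unitmx by rewrite c0 J0 unitmx1.
have wD' : chol (nball (cmap c p) rw) w J by rewrite c0.
have [d [hd dp dE]] := change_chart hc cp oW Wp rw0 wD' uJ.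
exists d, h; split=> //; first by have [_ _ _ -> _] := dE p dp; rewrite c0.
move=> x dx; have [cx Wx xb xE tJ] := dE x dx; split=> //.
rewrite (vcomp_change Z hc hd cx dx) tJ xE -A1 -wZ; last by rewrite -c0.
by rewrite /loc_field cmapK.
Qed.

End LinearizingChart.

(** * The volume density in terms of the metric *)

Section TopForms.
Context {R : realType} {n : nat}.
Local Notation C := (Cx R).

Definition block_perm (s : 'S_(n + n)) := [forall a : 'I_(n + n), (a < n)%N == (s a < n)%N].

Lemma block_perm_card : (0 < #|[pred s | block_perm s]|)%N.
Proof. by apply/card_gt0P; exists 1%g; rewrite inE; apply/forallP => a; rewrite perm1. Qed.

(** The product of the two minors is the determinant of [row_perm s V] with its
   off-diagonal blocks erased. In its expansion over [t], the entries of [V] that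
   occur depend on [s^-1 t] only, and whether they are erased depends on [t]
   only, so that the sum over [s] factors. *)
Lemma antisymmetrized_minors (K : comNzRingType) (V : 'M[K]_(n + n)) :
  \sum_(s : 'S_(n + n)) (-1) ^+ s *
    (\det (ulsubmx (row_perm s V)) * \det (drsubmx (row_perm s V)))
  = #|[pred s | block_perm s]|%:R * \det V.
Proof.
pose mask (a b : 'I_(n + n)) : K := ((a < n) == (b < n))%N%:R.
have minorE (X : 'M[K]_(n + n)) : \det (ulsubmx X) * \det (drsubmx X) =
    \sum_(t : 'S_(n + n)) (-1) ^+ t * ((\prod_a mask a (t a)) * \prod_a X a (t a)).
  rewrite -(det_ublock _ 0); apply: eq_bigr => t _; congr (_ * _); rewrite -big_split.
  apply: eq_bigr => a _ /=; rewrite /mask -[in RHS](submxK X).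
  by case: (split_ordP a) => i ->; case: (split_ordP (t _)) => j ->;
    rewrite ?block_mxEul ?block_mxEur ?block_mxEdl ?block_mxEdr /= ?ltn_ord
      ?ltnNge ?leq_addr ?mul1r ?mul0r ?mxE.
have maskE (t : {perm _}) : \prod_a mask a (t a) = (block_perm t)%:R.
  rewrite /block_perm; case: (boolP [forall a, _]) => [/forallP h|].
    by rewrite big1 // => a _; rewrite /mask h.
  by rewrite negb_forall => /existsP[a /negbTE ha]; rewrite (bigD1 a) //= /mask ha mul0r.
transitivity (\sum_(s : 'S_(n + n)) \sum_(t : 'S_(n + n))
    (block_perm t)%:R * ((-1) ^+ (s^-1 * t)%g * \prod_a V a ((s^-1 * t)%g a))).
  apply: eq_bigr => s _; rewrite minorE mulr_sumr; apply: eq_bigr => t _; rewrite maskE.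
  have -> : \prod_a row_perm s V a (t a) = \prod_a V a ((s^-1 * t)%g a).
    rewrite (reindex_inj (@perm_inj _ s^-1%g)); apply: eq_bigr => a _.
    by rewrite mxE permKV permM.
  rewrite odd_permM odd_permV signr_addb -mulrA [RHS]mulrCA; congr (_ * _).
  by rewrite mulrCA.
rewrite exchange_big /= -sum1_card natr_sum mulr_suml [RHS]big_mkcond; apply: eq_bigr => t _ /=.
rewrite inE -mulr_sumr; case: (block_perm t); last by rewrite mul0r.
congr (_ * _); rewrite /determinant (reindex (fun s : 'S_(n + n) => (t * s^-1)%g)) /=.
  by apply: eq_bigr => s _; rewrite invMg invgK mulgKV.
by exists (fun s => (s^-1 * t)%g) => s _; rewrite ?invMg ?invgK ?mulgKV ?mulKVg ?mulgK.
Qed.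

(** The values of [dz^1, ..., dz^n] and of their conjugates on [v]. *)
Definition coframe (v : 'I_(n + n) -> 'rV[R]_(n + n)) : 'M[C]_(n + n) :=
  \matrix_(a, b) row_mx (to_complex (v a)) (map_mx Num.conj (to_complex (v a))) 0 b.

Lemma wedge_top_conj (u : C) v :
  wedge (hol_top_form u) (conj_form (hol_top_form u)) v =
  (n`!%:R * n`!%:R)^-1 * (u * Num.conj u) * (#|[pred s | block_perm s]|%:R * \det (coframe v)).
Proof.
rewrite /wedge -mulrA; congr (_ * _); rewrite -antisymmetrized_minors mulr_sumr.
apply: eq_bigr => s _; rewrite [RHS]mulrCA; congr (_ * _).
have -> : ulsubmx (row_perm s (coframe v)) = \matrix_(i, j) dz j (v (s (lshift n i))).
  by apply/matrixP => i j; rewrite 4![LHS]mxE row_mxEl [RHS]mxE.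
have -> : drsubmx (row_perm s (coframe v)) = map_mx Num.conj (\matrix_(i, j) dz j (v (s (rshift n i)))).
  by apply/matrixP => i j; rewrite 4![LHS]mxE row_mxEr [LHS]mxE [RHS]mxE; congr Num.conj; rewrite [RHS]mxE.
rewrite /hol_top_form /conj_form det_map_mx rmorphM; ring.
Qed.

Lemma coframe_mul (Q : 'M[C]_n) v :
  \det (coframe (fun a => to_real (to_complex (v a) *m Q))) = \det Q * Num.conj (\det Q) * \det (coframe v).
Proof.
have -> : coframe (fun a => to_real (to_complex (v a) *m Q)) =
    coframe v *m block_mx Q 0 0 (map_mx Num.conj Q).
  apply/row_matrixP => a; rewrite row_mul.
  have rowE w : row a (coframe w) = row_mx (to_complex (w a)) (map_mx Num.conj (to_complex (w a))).
    by apply/rowP => b; rewrite [LHS]mxE [LHS]mxE.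
  by rewrite !rowE mul_row_block !mulmx0 addr0 add0r to_realK map_mxM.
by rewrite det_mulmx det_ublock det_map_mx mulrC.
Qed.

Lemma coframe_standard : \det (coframe (fun a => frame a)) != 0.
Proof.
suff : coframe (fun a => frame a) \in unitmx by rewrite unitmxE unitfE.
have -> : coframe (fun a => frame a) = block_mx 1%:M 1%:M ('i)%:M (- 'i)%:M.
  apply/row_matrixP => a; apply/rowP => b; rewrite ![row _ _ _ _]mxE [LHS]mxE.
  case: (split_ordP a) => i ->; case: (split_ordP b) => j ->;
    rewrite ?row_mxEl ?row_mxEr ?block_mxEul ?block_mxEur ?block_mxEdl ?block_mxEdr !mxE !eqxx /=.
  - by rewrite eq_lshift eq_rlshift eq_sym; case: (i == j).
  - by rewrite eq_lshift eq_rlshift eq_sym; case: (i == j); rewrite ?conjC1 ?conjC0.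
  - by rewrite eq_lrshift eq_rshift eq_sym; case: (i == j).
  - rewrite eq_lrshift eq_rshift eq_sym; case: (i == j); last exact: conjC0.
    exact: conj_i.
have uv : block_mx 1%:M 1%:M ('i)%:M (- 'i)%:M *m
    block_mx 1%:M (- 'i)%:M 1%:M ('i)%:M = 2%:M :> 'M[C]_(n + n).
  have ii : 'i * 'i = -1 :> C by rewrite -expr2 sqrCi.
  rewrite mulmx_block !mul1mx -!scalar_mxM !mulr1 mulrN mulNr ii opprK.
  have sD (x y : C) : x%:M + y%:M = (x + y)%:M :> 'M[C]_n by rewrite raddfD.
  by rewrite !sD addNr subrr raddf0 -scalar_mx_block.
have /mulmx1_unit[] // : block_mx 1%:M 1%:M ('i)%:M (- 'i)%:M *m
    (2^-1 *: block_mx 1%:M (- 'i)%:M 1%:M ('i)%:M) = 1%:M :> 'M[C]_(n + n).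
by rewrite -scalemxAr uv -[2%:M]scalemx1 scalerA mulVf ?scale1r // pnatr_eq0.
Qed.

End TopForms.

Lemma solve_density (K : fieldType) (a s c w N D e q q' : K) :
  s * (c * (N * D)) != 0 -> e != 0 -> q != 0 -> q' != 0 ->
  a = s / e * (c * w * (N * (q^-1 / q' * D))) -> w = a / (s * (c * (N * D))) * e * (q * q').
Proof.
rewrite !mulf_eq0 !negb_or => /and4P[s0 c0 N0 D0] e0 q0 q0' ->.
by field; rewrite s0 c0 N0 D0 e0 q0 q0'.
Qed.

Section VolumeDensity.
Context {R : realType} {n : nat}.
Local Notation C := (Cx R).

Lemma wedge_pow_pullback N (a b : Defs.form R N 2) (phi : 'rV[R]_N -> 'rV[R]_N) :
  (forall v, b v = a (fun i => phi (v i))) ->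
  forall k v, wedge_pow b k v = wedge_pow a k (fun i => phi (v i)).
Proof.
move=> ab; elim=> [//|k IH] v; rewrite /= /wedge; congr (_ * _); apply: eq_bigr => s _.
by rewrite ab IH.
Qed.

Lemma kahler_form_pullback (Q : 'M[C]_n) v :
  kahler_form (Q *m adj Q) v = kahler_form 1%:M (fun i => to_real (to_complex (v i) *m Q)).
Proof.
have h1 : adj (1%:M : 'M[C]_n) = 1%:M by rewrite /adj map_mx1 trmx1.
have hQ : adj (Q *m adj Q) = Q *m adj Q by rewrite adjM adjK.
have e (u w : 'rV[C]_n) : hform (Q *m adj Q) u w = hform 1%:M (u *m Q) (w *m Q).
  by rewrite !hform_mulmx mulmx1 adjM !mulmxA.
have E1 := kahler_formE v hQ.
have E2 := kahler_formE (fun i => to_real (to_complex (v i) *m Q)) h1.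
have k (i : 'I_2) : to_complex (to_real (to_complex (v i) *m Q)) = to_complex (v i) *m Q by exact: to_realK.
rewrite E2 E1 e; congr (- rc (complex.Im _)).
apply: (congr2 (hform 1%:M)); apply: esym; exact: k.
Qed.

(** Write the metric as [Q Q^*]. On the frame [v0] moved by [Q^-1] the wedge power
   of the Kaehler form is that of the standard form on [v0], which does not depend
   on the point, and [Upsilon /\ conj Upsilon] is divided by
   [|det Q|^2 = det (Q Q^* )]. *)
Lemma volume_density (M : complex_manifold R n) (W : set M) (g : kahler_metric W) (f : M -> R)
    (Ups : hol_volume_form M) : associated_volume_form g f Ups ->
  exists k : C, forall c x, hol_chart c -> W x -> cdom c x ->
    ucomp Ups c x * Num.conj (ucomp Ups c x) = k * rc (expR (f x)) * \det (gcomp g c x).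
Proof.
move=> vol.
pose v0 (k : nat) : 'rV[R]_(n + n) := if insub k is Some a then frame (a : 'I_(n + n)) else 0.
have v0E (a : 'I_(n + n)) : v0 a = frame a by rewrite /v0 valK.
pose w0 := wedge_pow (kahler_form (1%:M : 'M[C]_n)) n (fun i => v0 i).
pose c0 : C := ('i ^+ n / 2) ^+ n * ((n`!%:R * n`!%:R)^-1 *
  (#|[pred s : 'S_(n + n) | block_perm s]|%:R * \det (coframe (fun a : 'I_(n + n) => frame a)))).
have c00 : c0 != 0.
  have i0 : 'i != 0 :> C := neq0Ci C.
  have n0 : n`!%:R != 0 :> C by rewrite pnatr_eq0 -lt0n fact_gt0.
  have b0 : #|[pred s : 'S_(n + n) | block_perm s]|%:R != 0 :> C by rewrite pnatr_eq0 -lt0n block_perm_card.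
  have p0 : 'i ^+ n / 2 != 0 :> C by rewrite mulf_neq0 ?expf_neq0 // invr_eq0 pnatr_eq0.
  have q0 : (n`!%:R * n`!%:R)^-1 != 0 :> C by rewrite invr_eq0 mulf_neq0.
  exact: mulf_neq0 (expf_neq0 n p0) (mulf_neq0 q0 (mulf_neq0 b0 coframe_standard)).
exists ((n`!%:R)^-1 * w0 / c0) => c x hc Wx cx.
have herm : adj (gcomp g c x) = gcomp g c x := gcomp_hermitian g hc Wx cx.
have pos v : v != 0 -> 0 < complex.Re (hform (gcomp g c x) v v).
  move=> v1; have := @gcomp_pos _ _ _ _ g c x (to_real v) hc Wx cx.
  rewrite metric_formE // !to_realK -rc0 rc_lt; apply; apply: contra_neq v1 => v1.
  by rewrite -[v]to_realK v1 to_complex0.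
have [Q [_ [uQ HQ _]]] := orthonormal_eigenbasis (A := 0) herm pos
  (fun u v => ltac:(by rewrite !mulmx0 -[0](scale0r (0 : matrix C 1 n)) hformZl hformZr rmorph0 !mul0r)).
pose v k := to_real (to_complex (v0 k) *m invmx Q).
have := vol c x v hc Wx cx; rewrite /= wedge_top_conj HQ 
  (wedge_pow_pullback (phi := fun y => to_real (to_complex y *m Q)) (kahler_form_pullback Q)).
rewrite (_ : wedge_pow (kahler_form 1%:M) n _ = w0); last first.
  by congr wedge_pow; apply/funext => i; rewrite /v to_realK mulmxKV // to_complexK.
have -> : \det (coframe (fun i : 'I_(n + n) => v i)) =
    \det (invmx Q) * Num.conj (\det (invmx Q)) * \det (coframe (fun a : 'I_(n + n) => frame a)).
  rewrite -coframe_mul; apply: (congr1 (fun z => \det (coframe z))); apply/funext => a.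
  by rewrite /v v0E.
rewrite det_inv rmorphV ?[X in X -> _]unitfE; last by rewrite -unitmxE.
have dH : \det (Q *m adj Q) = \det Q * Num.conj (\det Q) by rewrite det_mulmx det_tr det_map_mx.
rewrite dH expRN rmorphV; last by rewrite unitfE gt_eqF // expR_gt0.
have q0 : \det Q != 0 by rewrite -unitfE -unitmxE.
have e0 : rc (expR (f x)) != 0 by rewrite rc_eq0 gt_eqF // expR_gt0.
have q0' : Num.conj (\det Q) != 0 by rewrite conjC_eq0.
exact: (solve_density c00 e0 q0 q0').
Qed.

End VolumeDensity.

(** * Invariance of the volume density *)

Section ContinuouslyDifferentiable.
Context {R : realType}.
Local Notation C := (Cx R).

Definition C1r n (D : set 'rV[C]_n) (G : 'rV[C]_n -> C) : Prop :=
  exists L, forall x, D x -> rdiff G x (L x) /\ forall v, ccont (fun y => L y v) x.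

Lemma C1r_cst n (D : set 'rV[C]_n) a : C1r D (fun=> a).
Proof. by exists (fun _ _ => 0) => x _; split=> [|v]; [exact: rdiff_cst | exact: ccont_cst]. Qed.

Lemma C1rD n (D : set 'rV[C]_n) G H : C1r D G -> C1r D H -> C1r D (fun x => G x + H x).
Proof.
move=> [L hL] [K hK]; exists (fun x v => L x v + K x v) => x Dx.
have [dG cL] := hL x Dx; have [dH cK] := hK x Dx; split=> [|v]; first exact: rdiffD.
exact: ccontD.
Qed.

Lemma C1rM n (D : set 'rV[C]_n) G H : C1r D G -> C1r D H -> C1r D (fun x => G x * H x).
Proof.
move=> [L hL] [K hK]; exists (fun x v => L x v * H x + G x * K x v) => x Dx.
have [dG cL] := hL x Dx; have [dH cK] := hK x Dx; split=> [|v]; first exact: rdiffM.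
by apply: ccontD; apply: ccontM => //; [exact: rdiff_ccont dH | exact: rdiff_ccont dG].
Qed.

Lemma C1r_det n k (D : set 'rV[C]_n) (A : 'rV[C]_n -> 'M[C]_k) :
  (forall i j, C1r D (fun x => A x i j)) -> C1r D (fun x => \det (A x)).
Proof.
move=> hA; rewrite /determinant.
have c0 := C1r_cst D 0; have c1 := C1r_cst D 1.
elim: (index_enum _) => [|s l IH].
  by rewrite (_ : (fun _ => _) = (fun=> 0)) //; apply/funext => x; rewrite big_nil.
rewrite (_ : (fun _ => _) = (fun x => (-1) ^+ s * \prod_i A x i (s i)
   + \sum_(t <- l) (-1) ^+ t * \prod_i A x i (t i))); last by apply/funext => x; rewrite big_cons.
apply: C1rD IH; apply: C1rM; first exact: C1r_cst.
elim: (index_enum _) => [|i r IH].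
  by rewrite (_ : (fun _ => _) = (fun=> 1)) //; apply/funext => x; rewrite big_nil.
rewrite (_ : (fun _ => _) = (fun x => A x i (s i) * \prod_(j <- r) A x j (s j))).
  exact: C1rM (hA _ _) IH.
by apply/funext => x; rewrite big_cons.
Qed.

Lemma rdiff_real_comp n (phi : R -> R) l (G : 'rV[C]_n -> C) x L :
  is_derive (complex.Re (G x)) 1 phi l -> rdiff G x L ->
  rdiff (fun y => rc (phi (complex.Re (G y)))) x (fun h => rc (l * complex.Re (L h))).
Proof.
move=> /is_derive_epsP dphi dG.
pose Phi (z : 'rV[C]_1) : C := rc (phi (complex.Re (z 0 0))).
have dPhi : rdiff Phi (const_mx (G x)) (fun z => rc (l * complex.Re (z 0 0))).
  split=> [a u v|e e0]; first by rewrite !mxE reD reZ -rcM -rcD; congr rc; ring.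
  have [d d0 hd] := dphi e e0; exists d => // z zd.
  have z1 : norm1 z = modulus (z 0 0) by rewrite /norm1 big_ord1.
  have zr : `|complex.Re (z 0 0)| <= norm1 z by rewrite z1 re_le_modulus.
  have := hd _ (le_lt_trans zr zd).
  rewrite /Phi !mxE reD -!rcB modulus_rc [(complex.Re _)%:A]mulr1 [complex.Re (z 0 0) * l]mulrC => h.
  by apply: (le_trans h); rewrite ler_wpM2l // ltW.
have := @rdiff_comp _ _ _ (fun y => const_mx (G y)) Phi x (fun h => const_mx (L h)) _ _ dPhi.
rewrite /Phi => h; apply: rdiff_eqL (rdiff_near _ (h _)); last 1 first.
- by move=> j; apply: rdiff_eqL (rdiff_near _ dG) => [v|]; rewrite ?mxE //; exists 1 => // y _; rewrite mxE.
- by move=> v; rewrite mxE.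
by exists 1 => // y _; rewrite mxE.
Qed.

Lemma C1r_expR n (D : set 'rV[C]_n) G : C1r D G -> C1r D (fun x => rc (expR (complex.Re (G x)))).
Proof.
move=> [L hL]; pose E x := expR (complex.Re (G x)).
exists (fun x v => rc (E x * complex.Re (L x v))) => x Dx; have [dG cL] := hL x Dx.
have dE := rdiff_real_comp (is_derive_expR _) dG; split=> [|v]; first exact: dE.
rewrite (_ : (fun _ => _) = (fun y => rc (E y) * rc (complex.Re (L y v)))).
  by apply: ccontM; [exact: rdiff_ccont dE | exact: ccont_re].
by apply/funext => y; rewrite rcM.
Qed.

Lemma C1r_lift n (D : set 'rV[C]_n) (D' : set 'rV[R]_(n + n)) u : smooth_on D' u ->
  (forall x, D x -> D' (to_real x) /\ open_at D' (to_real x)) -> C1r D (lift u).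
Proof.
move=> su hD; exists (dlift u) => x Dx; have [h1 h2] := hD x Dx; split=> [|v].
  exact: (rdiff_lift (smooth_on_C1 su) h2).
exact: dlift_ccont su h1.
Qed.

(** A differentiable [u] with [|u|^2] continuously differentiable is
   continuously differentiable, because [u] is complex differentiable:
   [2 conj(u) du(v) = d|u|^2(v) - i d|u|^2(i v)]. *)
Lemma chol_of_modulus n (D : set 'rV[C]_n) (U : 'rV[C]_n -> C) :
  (forall x, D x -> differentiable U x) -> (forall x, D x -> U x != 0) ->
  C1r D (fun x => U x * Num.conj (U x)) -> exists J, chol D (fun x => const_mx (U x) : 'rV[C]_1) J.
Proof.
move=> dU U0 [L hL].
pose e i : 'rV[C]_n := delta_mx 0 i.
pose J x : 'M[C]_(n, 1) := \matrix_(i, j) ((L x (e i) - 'i * L x ('i *: e i)) / (2 * Num.conj (U x))).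
exists J => x Dx; have [dS cL] := hL x Dx; have rU := differentiable_rdiff (dU x Dx).
have cU := rdiff_ccont rU.
have U'0 : Num.conj (U x) != 0 by rewrite conjC_eq0 U0.
have LE : forall v, L x v = 'd U x v * Num.conj (U x) + U x * Num.conj ('d U x v).
  by apply: rdiff_unique dS (rdiffM rU (rdiff_conj rU)).
have two : (2 : C) != 0 by rewrite pnatr_eq0.
have JE i : 'd U x (e i) = J x i 0.
  have Li : 'd U x ('i *: e i) = 'i * 'd U x (e i) by rewrite linearZ.
  have ii : 'i * 'i = -1 :> C by rewrite -expr2 sqrCi.
  have cM : Num.conj ('i * 'd U x (e i)) = - 'i * Num.conj ('d U x (e i)) by rewrite rmorphM /= conj_i.
  rewrite mxE !LE Li cM.
  apply: (canRL (mulfK _)); first exact: mulf_neq0.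
  move: ('d U x (e i)) (U x) => d u; transitivity (d * Num.conj u + u * Num.conj d - ('i * 'i) * (d * Num.conj u - u * Num.conj d)); last by ring.
  by rewrite ii; ring.
split=> [j|i j].
  apply: rdiff_eqL (rdiff_near _ rU) => [v|]; last by exists 1 => // y _; rewrite mxE.
  rewrite (ord1 j) mxE {1}[v](matrix_sum_delta v) exchange_big linear_sum; apply: eq_bigr => k _.
  by rewrite big_ord1 linearZ -JE.
rewrite (_ : (fun y => _) = (fun y => (L y (e i) + (- 'i) * L y ('i *: e i)) * (2 * Num.conj (U y))^-1)); last first.
  by apply/funext => y; rewrite mxE mulNr.
apply: ccontM; first by apply: ccontD; [exact: cL | apply: ccontZ; exact: cL].
have rV := rdiffV (mulf_neq0 two U'0) (rdiffZ 2 (rdiff_conj rU)).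
exact: rdiff_ccont rV.
Qed.

Lemma differentiable_const_mx n (U : 'rV[C]_n -> C) x (J : 'M[C]_(n, 1)) :
  cdiff (fun y => const_mx (U y) : 'rV[C]_1) x J -> rdiff U x (fun v => (v *m J) 0 0).
Proof.
move=> dU; apply: rdiff_near (dU 0); exists 1 => // y _; exact: mxE.
Qed.

End ContinuouslyDifferentiable.

Section RotationPaths.
Context {R : realType}.
Local Notation C := (Cx R).

Lemma C1r_eq n (a : 'rV[C]_n) r G H : (forall x, nball a r x -> G x = H x) ->
  C1r (nball a r) G -> C1r (nball a r) H.
Proof.
move=> GH [L hL]; exists L => x ax; have [dG cL] := hL x ax; split=> //.
have [e e0 he] := nball_near ax.
by apply: rdiff_near dG; exists e => // y /he; exact: GH.
Qed.

Lemma rdiff_cis (b : R) (z : 'rV[C]_1) : rdiff (fun w : 'rV[C]_1 => cis (b * complex.Re (w 0 0))) z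
  (fun w => rc (complex.Re (w 0 0)) * ('i * (rc b * cis (b * complex.Re (z 0 0))))).
Proof.
have dG := rdiff_lin z (rlinear_coord (rc b : C) (0 : 'I_1)).
have Re_b (w : 'rV[C]_1) : complex.Re (rc b * w 0 0) = b * complex.Re (w 0 0) by rewrite reZ.
have dc := rdiff_real_comp (is_derive_cos _) dG.
have ds := rdiff_real_comp (is_derive_sin _) dG.
have D := rdiffD dc (rdiffZ 'i ds); apply: rdiff_eqL (rdiff_near _ D) => [w|]; last first.
  exists 1 => // y _; rewrite !Re_b.
  by apply: complex_ext; rewrite ?reD ?imD ?re_i ?im_i ?re_rc ?im_rc ?oppr0 ?addr0 ?add0r.
rewrite !Re_b /cis; move: (b * complex.Re (z 0 0)) (complex.Re (w 0 0)) => s t.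
by apply: complex_ext; rewrite !(reD, imD, reZ, imZ, re_i, im_i, re_rc, im_rc) /=; ring.
Qed.

(** The flow of the field [i x diag(h)]. *)
Definition rotation n (h : 'I_n -> R) (t : R) : 'M[C]_n := cdiag (fun j => cis (h j * t)).

Lemma norm1_rotation n (h : 'I_n -> R) t (x : 'rV[C]_n) : norm1 (x *m rotation h t) = norm1 x.
Proof.
by apply: eq_bigr => j _; rewrite mulmx_cdiag modulusM modulus_cis mulr1.
Qed.

Lemma rotation_path n (h : 'I_n -> R) (x : 'rV[C]_n) (z : 'rV[C]_1) :
  vdiff (fun w : 'rV[C]_1 => x *m rotation h (complex.Re (w 0 0))) z
   (fun w => rc (complex.Re (w 0 0)) *:
      ('i *: (x *m rotation h (complex.Re (z 0 0)) *m cdiag (fun j => rc (h j))))).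
Proof.
move=> j; apply: rdiff_eqL (rdiff_near _ (rdiffZ (x 0 j) (rdiff_cis (h j) z))) => [w|].
  by rewrite mxE [in RHS]mxE !mulmx_cdiag; ring.
by exists 1 => // w _; rewrite mulmx_cdiag.
Qed.

(** Apply [hform_skew_selfadjoint] to multiplication by [i], which is
   anti-self-adjoint as well. *)
Lemma hform_zero n (S : 'M[C]_n) : (map_mx Num.conj S)^T = S ->
  (forall v, complex.Re (hform S v v) = 0) -> S = 0.
Proof.
move=> hS h0.
have sc (u : 'rV[C]_n) : u *m ('i)%:M = 'i *: u by rewrite mul_mx_scalar.
have h1 v : complex.Im (hform S (v *m ('i)%:M) v) = 0 by rewrite sc hformZl im_i h0.
apply/matrixP => i j; rewrite [RHS]mxE.
have := hform_skew_selfadjoint hS h1 (delta_mx 0 i) (delta_mx 0 j).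
rewrite !sc hformZl hformZr conj_i.
have -> : hform S (delta_mx 0 i) (delta_mx 0 j) = S i j.
  rewrite hform_mulmx -rowE mxE (bigD1 j) //= big1 => [|k kj].
    by rewrite adj_delta eqxx mulr1 addr0 mxE.
  by rewrite adj_delta (negbTE kj) mulr0.
move/eqP; rewrite mulNr -subr_eq0 opprK -mulr2n mulrn_eq0 mulf_eq0 /= => /orP[|/eqP//].
by rewrite (negbTE (neq0Ci C)).
Qed.

(** Differentiating [|q|^2 = 1] in the directions [v] and [i v] gives
   [Re (dq(v) conj q) = 0] and [Im (dq(v) conj q) = 0]. *)
Lemma unimodular_constant n (r : R) (q : 'rV[C]_n -> C) (L : 'rV[C]_n -> 'rV[C]_n -> C) :
  (forall x, nball 0 r x -> rdiff q x (L x)) ->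
  (forall x v, nball 0 r x -> L x ('i *: v) = 'i * L x v) ->
  (forall x, nball 0 r x -> q x * Num.conj (q x) = 1) ->
  forall x, nball 0 r x -> q x = q 0.
Proof.
move=> dq Li q1 x bx.
have L0 y v : nball 0 r y -> L y v = 0.
  move=> by_; have [e e0 he] := nball_near by_.
  have d1 := rdiffM (dq y by_) (rdiff_conj (dq y by_)).
  have d2 : rdiff (fun y => q y * Num.conj (q y)) y (fun=> 0).
    by apply: rdiff_near (rdiff_cst y 1); exists e => // w /he bw; exact: esym (q1 w bw).
  have E u : L y u * Num.conj (q y) + q y * Num.conj (L y u) = 0 := rdiff_unique d1 d2 u.
  have E1 := E v; have := E ('i *: v); rewrite Li // rmorphM /= conj_i => E2.
  have q0 : Num.conj (q y) != 0.
    by apply: contra_eqN (q1 y by_) => /eqP ->; rewrite mulr0 eq_sym oner_eq0.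
  have : 'i * L y v * Num.conj (q y) *+ 2 = 0.
    transitivity ('i * (L y v * Num.conj (q y) + q y * Num.conj (L y v)) +
      ('i * L y v * Num.conj (q y) + q y * (- 'i * Num.conj (L y v)))); first ring.
    by rewrite E1 E2 mulr0 addr0.
  move/eqP; rewrite mulrn_eq0 /= !mulf_eq0 (negbTE q0) orbF (negbTE (neq0Ci C)) /=.
  by move/eqP.
have b0 t : 0 <= t <= 1 -> nball 0 r (0 + rc t *: x).
  move=> ht; apply: nball_segment ht; last by rewrite add0r.
  by rewrite /nball /= subrr norm10; apply: le_lt_trans bx; exact: norm1_ge0.
have := @rdiff_mean_value _ _ q 0 x (fun t => L (0 + rc t *: x)) 0 (fun t ht => dq _ (b0 t ht)).
have m0 t : 0 <= t <= 1 -> modulus (L (0 + rc t *: x) x) <= 0.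
  by move=> ht; rewrite L0 ?modulus0 //; exact: b0.
by move/(_ m0); rewrite add0r => h; apply/eqP; rewrite -subr_eq0 -modulus_eq0 eq_le h modulus_ge0.
Qed.

End RotationPaths.

Section VolumeInvariance.
Context {R : realType} {n : nat}.
Local Notation C := (Cx R).
Variables (M : complex_manifold R n) (Z : hol_vector_field M) (W : set M).
Variables (g : kahler_metric W) (f : M -> R) (Ups : hol_volume_form M).
Variables (d : chart R n M) (h : 'I_n -> R) (r : R).
Hypothesis hd : hol_chart d.
Hypothesis soliton : gradient_soliton g f.
Hypothesis assoc : associated_vector_field g f Z.
Hypothesis vol : associated_volume_form g f Ups.
Hypothesis r0 : 0 < r.
Hypothesis hr : forall x, nball 0 r x -> [/\ cdom d (cinv d x), W (cinv d x) & cmap d (cinv d x) = x].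
Hypothesis linear : forall x, nball 0 r x -> loc_field Z d x = x *m cdiag (fun j => rc (h j)).

Local Notation H := (loc_metric g d).
Local Notation F := (loc_field Z d).
Local Notation A := (cdiag (fun j => rc (h j)) : 'M[C]_n).
Local Notation pot := (loc_pot f d).
Local Notation dH := (loc_dmetric g d).
Local Notation rot := (rotation h).

Definition loc_volume (x : 'rV[C]_n) : C := ucomp Ups d (cinv d x).

Let loc_smooth u : smooth_on (local_dom W d) u -> C1r (nball 0 r) (lift u).
Proof. by move=> su; apply: C1r_lift su _ => x bx; split; [exact: (loc_dom hr) | exact: (loc_open hr)]. Qed.

(** The density of the volume form is only assumed complex differentiable; its
   derivative is continuous because [volume_density] expresses its modulus
   through the metric and the potential. *)
Lemma volume_chol : exists J, chol (nball 0 r) (fun x => const_mx (loc_volume x) : 'rV[C]_1) J.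
Proof.
have [k dens] := volume_density vol.
apply: chol_of_modulus => [x /hr[h1 _ h3]|x /hr[h1 _ _]|].
- by have := @ucomp_hol _ _ _ Ups d (cinv d x) hd h1; rewrite h3.
- exact: ucomp_neq0.
apply: (C1r_eq (G := fun x => k * rc (expR (complex.Re (lift pot x))) * \det (H x))) => [x bx|].
  by have [h1 h2 _] := hr bx; rewrite /loc_volume dens // /lift re_rc /loc_pot local_exprE.
apply: C1rM; first by apply: C1rM; [exact: C1r_cst | apply: C1r_expR; exact: loc_smooth (pot_smooth hd soliton)].
apply: C1r_det => i j; rewrite (_ : (fun x => _) = (fun x => lift (gre g d i j) x + 'i * lift (gim g d i j) x)).
  apply: C1rD; first exact: loc_smooth (gre_smooth g hd i j).
  by apply: C1rM; [exact: C1r_cst | exact: loc_smooth (gim_smooth g hd i j)].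
by apply/funext => x; exact: loc_metric_lift.
Qed.

Lemma nball_rotation t x : nball 0 r x -> nball 0 r (x *m rot t).
Proof. by rewrite /nball /= !subr0 norm1_rotation. Qed.

Lemma linear_jacobian x : nball 0 r x -> jacobian F x = A.
Proof.
move=> bx; apply: cdiff_unique (loc_field_cdiff Z hd hr bx) _.
have [e e0 he] := nball_near bx.
have D := cdiff_mulr A (cdiff_id x); rewrite mul1mx in D.
by move=> j; apply: rdiff_near (D j); exists e => // y /he /linear ->.
Qed.

(** By [loc_killing], the Hermitian matrix with these entries has a vanishing
   quadratic form. *)
Lemma killing_matrix x i j : nball 0 r x ->
  dH x ('i *: F x) i j + 'i * (rc (h i) - rc (h j)) * H x i j = 0.
Proof.
move=> bx; have hH := loc_metric_herm g hd hr bx.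
have hdH := loc_dmetric_herm g hd hr ('i *: F x) bx.
pose B : 'M[C]_n := \matrix_(k, l) ('i * (rc (h k) - rc (h l)) * H x k l).
have cr (t : R) : Num.conj (rc t : C) = rc t.
  by apply: complex_ext; rewrite ?re_conj ?im_conj ?im_rc ?oppr0.
have hB : (map_mx Num.conj B)^T = B.
  apply/matrixP => k l; rewrite mxE [LHS]mxE ![B _ _]mxE !rmorphM /= conj_i rmorphB /= !cr.
  have -> : Num.conj (H x l k) = H x k l by rewrite -[in RHS]hH !mxE.
  ring.
have S0 : dH x ('i *: F x) + B = 0.
  apply: hform_zero => [|v].
    rewrite map_mxD linearD /= hdH hB //.
  have := loc_killing hd soliton assoc hr v bx; rewrite linear_jacobian // hformDM reD => K.
  have -> : complex.Re (hform B v v) = 2 * complex.Re (hform (H x) ('i *: (v *m A)) v); last exact: K.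
  have -> : hform B v v = hform (H x) ('i *: (v *m A)) v + Num.conj (hform (H x) ('i *: (v *m A)) v).
    rewrite -hform_conj // /hform -big_split; apply: eq_bigr => k _ /=; rewrite -big_split.
    apply: eq_bigr => l _ /=; rewrite mxE !(mxE, mulmx_cdiag) rmorphM rmorphM /= conj_i cr.
    ring.
  by rewrite reD re_conj; ring.
by have := congr1 (fun S : 'M[C]_n => S i j) S0; rewrite /= 2!mxE [B i j]mxE mxE.
Qed.

Lemma rdiff_constant (G : 'rV[C]_1 -> C) L : (forall z, rdiff G z (L z)) ->
  (forall z w, L z w = 0) -> forall z, G z = G 0.
Proof.
move=> dG L0 z; apply/eqP; rewrite -subr_eq0 -modulus_eq0 eq_le modulus_ge0 andbT.
have := @rdiff_mean_value _ _ G 0 z (fun t => L (0 + rc t *: z)) 0 (fun t ht => dG _).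
by rewrite add0r; apply=> t _; rewrite L0 modulus0.
Qed.

(** The derivative with respect to [t] vanishes by [killing_matrix]. *)
Lemma metric_rotation t x i j : nball 0 r x ->
  cis (h i * t) * Num.conj (cis (h j * t)) * H (x *m rot t) i j = H x i j.
Proof.
move=> bx; pose y (z : 'rV[C]_1) := x *m rot (complex.Re (z 0 0)).
pose K (z : 'rV[C]_1) := cis (h i * complex.Re (z 0 0)) * Num.conj (cis (h j * complex.Re (z 0 0))) * H (y z) i j.
have by_ z : nball 0 r (y z) by exact: nball_rotation.
have dK z := rdiffM (rdiffM (rdiff_cis (h i) z) (rdiff_conj (rdiff_cis (h j) z)))
  (rdiff_comp (rotation_path h x z) (loc_metric_rdiff g hd hr i j (by_ z))).
have := rdiff_constant dK _ (const_mx (rc t)); rewrite /K /y !mxE re_rc (erefl : complex.Re (0 : C) = 0) !mulr0 cis0 conjC1 !mul1r.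
have -> : x *m rot 0 = x.
  by apply/rowP => k; rewrite mulmx_cdiag mulr0 cis0 mulr1.
apply=> z w; have [lL _] := loc_metric_rdiff g hd hr i j (by_ z).
rewrite /= (rlinearZ _ _ lL) -/(y z) -linear //.
have cr (s : R) : Num.conj (rc s : C) = rc s.
  by apply: complex_ext; rewrite ?re_conj ?im_conj ?im_rc ?oppr0.
have := killing_matrix i j (by_ z); move: (dH _ _ i j) (H _ i j) => dk k.
rewrite !rmorphM /= conj_i !cr.
move: (cis _) (Num.conj (cis _)) (rc _) (rc _) (rc _) => c c' s b a E.
transitivity (s * c * c' * (dk + 'i * (a - b) * k)); first ring.
by rewrite E mulr0.
Qed.

Lemma potential_rotation t x : nball 0 r x -> f (cinv d (x *m rot t)) = f (cinv d x).
Proof.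
move=> bx; pose y (z : 'rV[C]_1) := x *m rot (complex.Re (z 0 0)).
have by_ z : nball 0 r (y z) by exact: nball_rotation.
have lE w : lift pot w = rc (f (cinv d w)) by rewrite /lift /loc_pot local_exprE.
have dK0 z := rdiff_re (rdiff_comp (rotation_path h x z) (rdiff_lift
  (smooth_on_C1 (pot_smooth hd soliton)) (loc_open hr (by_ z)))).
have nE (z : 'rV[C]_1) : exists2 e : R, 0 < e & forall w, norm1 (w - z) < e ->
    rc (complex.Re (lift pot (y w))) = rc (f (cinv d (y w))).
  by exists 1 => // w _; rewrite lE.
have dK z := rdiff_near (nE z) (dK0 z).
have := rdiff_constant dK _ (const_mx (rc t)); rewrite /y !mxE re_rc (erefl : complex.Re (0 : C) = 0).
have -> : x *m rot 0 = x.
  by apply/rowP => k; rewrite mulmx_cdiag mulr0 cis0 mulr1.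
move=> e; apply: rc_inj; apply: e => z w.
have [lL _] := rdiff_lift (smooth_on_C1 (pot_smooth hd soliton)) (loc_open hr (by_ z)).
rewrite /= (rlinearZ _ _ lL) -/(y z) -linear // reZ.
by rewrite (loc_pot_invariant hd assoc hr (by_ z)) mulr0.
Qed.

Lemma modulus_volume_rotation t x : nball 0 r x ->
  loc_volume (x *m rot t) * Num.conj (loc_volume (x *m rot t)) = loc_volume x * Num.conj (loc_volume x).
Proof.
move=> bx; have [k dens] := volume_density vol.
have [h1 h2 _] := hr bx; have [h3 h4 _] := hr (nball_rotation t bx).
rewrite /loc_volume (dens _ _ hd h2 h1) (dens _ _ hd h4 h3) (potential_rotation t bx); congr (_ * _).
pose D := rot t.
have HE : H x = D *m H (x *m D) *m adj D.
  apply/matrixP => i j; rewrite -(metric_rotation t i j bx) mxE.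
  rewrite (bigD1 j) //= big1 => [|l lj].
    rewrite addr0 /D /rotation /cdiag mul_diag_mx !mxE eqxx mulr1n; ring.
  by rewrite [adj _ _ _]mxE /D /rotation /cdiag !mxE eq_sym (negbTE lj) conjC0 mulr0.
have DD : \det D * Num.conj (\det D) = 1.
  rewrite det_diag rmorph_prod -big_split big1 // => l _ /=.
  by rewrite mxE mul_conj modulus_cis expr1n rc1.
rewrite -/(H x) -/(H (x *m rot t)) HE !det_mulmx det_tr det_map_mx.
by rewrite mulrAC DD mul1r.
Qed.

(** [u] is constant along the orbits of [i Z], because [u(rot x) / u(x)] is
   holomorphic, unimodular and equal to [1] at the origin. *)
Lemma volume_invariant : exists J, chol (nball 0 r) (fun x => const_mx (loc_volume x) : 'rV[C]_1) J /\
  forall x, nball 0 r x -> x *m A *m J x = 0.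
Proof.
have [J UJ] := volume_chol; exists J; split=> // x bx.
have dU y : nball 0 r y -> rdiff loc_volume y (fun v => (v *m J y) 0 0).
  by move=> yb; exact: differentiable_const_mx (UJ y yb).1.
have U0 y : nball 0 r y -> loc_volume y != 0.
  by move=> /hr[h1 _ _]; exact: ucomp_neq0.
have b0 : nball 0 r (0 : 'rV[C]_n) by rewrite /nball /= subrr norm10.
have inv t y : nball 0 r y -> loc_volume (y *m rot t) = loc_volume y.
  pose q z := loc_volume (z *m rot t) * (loc_volume z)^-1.
  have dq z (bz : nball 0 r z) := rdiffM (rdiff_comp (cdiff_mulr (rot t) (cdiff_id z)) (dU _ (nball_rotation t bz)))
    (rdiffV (U0 z bz) (dU z bz)).
  move=> yb; have E : q y = q 0.
    apply: (unimodular_constant dq) yb => [z v zb|z zb].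
      have Zl (a : C) (v1 : 'rV[C]_n) (B : 'M[C]_(n, 1)) : (a *: v1 *m B) 0 0 = a * (v1 *m B) 0 0.
        by rewrite -scalemxAl mxE.
      by rewrite -scalemxAl !Zl; ring.
    rewrite /q rmorphM /= fmorphV mulrACA modulus_volume_rotation // -invfM mulfV //.
    by rewrite mulf_neq0 ?conjC_eq0 ?U0.
  move: E; rewrite /q mul0mx mulfV ?U0 // => /(canRL (mulfVK (U0 y yb))).
  by rewrite mul1r.
have e0 : complex.Re ((0 : 'rV[C]_1) 0 0) = 0 by rewrite mxE.
have e1 : complex.Re ((const_mx 1 : 'rV[C]_1) 0 0) = 1 by rewrite mxE.
have rot0 : x *m rot 0 = x.
  by apply/rowP => k; rewrite mulmx_cdiag mulr0 cis0 mulr1.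
have dUx := rdiff_comp (rotation_path h x 0) (dU _ (nball_rotation (complex.Re ((0 : 'rV[C]_1) 0 0)) bx)).
have dC : rdiff (fun z : 'rV[C]_1 => loc_volume (x *m rot (complex.Re (z 0 0)))) 0 (fun=> 0).
  by apply: rdiff_near (rdiff_cst 0 (loc_volume x)); exists 1 => // z _; rewrite inv.
have := rdiff_unique dUx dC (const_mx 1); rewrite e0 e1 rot0 rc1 scale1r -scalemxAl.
set w := _ *m J x; rewrite mxE => /eqP; rewrite mulf_eq0 (negbTE (neq0Ci C)) /= => /eqP w0.
by apply/matrixP => i j; rewrite (ord1 i) (ord1 j) w0 mxE.
Qed.

End VolumeInvariance.

(** * A primitive of the volume density *)

Section VolumeCoordinate.
Context {R : realType}.
Local Notation C := (Cx R).

(** On each interval of the subdivision [taylor1] bounds the error by the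
   oscillation of the derivative [J]. *)
Lemma riemann_sum (f J : 'rV[C]_1 -> 'rV[C]_1) :
  (forall z, norm1 z <= 1 -> cdiff f z (J z : 'M[C]_1) /\ vcont J z) ->
  forall e : R, 0 < e -> exists N0, forall N, (N0 <= N)%N ->
    norm1 (f (const_mx 1) - f (const_mx 0)
      - (N.+1%:R)^-1 *: \sum_(k < N.+1) J (const_mx (rc (k%:R / N.+1%:R)))) <= e.
Proof.
move=> fJ e e0.
have [|d d0 hd] := @uniform_continuity _ _ _ J 0 1 _ e e0.
  by move=> x; rewrite subr0 => /fJ[].
have [N0 hN0] : exists N0 : nat, d^-1 < N0%:R by exists (Num.truncn d^-1).+1; exact: truncnS_gt.
exists N0 => N hN; set p := fun k : nat => const_mx (rc (k%:R / N.+1%:R)) : 'rV[C]_1.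
have N1 : (0 : R) < N.+1%:R by rewrite ltr0n.
have p_le k : (k <= N.+1)%N -> norm1 (p k) <= 1.
  move=> hk; rewrite /norm1 big_ord1 mxE modulus_rc ger0_norm ?divr_ge0 //.
  by rewrite ler_pdivrMr // mul1r ler_nat.
pose w : 'rV[C]_1 := const_mx (rc N.+1%:R^-1).
have pS k : p k.+1 = p k + w.
  by apply/rowP => j; rewrite !mxE -rcD; congr rc; rewrite -addn1 natrD mulrDl mul1r.
have w1 : norm1 w = N.+1%:R^-1.
  by rewrite /norm1 big_ord1 mxE modulus_rc ger0_norm // invr_ge0 ltW.
have wd : norm1 w < d.
  rewrite w1 invf_plt ?posrE //; apply: lt_le_trans hN0 _; rewrite ler_nat; exact: leqW.
have seg k (t : R) : (k < N.+1)%N -> 0 <= t <= 1 -> norm1 (p k + rc t *: w) <= 1.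
  move=> hk /andP[t0 t1]; rewrite /norm1 big_ord1 !mxE -rcM -rcD modulus_rc ger0_norm; last first.
    by rewrite addr_ge0 ?mulr_ge0 ?divr_ge0 ?invr_ge0.
  rewrite -mulrDl ler_pdivrMr // mul1r; apply: (@le_trans _ _ (k%:R + 1)); first by rewrite lerD2l.
  by rewrite natr1 ler_nat.
have step k : (k < N.+1)%N -> norm1 (f (p k.+1) - f (p k) - w *m (J (p k) : 'M[C]_1)) <= N.+1%:R^-1 * e.
  move=> hk; rewrite pS; apply: (@taylor1 _ _ _ f J) => t ht; first exact: (fJ _ (seg k t hk ht)).1.
  apply: (le_trans (norm1_mulmx _ _)); rewrite w1 ler_wpM2l ?invr_ge0 //.
  rewrite /mnorm1 big_ord1.
  apply: hd; rewrite ?subr0; first exact: seg.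
    by rewrite p_le // ltnW.
  rewrite addrAC subrr add0r norm1Z modulus_rc; case/andP: ht => t0 t1.
  by apply: le_lt_trans wd; rewrite ler_piMl ?norm1_ge0 // ger0_norm.
have wJ (A : 'M[C]_1) : w *m A = N.+1%:R^-1 *: A.
  by apply/matrixP => i j; rewrite (ord1 i) !mxE big_ord1 mxE rcV rc_nat.
have p0 : p 0%N = const_mx 0 by rewrite /p mul0r rc0.
have p1 : p N.+1 = const_mx 1 by rewrite /p divff ?rc1 // pnatr_eq0.
rewrite -p0 -p1 -(@telescope_sumr _ 0 N.+1 (fun k => f (p k))) // big_mkord scaler_sumr -sumrB.
apply: (le_trans (norm1_sum _ _ _)); apply: (@le_trans _ _ (\sum_(k < N.+1) (N.+1%:R^-1 * e))).
  by apply: ler_sum => k _; rewrite -wJ; exact: step.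
by rewrite big_const card_ord iter_addr addr0 -(mulr_natl (N.+1%:R^-1 * e)) mulrA mulfV ?mul1r // pnatr_eq0.
Qed.

End VolumeCoordinate.

Lemma eq0_modulus_le (R : realType) (z : Cx R) (K : R) : 0 <= K ->
  (forall e : R, 0 < e -> modulus z <= K * e) -> z = 0.
Proof.
move=> K0 hz; apply/eqP; rewrite -modulus_eq0 eq_le modulus_ge0 andbT.
apply/ler_addgt0Pr => e e0; rewrite add0r; have K1 : 0 < K + 1 by rewrite ltr_wpDl.
apply: (le_trans (hz (e / (K + 1)) _)); first by rewrite divr_gt0.
by rewrite mulrA ler_pdivrMr // mulrC ler_wpM2l ?lerDl // ltW.
Qed.

Section VolumeCoordinate.
Context {R : realType} {k : nat}.
Local Notation C := (Cx R).
Local Notation n := k.+1.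
Variables (r : R) (h : 'I_n -> R) (u : 'rV[C]_n -> C) (J : 'rV[C]_n -> 'M[C]_(n, 1)).
Local Notation A := (cdiag (fun j => rc (h j)) : 'M[C]_n).
Hypothesis r0 : 0 < r.
Hypothesis uJ : chol (nball 0 r) (fun x => const_mx (u x) : 'rV[C]_1) J.
Hypothesis u_inv : forall x, nball 0 r x -> x *m A *m J x = 0.

(** Shrinks the first coordinate, along which [u] is to be integrated. *)
Definition squeeze (z : C) : 'M[C]_n := cdiag (fun j => if j == ord0 then z else 1).

Lemma norm1_squeeze z x : modulus z <= 1 -> norm1 (x *m squeeze z) <= norm1 x.
Proof.
move=> z1; apply: ler_sum => j _; rewrite mulmx_cdiag modulusM ler_piMr ?modulus_ge0 //.
by case: (j == ord0); rewrite ?modulus1.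
Qed.

Lemma nball_squeeze z x : modulus z <= 1 -> nball 0 r x -> nball 0 r (x *m squeeze z).
Proof. by move=> z1; rewrite /nball /= !subr0; apply: le_lt_trans; exact: norm1_squeeze. Qed.

Definition node q i : C := rc (i%:R / q.+1%:R).

Lemma node_le1 q (i : 'I_q.+1) : modulus (node q i) <= 1.
Proof.
rewrite modulus_rc ger0_norm ?divr_ge0 // ler_pdivrMr ?ltr0n // mul1r ler_nat.
exact: ltnW.
Qed.

Definition avg q (x : 'rV[C]_n) : 'rV[C]_1 :=
  q.+1%:R^-1 *: \sum_(i < q.+1) const_mx (u (x *m squeeze (node q i))).
Definition davg q (x : 'rV[C]_n) : 'M[C]_(n, 1) :=
  q.+1%:R^-1 *: \sum_(i < q.+1) squeeze (node q i) *m J (x *m squeeze (node q i)).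

Lemma avg_chol q : chol (nball 0 r) (avg q) (davg q).
Proof.
have D (i : 'I_q.+1) := chol_comp (chol_lin (D := nball 0 r) (squeeze (node q i))) uJ
  (fun x bx => nball_squeeze (node_le1 i) bx).
exact: (cholZ q.+1%:R^-1 (chol_sum (index_enum _) D)).
Qed.

Lemma davg_inv q x : nball 0 r x -> x *m A *m davg q x = 0.
Proof.
move=> bx; rewrite -scalemxAr mulmx_sumr big1 ?scaler0 // => i _; rewrite mulmxA.
have -> : x *m A *m squeeze (node q i) = x *m squeeze (node q i) *m A.
  rewrite -!mulmxA !cdiagM; congr (_ *m cdiag _); apply/funext => j; exact: mulrC.
exact: u_inv (nball_squeeze (node_le1 i) bx).
Qed.

(** The average [avg q x] approximates the integral of [u(s x_1, x')] over
   0 <= s <= 1, so that the first component approximates a primitive of [u] in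
   the first coordinate. *)
Definition prim q (x : 'rV[C]_n) : 'rV[C]_n :=
  \row_j (if j == ord0 then x 0 ord0 * avg q x 0 0 else x 0 j).
Definition dprim q (x : 'rV[C]_n) : 'M[C]_n :=
  \matrix_(i, j) (if j == ord0 then (i == ord0)%:R * avg q x 0 0 + x 0 ord0 * davg q x i 0
                  else (i == j)%:R).

Lemma prim_chol q : chol (nball 0 r) (prim q) (dprim q).
Proof.
move=> x bx; have [dB cB] := avg_chol q bx.
have ccoord j : ccont (fun y : 'rV[C]_n => y 0 j) x by exact: vdiff_vcont (vdiff_id x) j.
have cavg : ccont (fun y => avg q y 0 0) x by exact: vdiff_vcont dB 0.
split=> [j|i j].
  have [->|j0] := eqVneq j ord0.
    apply: rdiff_eqL (rdiff_near _ (rdiffM (vdiff_id x ord0) (dB 0))) => [v|]; last first.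
      by exists 1 => // y _; rewrite [RHS]mxE eqxx.
    rewrite [LHS]addrC [RHS]mxE; under [RHS]eq_bigr do rewrite mxE eqxx mulrDr.
    rewrite big_split addrC /=; congr (_ + _).
      rewrite (bigD1 ord0) //= big1 => [|i i0]; first by rewrite ?eqxx mul1r addr0.
      by rewrite (negbTE i0) mul0r mulr0.
    by rewrite mxE mulr_sumr; apply: eq_bigr => i _; rewrite mulrCA.
  apply: rdiff_eqL (rdiff_near _ (vdiff_id x j)) => [v|]; last first.
    by exists 1 => // y _; rewrite [RHS]mxE (negbTE j0).
  rewrite mxE (bigD1 j) //= big1 => [|i ij]; first by rewrite mxE (negbTE j0) eqxx mulr1 addr0.
  by rewrite mxE (negbTE j0) (negbTE ij) mulr0.
have [->|j0] := eqVneq j ord0.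
  rewrite (_ : (fun y => _) = (fun y => (i == ord0)%:R * avg q y 0 0 + y 0 ord0 * davg q y i 0)).
    by apply: ccontD; [apply: ccontZ | apply: ccontM].
  by apply/funext => y; rewrite mxE.
rewrite (_ : (fun y => _) = fun=> (i == j)%:R); first exact: ccont_cst.
by apply/funext => y; rewrite mxE (negbTE j0).
Qed.

Lemma prim_inv q x : nball 0 r x -> x *m A *m dprim q x = prim q x *m A.
Proof.
move=> bx; apply/rowP => j; rewrite mulmx_cdiag [prim q x 0 j]mxE mxE.
have [->|j0] := eqVneq j ord0.
  under eq_bigr do rewrite [dprim _ _ _ _]mxE eqxx mulrDr.
  rewrite big_split /= (bigD1 ord0) //= big1 => [|i i0]; last by rewrite (negbTE i0) mul0r mulr0.
  have -> : \sum_i (x *m A) 0 i * (x 0 ord0 * davg q x i 0) = 0.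
    have E : (x *m A *m davg q x) 0 0 = 0 by rewrite davg_inv // mxE.
    rewrite mxE in E; rewrite -[RHS](mulr0 (x 0 ord0)) -[in RHS]E mulr_sumr.
    by apply: eq_bigr => i _; exact: mulrCA.
  by rewrite ?eqxx mulmx_cdiag mul1r !addr0 mulrAC.
rewrite (bigD1 j) //= big1 => [|i ij]; last by rewrite [dprim _ _ _ _]mxE (negbTE j0) (negbTE ij) mulr0.
by rewrite [dprim _ _ _ _]mxE (negbTE j0) eqxx mulr1 addr0 mulmx_cdiag.
Qed.

(** The derivative of the first component in the first direction is a Riemann
   sum of the derivative of [s u(s x_1, x')] with respect to [s]. *)
Lemma dprim_cvg x : nball 0 r x -> forall e : R, 0 < e -> exists N0, forall q, (N0 <= q)%N ->
  modulus (dprim q x ord0 ord0 - u x) <= e.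
Proof.
move=> bx e e0.
pose y (z : 'rV[C]_1) := x *m squeeze (z 0 0).
pose f (z : 'rV[C]_1) : 'rV[C]_1 := const_mx (z 0 0 * u (y z)).
pose Jf (z : 'rV[C]_1) : 'rV[C]_1 := const_mx (u (y z) + z 0 0 * (x 0 ord0 * J (y z) ord0 0)).
have by_ z : norm1 z <= 1 -> nball 0 r (y z).
  by move=> z1; apply: nball_squeeze bx; apply: le_trans z1; exact: norm1_coord.
have dy z : cdiff y z (x 0 ord0 *: delta_mx 0 ord0).
  move=> j; have [->|j0] := eqVneq j ord0.
    apply: rdiff_eqL (rdiff_near _ (rdiffZ (x 0 ord0) (vdiff_id z 0))) => [v|]; last first.
      by exists 1 => // w _; rewrite mulmx_cdiag eqxx.
    by rewrite mxE big_ord1 !mxE !eqxx mulr1 mulrC.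
  apply: rdiff_eqL (rdiff_near _ (rdiff_cst z (x 0 j))) => [v|]; last first.
    by exists 1 => // w _; rewrite mulmx_cdiag (negbTE j0) mulr1.
  by rewrite mxE big_ord1 !mxE eqxx (negbTE j0) !mulr0.
have [z z1|N0 hN0] := @riemann_sum R f Jf _ e e0.
  have du := rdiff_comp (dy z) (differentiable_const_mx (uJ (by_ z z1)).1).
  have cJ : ccont (fun w => J (y w) ord0 0) z.
    exact: ccont_comp (vdiff_vcont (dy z)) ((uJ (by_ z z1)).2 ord0 0).
  split=> j; rewrite (ord1 j).
    apply: rdiff_eqL (rdiff_near _ (rdiffM (vdiff_id z 0) du)) => [v|]; last first.
      by exists 1 => // w _; rewrite [RHS]mxE.
    rewrite [RHS]mxE big_ord1 [Jf z _ _]mxE mulrDr; congr (_ + _); rewrite [RHS]mulrCA; congr (_ * _).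
    rewrite -scalemxAr -scalemxAl mxE [RHS]mulrCA; congr (_ * _).
    rewrite mxE (bigD1 ord0) //= big1 => [|i i0].
      by rewrite mxE big_ord1 !mxE !eqxx mulr1 addr0.
    by rewrite mxE big_ord1 !mxE (negbTE i0) andbF mulr0 mul0r.
  rewrite (_ : (fun w => _) = fun w => u (y w) + w 0 0 * (x 0 ord0 * J (y w) ord0 0)); last first.
    by apply/funext => w; rewrite mxE.
  apply: ccontD; first exact: rdiff_ccont du.
  by apply: ccontM; [exact: vdiff_vcont (vdiff_id z) 0 | apply: ccontZ].
exists N0 => q hq; have := hN0 q hq.
have e1 : f (const_mx 1) = const_mx (u x).
  rewrite /f /y !mxE mul1r; congr const_mx; congr u.
  by apply/rowP => j; rewrite mulmx_cdiag; case: (j == ord0); rewrite mulr1.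
have e2 : f (const_mx 0) = 0 by rewrite /f !mxE mul0r; apply/rowP => j; rewrite !mxE.
have e3 : q.+1%:R^-1 *: (\sum_(i < q.+1) Jf (const_mx (rc (i%:R / q.+1%:R)))) = const_mx (dprim q x ord0 ord0).
  apply/rowP => j; rewrite (ord1 j) [LHS]mxE summxE [RHS]mxE [dprim _ _ _ _]mxE eqxx mul1r.
  rewrite [avg q x 0 0]mxE [davg q x ord0 0]mxE !summxE [x 0 ord0 * _]mulrCA -mulrDr; congr (_ * _).
  rewrite mulr_sumr -big_split; apply: eq_bigr => i _ /=.
  rewrite [Jf _ _ _]mxE [const_mx _ _ _]mxE /y [const_mx _ _ _]mxE; congr (_ + _).
  rewrite mulrCA; congr (_ * _); rewrite -/(node q i) {1}/squeeze /cdiag mul_diag_mx [RHS]mxE.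
  by rewrite [(\row__ _) _ _]mxE eqxx.
rewrite e1 e2 e3 subr0 => hb; apply: le_trans hb.
by rewrite /norm1 big_ord1 !mxE modulusB.
Qed.

(** The maps [prim q] intertwine [Z] with [diag(h)] because [u] is invariant, and
   the limit of a subsequence does so too. Its Jacobian is triangular: the columns
   other than the first are those of the identity, and the first diagonal entry
   is [u x] by [dprim_cvg]. *)
Lemma volume_coordinate : exists (s : R) (P : 'rV[C]_n -> 'rV[C]_n) G,
  [/\ 0 < s <= r, chol (nball 0 s) P G, P 0 = 0 & forall x, nball 0 s x ->
    \det (G x) = u x /\ x *m A *m G x = P x *m A].
Proof.
have b0 : nball 0 r (0 : 'rV[C]_n) by rewrite /nball /= subrr norm10.
have [d d0 hd] := rdiff_ccont (differentiable_const_mx (uJ b0).1) (@ltr01 R).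
pose r1 := Num.min d r; have r10 : 0 < r1 by rewrite lt_min d0 r0.
have r1r : r1 <= r by rewrite ge_min lexx orbT.
pose B := modulus (u 0) + 1; have B1 : 1 <= B by rewrite lerDr modulus_ge0.
have uB x : nball 0 r1 x -> modulus (u x) <= B.
  move=> bx; have /hd h1 : norm1 (x - 0) < d by apply: lt_le_trans bx _; rewrite ge_min lexx.
  rewrite -[u x](subrK (u 0)) addrC; apply: (le_trans (modulusD _ _)); rewrite lerD2l.
  exact: ltW.
have primB q x : nball 0 r1 x -> norm1 (prim q x) <= r1 * B.
  move=> bx; have avgB : modulus (avg q x 0 0) <= B.
    rewrite mxE summxE modulusM -rc_nat -rcV modulus_rc ger0_norm ?invr_ge0 //.
    rewrite ler_pdivrMl ?ltr0n //; apply: (le_trans (modulus_sum _ _ _)).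
    apply: (@le_trans _ _ (\sum_(i < q.+1) B)).
      apply: ler_sum => i _; rewrite mxE; apply: uB; rewrite /nball /= subr0.
      apply: le_lt_trans (norm1_squeeze x (node_le1 i)) _.
      by move: bx; rewrite /nball /= subr0.
    by rewrite big_const card_ord iter_addr addr0 mulr_natl.
  apply: (@le_trans _ _ (norm1 x * B)); last first.
    by rewrite ler_wpM2r ?(le_trans ler01) // ltW //; move: bx; rewrite /nball /= subr0.
  rewrite /norm1 mulr_suml; apply: ler_sum => j _; rewrite mxE.
  have [->|_] := eqVneq j ord0; first by rewrite modulusM ler_wpM2l ?modulus_ge0.
  by rewrite ler_peMr ?modulus_ge0.
have [P [G [PG lim]]] := montel r10 (fun q => cholS (fun x => @nball_le _ _ 0 _ _ x r1r) (prim_chol q)) primB.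
have s0 : 0 < r1 / 8 by rewrite divr_gt0.
have sr : r1 / 8 <= r.
  by apply: le_trans r1r; rewrite ler_pdivrMr // ler_peMr ?(ltW r10) // ler1n.
exists (r1 / 8), P, G; split=> //; first by rewrite s0 sr.
  apply/rowP => j; rewrite mxE; apply: (@eq0_modulus_le _ _ 1) => // e e0.
  have bs0 : nball 0 (r1 / 8) (0 : 'rV[C]_n) by rewrite /nball /= subrr norm10.
  have [q _ [h1 _]] := lim 0 bs0 e 0%N e0.
  have q0 : prim q 0 = 0.
    by apply/rowP => i; rewrite !mxE; case: (i == ord0); rewrite ?mul0r.
  rewrite mul1r; rewrite q0 sub0r norm1N in h1.
  by apply: le_trans (norm1_coord _ j) (ltW h1).
move=> x bx; have brx : nball 0 r x by exact: nball_le bx.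
have approx (e : R) q0 : 0 < e -> exists2 q, (q0 <= q)%N &
    (forall j, modulus (prim q x 0 j - P x 0 j) < e) /\
    (forall i j, modulus (dprim q x i j - G x i j) < e).
  move=> e0; have [q hq [h1 h2]] := lim x bx e q0 e0; exists q => //; split=> [j|i j].
    by have := norm1_coord (prim q x - P x) j; rewrite !mxE => /le_lt_trans; apply.
  have eB (U V : 'rV[C]_n) : (U - V) 0 j = U 0 j - V 0 j by rewrite !mxE.
  have := norm1_coord (row i (dprim q x) - row i (G x)) j.
  by rewrite eB ![row _ _ _ _]mxE => /le_lt_trans; apply.
have Gj i j : j != ord0 -> G x i j = (i == j)%:R.
  move=> j0; apply/eqP; rewrite -subr_eq0; apply/eqP; apply: (@eq0_modulus_le _ _ 1) => // e e0.
  have [q _ [_ h2]] := approx e 0%N e0; have := h2 i j.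
  by rewrite mxE (negbTE j0) modulusB mul1r => /ltW.
have G0 : G x ord0 ord0 = u x.
  apply/eqP; rewrite -subr_eq0; apply/eqP; apply: (@eq0_modulus_le _ _ 2) => // e e0.
  have [N0 hN] := dprim_cvg brx e0; have [q hq [_ h2]] := approx e N0 e0.
  have -> : G x ord0 ord0 - u x = - (dprim q x ord0 ord0 - G x ord0 ord0) + (dprim q x ord0 ord0 - u x) by ring.
  apply: (le_trans (modulusD _ _)); rewrite modulusN mulr_natl mulr2n; apply: lerD; last exact: hN.
  exact: ltW.
split.
  rewrite det_trig => [|]; last first.
    apply/is_trig_mxP => i j ij; have j0 : j != ord0 by apply: contraTneq ij => ->; rewrite ltn0.
    by rewrite Gj //; case: eqVneq ij => // ->; rewrite ltnn.
  rewrite (bigD1 ord0) //= G0 big1 ?mulr1 // => j j0.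
  by rewrite Gj // eqxx.
apply/rowP => j; apply/eqP; rewrite -subr_eq0; apply/eqP.
pose K := norm1 (x *m A) + modulus (rc (h j) : C).
apply: (@eq0_modulus_le _ _ K) => [|e e0]; first by rewrite addr_ge0 ?norm1_ge0 ?modulus_ge0.
have [q _ [h1 h2]] := approx e 0%N e0.
have := congr1 (fun w : 'rV[C]_n => w 0 j) (prim_inv q brx); rewrite /= mulmx_cdiag mxE => E.
have -> : (x *m A *m G x) 0 j - (P x *m A) 0 j =
   (\sum_i (x *m A) 0 i * (G x i j - dprim q x i j)) + (prim q x 0 j - P x 0 j) * rc (h j).
  rewrite mulmx_cdiag mulrBl -E mxE.
  under [X in _ = X + _]eq_bigr do rewrite mulrBr.
  by rewrite sumrB; ring.
apply: (le_trans (modulusD _ _)); rewrite /K [leRHS]mulrDl; apply: lerD; last first.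
  by rewrite modulusM mulrC ler_wpM2l ?modulus_ge0 // ltW.
apply: (le_trans (modulus_sum _ _ _)); rewrite /norm1 mulr_suml; apply: ler_sum => i _.
by rewrite modulusM ler_wpM2l ?modulus_ge0 // modulusB ltW.
Qed.

End VolumeCoordinate.

(** * The normal form *)

Theorem corollary2 (R : realType) (n : nat) (n_gt0 : (0 < n)%N)
    (M : complex_manifold R n) (Z : hol_vector_field M)
    (Ups : hol_volume_form M) (p : M) :
  singular_point Z p ->
  (exists (W : set M) (g : kahler_metric W) (f : M -> R),
     [/\ open W, W p, gradient_soliton g f,
         associated_vector_field g f Z & associated_volume_form g f Ups]) ->
  exists (h : 'rV[R]_n) (z : chart R n M),
    [/\ hol_chart z, cdom z p, cmap z p = 0 &
        forall x, cdom z x ->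
          vcomp Z z x = \row_i ((h 0 i)%:C * cmap z x 0 i) /\
          ucomp Ups z x = 1].
Proof.
case: n n_gt0 M Z Ups p => // k _ M Z Ups p sing [W [g [f [oW Wp soliton assoc vol]]]].
have [d [h [hd dp d0 lin]]] := linearizing_chart soliton assoc oW Wp sing.
have [r r0 hr] := chart_ball dp oW Wp; rewrite d0 in hr.
have linear x : nball 0 r x -> loc_field Z d x = x *m cdiag (fun j => rc (h j)).
  by move=> /hr[h1 _ h3]; rewrite /loc_field (lin _ h1).2 h3.
have [J [uJ u_inv]] := volume_invariant hd soliton assoc vol r0 hr linear.
have b0 : nball 0 r (0 : 'rV[Cx R]_k.+1) by rewrite /nball /= subrr norm10.
have u0 : loc_volume Ups d 0 != 0 by have [h1 _ _] := hr 0 b0; exact: ucomp_neq0.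
have [s [P [G [/andP[s0 sr] PG P0 PE]]]] := volume_coordinate r0 uJ u_inv.
have bs0 : nball 0 s (0 : 'rV[Cx R]_k.+1) by rewrite /nball /= subrr norm10.
have PG' : chol (nball (cmap d p) s) P G by rewrite d0.
have uG : G (cmap d p) \in unitmx.
  by rewrite unitmxE unitfE d0 (PE 0 bs0).1.
have [z [hz zp zE]] := change_chart hd dp oW Wp s0 PG' uG.
exists (\row_j h j), z; split=> // [|x zx]; first by have [_ _ _ -> _] := zE p zp; rewrite d0.
have [dx _ xs xE tJ] := zE x zx; rewrite d0 in xs.
have [detG invG] := PE _ xs; split.
  rewrite (vcomp_change Z hd hz dx zx) tJ (lin _ dx).2 invG -xE.
  by apply/rowP => j; rewrite mulmx_cdiag [RHS]mxE [(\row__ _) _ _]mxE mulrC.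
have := ucomp_change Ups hd hz dx zx; rewrite tJ detG /loc_volume cmapK //.
have n0 := ucomp_neq0 Ups hd dx.
by move/(congr1 (fun a => (ucomp Ups d x)^-1 * a)); rewrite mulKf // mulVf.
Qed.
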